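(* Let $(A,\mathfrak m)$ be an $\mathfrak m$-adically complete Noetherian local ring with infinite residue field $A/\mathfrak m$, let $d=\dim A$, and let $M$ be a finitely generated $A$-module with $\dim_A M=d\ge 3$. Suppose that $M$ is unmixed. Let $Q$ be a parameter ideal of $A$. Then the following conditions are equivalent: (1) $\mathrm{g}_s(Q;M)=\operatorname{hdeg}_Q(M)-\mathrm{e}_Q^0(M)-\mathrm{T}_Q^1(M)$; (2) $\mathrm{e}_Q^2(M)=\mathrm{T}_Q^2(M)$. When this is the case, the following hold: (i) $(-1)^i\mathrm{e}_Q^i(M)=\mathrm{T}_Q^i(M)$ for $3\le i\le d-1$, and $\mathrm{e}_Q^d(M)=0$; (ii) $\ell_A(M/Q^{n+1}M)=\sum_{i=0}^d(-1)^i\mathrm{e}_Q^i(M)\binom{n+d-i}{d-i}$ for all $n\ge0$; (iii) there exist elements $a_1,a_2,\ldots,a_d\in A$ such that $Q=(a_1,a_2,\ldots,a_d)$ and $a_1,a_2,\ldots,a_d$ forms a $d$-sequence on $M$; and (iv) $Q\,\mathrm{H}^i_{\mathfrak m}(M)=(0)$ for all $1\le i\le d-3$.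
   Context: Let $(A,\mathfrak m)$ be an $\mathfrak m$-adically complete Noetherian local ring with $d=\dim A>0$ and infinite residue field, let $\ell_A$ denote length, and let $E=\mathrm{E}_A(A/\mathfrak m)$ be the injective envelope of $A/\mathfrak m$. Let $\mathrm{H}^j_{\mathfrak m}$ denote local cohomology. For a finitely generated $A$-module $M$ and $j\in\mathbb Z$ put $M_j=\operatorname{Hom}_A(\mathrm{H}^j_{\mathfrak m}(M),E)$; this is a finitely generated $A$-module with $\dim_A M_j\le j$ (with $\dim_A(0)=-\infty$). A parameter ideal of $A$ is an ideal generated by a system of parameters of $A$ (i.e. an $\mathfrak m$-primary ideal generated by $d$ elements). Hilbert coefficients: for an $\mathfrak m$-primary ideal $I$ and a finitely generated $A$-module $M$ with $s=\dim_A M$, the integers $\mathrm{e}_I^i(M)$, $0\le i\le s$, are defined by $\ell_A(M/I^{n+1}M)=\sum_{i=0}^{s}(-1)^i\mathrm{e}_I^i(M)\binom{n+s-i}{s-i}$ for all $n\gg0$. Sectional genus: $\mathrm{g}_s(Q;M)=\ell_A(M/QM)-\mathrm{e}_Q^0(M)+\mathrm{e}_Q^1(M)$ (the subscript $s$ is part of the name). Homological degree: defined by induction on $s=\dim_A M$ by $\operatorname{hdeg}_I(M)=\ell_A(M)$ if $s\le 0$, and $\operatorname{hdeg}_I(M)=\mathrm{e}_I^0(M)+\sum_{j=0}^{s-1}\binom{s-1}{j}\operatorname{hdeg}_I(M_j)$ if $s>0$. Homological torsions: if $s=\dim_A M\ge2$, then for $1\le i\le s-1$, $\mathrm{T}_I^i(M)=\sum_{j=1}^{s-i}\binom{s-i-1}{j-1}\operatorname{hdeg}_I(M_j)$.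 $M$ is called unmixed if $\dim A/\mathfrak p=\dim_A M$ for all $\mathfrak p\in\operatorname{Ass}_A M$. A sequence $a_1,\ldots,a_d$ in $A$ is a $d$-sequence on $M$ if $[(a_1,\ldots,a_{i-1})M:_M a_ia_j]=[(a_1,\ldots,a_{i-1})M:_M a_j]$ for all $1\le i\le j\le d$. *)

(* Defs.v *)
From HB Require Import structures.
From mathcomp Require Import all_boot all_order all_algebra.
From mathcomp Require Import ring_quotient.
From mathcomp Require Import mathcomp_extra boolp classical_sets functions.
From mathcomp Require Import cardinality.

Set Implicit Arguments.
Unset Strict Implicit.
Unset Printing Implicit Defensive.

Import Order.TTheory GRing.Theory Num.Theory.
Local Open Scope classical_set_scope.
Local Open Scope ring_scope.

(* The largest n for which there is a strict chain c_0 < c_1 < ... < c_n of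
   members of P, or the junk value 0 if there is no such n. *)
Definition has_chain (T : Type) (P : set (set T)) (n : nat) : Prop :=
  exists c : nat -> set T,
    (forall i, (i <= n)%N -> P (c i)) /\
    (forall i, (i < n)%N -> c i `<` c i.+1).

Definition chain_length (T : Type) (P : set (set T)) : nat :=
  xget 0%N [set n | has_chain P n /\ ~ has_chain P n.+1].

Section Submodules.
Variables (A : comNzRingType) (V : lmodType A).

Definition is_submodule (N : set V) : Prop := submod_closed [in N].

Definition submod_span (S : set V) : set V :=
  [set x | forall N : set V, is_submodule N -> S `<=` N -> N x].

Definition submod_span_pred (S : set V) : pred V :=
  [pred x | `[< submod_span S x >]].

Lemma submod_span_closed (S : set V) : submod_closed (submod_span_pred S).
Proof.
split=> [|a x y].
  by apply: asboolT => N [N0 _] _; rewrite in_setE in N0.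
move=> /asboolW Sx /asboolW Sy; apply: asboolT => N NN SN.
have [_ Nlin] := NN.
by have := Nlin a x y; rewrite !in_setE; apply; [exact: Sx | exact: Sy].
Qed.

HB.instance Definition _ (S : set V) :=
  GRing.isSubmodClosed.Build A V (submod_span_pred S) (submod_span_closed S).

Lemma submod_span_submodule (S : set V) : is_submodule (submod_span S).
Proof.
have [S0 Slin] := submod_span_closed S; split=> [|a x y].
  by rewrite in_setE; exact: asboolW S0.
rewrite !in_setE => Sx Sy.
exact: asboolW (Slin a x y (asboolT Sx) (asboolT Sy)).
Qed.

Lemma sub_submod_span (S : set V) : S `<=` submod_span S.
Proof. by move=> x Sx N _; apply. Qed.

Lemma submod_span_id (N : set V) : is_submodule N -> submod_span N = N.
Proof.
move=> NN; apply/seteqP; split; last exact: sub_submod_span.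
by move=> x; apply.
Qed.

(* The submodule generated by S, as a module in its own right. *)
Record submod (S : set V) :=
  Submod { submod_val : V; _ : submod_span_pred S submod_val }.

HB.instance Definition _ (S : set V) := [isSub for @submod_val S].
HB.instance Definition _ (S : set V) := [Choice of submod S by <:].
HB.instance Definition _ (S : set V) :=
  [SubChoice_isSubLmodule of submod S by <:].

(* V / submod_span S. *)
Definition quotmod (S : set V) :=
  Quotient.quot (GRing.ZmodClosed.clone V (submod_span_pred S) _).
HB.instance Definition _ (S : set V) := GRing.Zmodule.on (quotmod S).

Section Quotient.
Variable S : set V.
Local Open Scope quotient_scope.

Definition quotmod_pi (x : V) : quotmod S := \pi x.
Definition quotmod_scale (a : A) (q : quotmod S) : quotmod S :=
  quotmod_pi (a *: repr q).

Lemma quotmod_eqP (x y : V) :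
  reflect (quotmod_pi x = quotmod_pi y) (x - y \in submod_span_pred S).
Proof. by rewrite Quotient.idealrBE; exact: eqP. Qed.

Lemma quotmod_reprK (q : quotmod S) : quotmod_pi (repr q) = q.
Proof. exact: reprK. Qed.

Lemma quotmod_piD x y : quotmod_pi (x + y) = quotmod_pi x + quotmod_pi y.
Proof. exact: raddfD. Qed.

Lemma quotmod_piZ a x : quotmod_pi (a *: x) = quotmod_scale a (quotmod_pi x).
Proof.
apply/quotmod_eqP; rewrite -scalerBr rpredZ //.
by apply/quotmod_eqP; rewrite quotmod_reprK.
Qed.

Fact quotmod_scaleA a b q :
  quotmod_scale a (quotmod_scale b q) = quotmod_scale (a * b) q.
Proof. by rewrite -[q]quotmod_reprK -!quotmod_piZ scalerA. Qed.
Fact quotmod_scale1 : left_id 1 quotmod_scale.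
Proof. by move=> q; rewrite -[q]quotmod_reprK -quotmod_piZ scale1r. Qed.
Fact quotmod_scaleDr : right_distributive quotmod_scale +%R.
Proof.
move=> a q r; rewrite -[q]quotmod_reprK -[r]quotmod_reprK -quotmod_piD.
by rewrite -!quotmod_piZ scalerDr quotmod_piD.
Qed.
Fact quotmod_scaleDl q : {morph quotmod_scale^~ q : a b / a + b}.
Proof.
move=> a b /=; rewrite -[q]quotmod_reprK -!quotmod_piZ scalerDl.
exact: quotmod_piD.
Qed.

HB.instance Definition _ := GRing.Zmodule_isLmodule.Build A (quotmod S)
  quotmod_scaleA quotmod_scale1 quotmod_scaleDr quotmod_scaleDl.

Fact quotmod_pi_linear : linear quotmod_pi.
Proof. by move=> a x y; rewrite quotmod_piD quotmod_piZ. Qed.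
HB.instance Definition _ :=
  GRing.isLinear.Build A V (quotmod S) _ quotmod_pi quotmod_pi_linear.

End Quotient.

Definition finitely_generated_submodule (N : set V) : Prop :=
  exists (n : nat) (g : 'I_n -> V), N = submod_span (range g).

Definition finitely_generated : Prop := finitely_generated_submodule setT.

Definition module_length : nat := chain_length is_submodule.

Definition annihilator : set A := [set a | forall x : V, a *: x = 0].

End Submodules.

Arguments finitely_generated {A} V.
Arguments module_length {A} V.
Arguments annihilator {A} V.

Section Hom.
Variables (A : comNzRingType) (U V : lmodType A).

(* Hom_A(U, V), as a submodule of the module of all functions U -> V. *)
Definition linear_pred : pred (U -> V) := [pred f | `[< linear f >]].

Lemma linear_submod_closed : submod_closed linear_pred.
Proof.
split=> [|a f g].
  apply: asboolT => b x y.
  by change ((0 : V) = b *: (0 : V) + (0 : V)); rewrite scaler0 addr0.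
move=> /asboolW lf /asboolW lg; apply: asboolT => b x y; rewrite !fctE lf lg.
by rewrite !scalerDr !scalerA [b * a]mulrC addrACA.
Qed.

HB.instance Definition _ :=
  GRing.isSubmodClosed.Build A (U -> V) linear_pred linear_submod_closed.

Record hom := Hom { hom_fun :> U -> V; _ : linear_pred hom_fun }.

HB.instance Definition _ := [isSub for hom_fun].
HB.instance Definition _ := [Choice of hom by <:].
HB.instance Definition _ := [SubChoice_isSubLmodule of hom by <:].

Lemma hom_linear (f : hom) : linear f.
Proof. exact: asboolW (valP f). Qed.

End Hom.

Section Rings.
Variable A : comNzRingType.

(* An ideal is a submodule of the regular module. *)
Definition ideal_span (S : set A) : set A := @submod_span A A^o S.
Definition is_ideal (J : set A) : Prop := @is_submodule A A^o J.
Definition ideal_mul (I J : set A) : set A :=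
  ideal_span [set a * b | a in I & b in J].
Fixpoint ideal_pow (I : set A) (n : nat) : set A :=
  if n is n'.+1 then ideal_mul I (ideal_pow I n') else setT.
Definition radical (J : set A) : set A := [set a | exists n, J (a ^+ n)].

Definition is_prime (p : set A) : Prop :=
  idealr_closed [in p] /\ prime_idealr_closed [in p].
Definition is_maximal (J : set A) : Prop :=
  idealr_closed [in J] /\
  forall J' : set A, idealr_closed [in J'] -> J `<=` J' -> J' = J.
Definition is_local (m : set A) : Prop :=
  is_maximal m /\ forall J : set A, is_maximal J -> J = m.

Definition noetherian : Prop :=
  forall J : set A, is_ideal J -> @finitely_generated_submodule A A^o J.

(* The canonical map from A to the inverse limit of the A / m^n is bijective. *)
Definition adically_complete (m : set A) : Prop :=
  (forall x : A, (forall n, ideal_pow m n x) -> x = 0) /\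
  (forall u : nat -> A, (forall n, ideal_pow m n (u n.+1 - u n)) ->
     exists x : A, forall n, ideal_pow m n (x - u n)).

(* A / J as an A-module. *)
Definition cyclic_module (J : set A) : lmodType A := @quotmod A A^o J.

(* dim A / J. *)
Definition krull_dim (J : set A) : nat :=
  chain_length [set p | is_prime p /\ J `<=` p].

End Rings.

Arguments noetherian A : clear implicits.

(* dim N = dim A / Ann N.  The conventional value -oo on the zero module is
   replaced by 0: dimensions <= 0 are never distinguished below. *)
Definition module_dim (A : comNzRingType) (N : lmodType A) : nat :=
  krull_dim (annihilator N).

Section Modules.
Variables (A : comNzRingType) (N : lmodType A).

Definition ideal_smul (I : set A) : set N :=
  submod_span [set a *: x | a in I & x in [set: N]].

(* N / I N. *)
Definition mod_ideal (I : set A) : lmodType A := quotmod (ideal_smul I).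

Definition associated_prime (p : set A) : Prop :=
  is_prime p /\ exists x : N, p = [set a | a *: x = 0].

Definition unmixed : Prop :=
  forall p : set A, associated_prime p -> krull_dim p = module_dim N.

Definition d_sequence (d : nat) (a : 'I_d -> A) : Prop :=
  forall i j : 'I_d, (i <= j)%N ->
    let N_i := ideal_smul
      (ideal_span [set a k | k in [set k : 'I_d | (k < i)%N]]) in
    [set x : N | N_i ((a i * a j) *: x)] = [set x : N | N_i (a j *: x)].

Definition torsion (m : set A) : set N :=
  [set x | exists n, forall a, ideal_pow m n a -> a *: x = 0].

End Modules.

Arguments mod_ideal {A} N I.
Arguments unmixed {A} N.
Arguments d_sequence {A} N {d} a.
Arguments torsion {A} N m.

Definition parameter_ideal (A : comNzRingType) (m Q : set A) : Prop :=
  radical Q = m /\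
  exists a : 'I_(krull_dim [set (0 : A)]) -> A, Q = ideal_span (range a).

Section Injectives.
Variable A : comNzRingType.

Definition injective_module (E : lmodType A) : Prop :=
  forall (X Y : lmodType A) (i : {linear X -> Y}) (f : {linear X -> E}),
    injective i -> exists g : {linear Y -> E}, forall x, g (i x) = f x.

Definition injective_envelope (N E : lmodType A) : Prop :=
  injective_module E /\
  exists i : {linear N -> E}, injective i /\
    forall S : set E, is_submodule S -> S `&` range i = [set 0] -> S = [set 0].

Record injective_resolution (N : lmodType A) := InjectiveResolution {
  ir_obj : nat -> lmodType A;
  ir_d : forall n, {linear ir_obj n -> ir_obj n.+1};
  ir_aug : {linear N -> ir_obj 0%N};
  ir_injective : forall n, injective_module (ir_obj n);
  ir_aug_inj : injective ir_aug;
  ir_exact0 : forall x, ir_d 0%N x = 0 <-> range ir_aug x;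
  ir_exactS : forall n x, ir_d n.+1 x = 0 <-> range (ir_d n) x }.

End Injectives.

(* Over a local ring an injective envelope of the residue field provides
   injective resolutions of all modules. *)
Section EnoughInjectives.
Variables (A : comNzRingType) (m : set A) (E : lmodType A).
Hypothesis m_local : is_local m.
Hypothesis E_envelope : injective_envelope (cyclic_module m) E.

Lemma proper_sub_local (J : set A) : idealr_closed [in J] -> J `<=` m.
Proof.
move=> JI; pose P : set (set A) := [set X | X = set0 \/
  (idealr_closed [in X] /\ J `<=` X)].
have [F FP Ftot|X [PX Xmax]] := @Zorn_bigcup A P.
  case: (pselect (exists2 X, F X & exists x, X x)) => [[X0 FX0 [x0 X0x0]]|nF].
    have FI X x : F X -> X x -> idealr_closed [in X] /\ J `<=` X.
      by move=> /FP [->|].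
    have [X0I JX0] := FI _ _ FX0 X0x0; right; split; last first.
      by move=> x /JX0 X0x; exists X0.
    split.
    - by rewrite in_setE; exists X0 => //; case: X0I; rewrite in_setE.
    - apply/negP; rewrite in_setE => -[X FX X1].
      by have [[_ /negP + _] _] := FI _ _ FX X1; rewrite in_setE.
    - move=> a x y; rewrite !in_setE => -[X FX Xx] [Y FY Yy].
      have [XY|YX] := Ftot _ _ FX FY.
        have [[_ _ H] _] := FI _ _ FY Yy; exists Y => //.
        by have := H a x y; rewrite !in_setE; apply => //; exact: XY.
      have [[_ _ H] _] := FI _ _ FX Xx; exists X => //.
      by have := H a x y; rewrite !in_setE; apply => //; exact: YX.
  left; apply/seteqP; split => // x [X FX Xx].
  by apply: nF; exists X => //; exists x.
have [XI JX] : idealr_closed [in X] /\ J `<=` X.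
  case: PX => // X0; exfalso.
  apply: (Xmax J); last by right; split.
  rewrite X0 properEneq; split => //; apply/eqP => J0.
  by case: JI; rewrite -J0 in_setE.
have /(m_local.2 X) <- // : is_maximal X; split=> // Y YI XY.
apply: contrapT => /eqP YX; apply: (Xmax Y); last first.
  by right; split=> // x /JX /XY.
by rewrite properEneq; split => //; rewrite eq_sym.
Qed.

Lemma quotmod_lift (V W : lmodType A) (S : set V) (g : {linear V -> W}) :
  (forall x, S x -> g x = 0) ->
  exists h : {linear quotmod S -> W}, forall x, h (quotmod_pi S x) = g x.
Proof.
move=> gS; pose K : set V := [set x | g x = 0].
have KK : is_submodule K.
  split=> [|a x y]; rewrite !in_setE /K /= ?linear0 //.
  by move=> gx gy; rewrite linearP gx gy scaler0 addr0.
pose h (q : quotmod S) : W := g (repr q).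
have hpi x : h (quotmod_pi S x) = g x.
  apply/eqP; rewrite -subr_eq0 /h -linearB; apply/eqP.
  have /asboolW : repr (quotmod_pi S x) - x \in submod_span_pred S.
    by apply/quotmod_eqP; rewrite quotmod_reprK.
  by move=> /(_ K KK gS).
have hlin : linear h.
  move=> a q r; rewrite -[q]quotmod_reprK -[r]quotmod_reprK -linearP.
  by rewrite !hpi linearP.
pose hl : {linear quotmod S -> W} :=
  HB.pack h (GRing.isLinear.Build _ _ _ _ h hlin).
by exists hl.
Qed.

Lemma quotmod_pi0P (V : lmodType A) (S : set V) : is_submodule S ->
  forall x, quotmod_pi S x = 0 <-> S x.
Proof.
move=> SS x; split=> [|Sx].
  rewrite -(linear0 (quotmod_pi S)) => /quotmod_eqP /asboolW.
  by rewrite subr0 submod_span_id.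
rewrite -(linear0 (quotmod_pi S)); apply/quotmod_eqP; apply: asboolT.
by rewrite subr0; exact: sub_submod_span.
Qed.

Lemma separating (N : lmodType A) (x : N) :
  x != 0 -> exists f : {linear N -> E}, f x != 0.
Proof.
move=> x0; have [Einj [i [iinj _]]] := E_envelope.
pose J : set A^o := [set a | a *: x = 0].
have JI : idealr_closed [in J].
  split; rewrite ?in_setE /J /= ?scale0r ?scale1r //.
    by apply/negP; rewrite in_setE /= scale1r; exact/eqP.
  move=> a u v; rewrite !in_setE /= => ux vx.
  by rewrite scalerDl -scalerA ux vx scaler0 addr0.
have JS : @is_submodule A A^o J.
  by case: JI => J0 _ JL; split => // a u v; exact: JL.
have mS : @is_submodule A A^o m.
  by case: m_local => -[[m0 _ mL] _] _; split => // a u v; exact: mL.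
pose g (a : A^o) : N := a *: x.
have glin : linear g by move=> a u v; rewrite /g scalerDl -scalerA.
pose gl : {linear A^o -> N} := HB.pack g (GRing.isLinear.Build _ _ _ _ g glin).
have [h hE] : exists h : {linear quotmod J -> N},
    forall a, h (quotmod_pi J a) = gl a by apply: quotmod_lift.
have [k kE] : exists k : {linear quotmod J -> cyclic_module m},
    forall a, k (quotmod_pi J a) = @quotmod_pi A A^o m a.
  apply: quotmod_lift => a Ja; apply/(quotmod_pi0P mS).
  exact: (proper_sub_local JI).
have hinj : injective h.
  move=> q r /eqP; rewrite -subr_eq0 -linearB -[q - r]quotmod_reprK hE => /eqP.
  move=> /(quotmod_pi0P JS); rewrite quotmod_reprK => /eqP.
  by rewrite subr_eq0 => /eqP.
have [f fE] := Einj _ _ h (i \o k) hinj.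
exists f; have := fE (quotmod_pi J 1); rewrite hE /= /g scale1r => ->.
rewrite kE; apply/eqP; rewrite -(linear0 i) => /iinj /(quotmod_pi0P mS) m1.
by case: m_local => -[[_ /negP + _] _] _; rewrite in_setE.
Qed.

(* The embedding of N into the product of copies of E indexed by its dual. *)
Definition cofree (N : lmodType A) : lmodType A := {linear N -> E} -> E.

Definition cofree_eval (N : lmodType A) (x : N) : cofree N := fun f => f x.

Fact cofree_eval_linear N : linear (@cofree_eval N).
Proof. by move=> a x y; apply: funext => f; rewrite /cofree_eval linearP. Qed.
HB.instance Definition _ N := GRing.isLinear.Build A N (cofree N) _
  (@cofree_eval N) (@cofree_eval_linear N).

Lemma cofree_eval_inj N : injective (@cofree_eval N).
Proof.
move=> x y xy; apply/eqP; rewrite -subr_eq0; apply: contrapT => /negP.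
move=> /separating [f]; rewrite linearB subr_eq0 => /eqP; apply.
exact: (congr1 (@^~ f) xy).
Qed.

Lemma cofree_injective N : injective_module (cofree N).
Proof.
have [Einj _] := E_envelope; move=> X Y i f iinj.
have comp (phi : {linear N -> E}) :
    exists g : {linear Y -> E}, forall x, g (i x) = f x phi.
  have flin : linear (fun x => f x phi).
    by move=> a x y; rewrite linearP.
  pose fl : {linear X -> E} := HB.pack (fun x => f x phi)
    (GRing.isLinear.Build _ _ _ _ (fun x => f x phi) flin).
  exact: (Einj _ _ i fl).
have [g gE] := choice comp.
pose G (y : Y) : cofree N := fun phi => g phi y.
have Glin : linear G.
  by move=> a x y; apply: funext => phi; rewrite /G linearP.
pose Gl : {linear Y -> cofree N} :=
  HB.pack G (GRing.isLinear.Build _ _ _ _ G Glin).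
by exists Gl => x; apply: funext => phi; exact: gE.
Qed.

Record stage := Stage { st_dom : lmodType A; st_cod : lmodType A;
  st_map : {linear st_dom -> st_cod}; st_inj : injective_module st_cod }.

Definition next_stage (s : stage) : stage :=
  @Stage (st_cod s) (cofree (quotmod (range (st_map s))))
    (@cofree_eval _ \o quotmod_pi (range (st_map s)))
    (@cofree_injective _).

Lemma next_stage_exact (s : stage) (x : st_cod s) :
  st_map (next_stage s) x = 0 <-> range (st_map s) x.
Proof.
have RS : is_submodule (range (st_map s)).
  split=> [|a u v]; rewrite !in_setE; first by exists 0; rewrite ?linear0.
  by move=> [u' _ <-] [v' _ <-]; exists (a *: u' + v'); rewrite ?linearP.
rewrite -(quotmod_pi0P RS) /=; split=> [|->]; last by rewrite linear0.
by rewrite -(linear0 (@cofree_eval _)) => /cofree_eval_inj.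
Qed.

Definition stages (N : lmodType A) (n : nat) : stage :=
  iter n next_stage (Stage (@cofree_eval N) (@cofree_injective N)).

Definition cofree_resolution (N : lmodType A) : injective_resolution N :=
  @InjectiveResolution A N (fun n => st_cod (stages N n))
    (fun n => st_map (stages N n.+1)) (@cofree_eval N)
    (fun n => @st_inj (stages N n)) (@cofree_eval_inj N)
    (@next_stage_exact (stages N 0))
    (fun n => @next_stage_exact (stages N n.+1)).

End EnoughInjectives.

Section LocalCohomology.
Variables (A : comNzRingType) (m : set A).

(* H^j_m(N) = H^j(Gamma_m(I)) for an injective resolution I of N. *)
Section Complex.
Variables (N : lmodType A) (I : injective_resolution N).

Definition cocycles (j : nat) : set (ir_obj I j) :=
  [set z | torsion (ir_obj I j) m z /\ ir_d I j z = 0].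

Definition coboundaries (j : nat) : set (submod (@cocycles j)) :=
  match j return set (submod (@cocycles j)) with
  | 0%N => [set 0]
  | i.+1 => [set z | exists2 y, torsion (ir_obj I i) m y & ir_d I i y = val z]
  end.

Definition cohomology_at (j : nat) : lmodType A := quotmod (@coboundaries j).

End Complex.

(* As usual for derived functors, an injective resolution of every module is
   fixed once and for all; cofree_resolution is one possible choice. *)
Variables (E : lmodType A).
Variables (res : forall N : lmodType A, injective_resolution N).

Definition local_cohomology (j : nat) (N : lmodType A) : lmodType A :=
  cohomology_at (res N) j.

(* The module written N_j in the theory of homological degrees. *)
Definition dual_cohomology (j : nat) (N : lmodType A) : lmodType A :=
  hom (local_cohomology j N) E.

Definition is_hilbert_coefs (I : set A) (N : lmodType A) (e : nat -> int) :=
  exists n0 : nat, forall n, (n0 <= n)%N ->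
    (module_length (mod_ideal N (ideal_pow I n.+1)))%:Z =
      \sum_(i < (module_dim N).+1)
        (-1) ^+ i * e i * 'C(n + (module_dim N - i), module_dim N - i)%:Z.

(* Meaningful for i <= module_dim N only. *)
Definition hilbert_coef (I : set A) (i : nat) (N : lmodType A) : int :=
  xget 0 [set c | exists e, is_hilbert_coefs I N e /\ e i = c].

Definition sectional_genus (Q : set A) (N : lmodType A) : int :=
  (module_length (mod_ideal N Q))%:Z - hilbert_coef Q 0 N + hilbert_coef Q 1 N.

(* The graph of hdeg_I; the recursion is well founded because
   dim N_j <= j < dim N for finitely generated N. *)
Inductive is_hdeg (I : set A) : lmodType A -> int -> Prop :=
| IsHdeg0 N : module_dim N = 0%N -> is_hdeg I N (module_length N)%:Z
| IsHdegS N (h : nat -> int) : (0 < module_dim N)%N ->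
    (forall j, (j < module_dim N)%N -> is_hdeg I (dual_cohomology j N) (h j)) ->
    is_hdeg I N (hilbert_coef I 0 N +
      \sum_(j < module_dim N) 'C((module_dim N).-1, j)%:Z * h j).

Definition hdeg (I : set A) (N : lmodType A) : int := xget 0 (is_hdeg I N).

Definition homological_torsion (I : set A) (i : nat) (N : lmodType A) : int :=
  \sum_(1 <= j < (module_dim N - i).+1)
    'C(module_dim N - i - 1, j - 1)%:Z * hdeg I (dual_cohomology j N).

End LocalCohomology.

(* Main.v *)
(** Choose a sequence u in Q, on the moment curve through generators of Q, any d
    terms of which generate Q; all but finitely many of its terms are as generic
    as needed. For a = u_n and N of depth > 0 and dimension s, put N' = (N/aN)
    modulo its m-torsion W. Up to W the Hilbert coefficients of N and N' agree,
    and the sequences 0 -> N_(j+1)/a -> (N/aN)_j -> 0:a in N_j -> 0 give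
    hdeg (N/aN)_j <= hdeg N_(j+1) + hdeg N_j, with equality only if a N_j = 0.
    By Pascal's rule these inequalities add up, by induction on s, to
    e_2 <= T^2 and to an upper bound on g_s(Q; N) which for N = M is
    hdeg M - e_0 - T^1. If the latter is an equality then so is the former.
    If e_2 = T^2 and N is unmixed, then Q N_1 = 0, so that Q carries the
    saturation U(y) of yN into yN for every regular y. A d-sequence on N/U(b),
    for another term b of u, then gives U(a) ∩ QN = aN, i.e. W ∩ Q(N/aN) = 0.
    Hence the bound on g_s is attained, d-sequences lift from N' to N, and the
    Hilbert function of N is the sum of that of N/aN. *)
Require Import Defs.
From HB Require Import structures.
From mathcomp Require Import all_boot all_order all_algebra.
From mathcomp Require Import boolp classical_sets functions cardinality.

Set Implicit Arguments.
Unset Strict Implicit.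
Unset Printing Implicit Defensive.

Import Order.TTheory GRing.Theory Num.Theory.
Local Open Scope classical_set_scope.
Local Open Scope ring_scope.

(** * Submodules and exact sequences *)

Section Submodules.
Variable A : comNzRingType.

Section OneModule.
Variable V : lmodType A.
Implicit Types (S T : set V).

(** The induction runs on pairs (N, I), where I lists the indices of the terms of u already divided
    out. They act as zero on N and |I| + dim N = d, so any dim N further terms generate Q on N, and
    the d-sequences found in the end generate Q. That (1) gives (2) needs a single generic term. The
    converse needs all large terms at once: Q N_1 = 0 is read off from d terms that each kill N_1,
    and comparing U(a) with U(b) takes two of them.

    The comparison of T^2(N) with T^2(N') involves (N/aN)_j for 1 <= j <= dim N - 3 only, whence the
    range in (iv). In dimension 3 there is nothing to compare: T^2(N) = hdeg N_1, and equality says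
    that N_1/aN_1 has length hdeg N_1, which would not force a N_1 = 0 if N_1 had dimension 1.
    Unmixedness excludes this through dim N_(j+1) <= j, a bound that N' inherits.

    That the N_j are Noetherian comes from Matlis duality: over a complete ring every endomorphism
    of E is a multiplication, so the dual of E is Noetherian, and local cohomology is reached from E
    by embeddings. *)

Lemma submoduleP S : is_submodule S <->
  S 0 /\ forall a x y, S x -> S y -> S (a *: x + y).
Proof.
split=> [[S0 SL]|[S0 SL]].
  split=> [|a x y Sx Sy]; first by rewrite in_setE in S0.
  by have := SL a x y; rewrite !in_setE; apply.
split=> [|a x y]; rewrite ?in_setE //; exact: SL.
Qed.

Lemma submod0 S : is_submodule S -> S 0.
Proof. by move=> /submoduleP []. Qed.

Lemma submodP S : is_submodule S ->
  forall a x y, S x -> S y -> S (a *: x + y).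
Proof. by move=> /submoduleP []. Qed.

Lemma submodZ S : is_submodule S -> forall a x, S x -> S (a *: x).
Proof.
by move=> HS a x Sx; rewrite -[_ *: _]addr0; apply: submodP => //; exact: submod0.
Qed.

Lemma submodD S : is_submodule S -> forall x y, S x -> S y -> S (x + y).
Proof. by move=> HS x y Sx Sy; rewrite -[x]scale1r; exact: submodP. Qed.

Lemma submodN S : is_submodule S -> forall x, S x -> S (- x).
Proof. by move=> HS x Sx; rewrite -scaleN1r; exact: submodZ. Qed.

Lemma submodB S : is_submodule S -> forall x y, S x -> S y -> S (x - y).
Proof. by move=> HS x y Sx Sy; apply: submodD => //; exact: submodN. Qed.

Lemma submod_sum S : is_submodule S -> forall (I : Type) (r : seq I) (P : pred I) (F : I -> V),
  (forall i, P i -> S (F i)) -> S (\sum_(i <- r | P i) F i).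
Proof.
move=> HS I r P F SF; elim/big_ind: _ => //; first exact: submod0.
exact: submodD.
Qed.

Lemma submodule_setT : is_submodule [set: V].
Proof. by apply/submoduleP. Qed.

Lemma submodule0 : is_submodule [set (0 : V)].
Proof. by apply/submoduleP; split=> // a x y /= -> ->; rewrite scaler0 addr0. Qed.

Lemma submoduleI S T : is_submodule S -> is_submodule T -> is_submodule (S `&` T).
Proof.
move=> HS HT; apply/submoduleP; split; first by split; exact: submod0.
by move=> a x y [Sx Tx] [Sy Ty]; split; exact: submodP.
Qed.

Definition addS S T : set V := [set x | exists y z, [/\ S y, T z & x = y + z]].

Lemma addS_submodule S T :
  is_submodule S -> is_submodule T -> is_submodule (addS S T).
Proof.
move=> HS HT; apply/submoduleP; split.
  by exists 0, 0; rewrite addr0; split=> //; exact: submod0.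
move=> a _ _ [y [z [Sy Tz ->]]] [y' [z' [Sy' Tz' ->]]].
exists (a *: y + y'), (a *: z + z'); split; [exact: submodP|exact: submodP|].
by rewrite scalerDr addrACA.
Qed.

Lemma sub_addSl S T : is_submodule T -> S `<=` addS S T.
Proof. by move=> HT x Sx; exists x, 0; rewrite addr0; split=> //; exact: submod0. Qed.

Lemma sub_addSr S T : is_submodule S -> T `<=` addS S T.
Proof. by move=> HS x Sx; exists 0, x; rewrite add0r; split=> //; exact: submod0. Qed.

Lemma addS_sub S T R : is_submodule R -> S `<=` R -> T `<=` R -> addS S T `<=` R.
Proof. by move=> HR SR TR _ [y [z [/SR Ry /TR Rz ->]]]; exact: submodD. Qed.

Lemma addSS S T S' T' : S `<=` S' -> T `<=` T' -> addS S T `<=` addS S' T'.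
Proof. by move=> SS TT _ [y [z [/SS Sy /TT Tz ->]]]; exists y, z. Qed.

Definition scS (a : A) S : set V := [set a *: x | x in S].

Lemma scS_submodule a S : is_submodule S -> is_submodule (scS a S).
Proof.
move=> HS; apply/submoduleP; split; first by exists 0; rewrite ?scaler0 //; exact: submod0.
move=> b _ _ [x Sx <-] [y Sy <-]; exists (b *: x + y); first exact: submodP.
by rewrite scalerDr !scalerA mulrC.
Qed.

Lemma submod_span_min S T : is_submodule T -> S `<=` T -> submod_span S `<=` T.
Proof. by move=> HT ST x Sx; exact: Sx. Qed.

Lemma eq_pi_sub S : is_submodule S -> forall x y : V,
  quotmod_pi S x = quotmod_pi S y <-> S (x - y).
Proof.
move=> HS x y; rewrite -(quotmod_pi0P HS) linearB /=; split=> [->|/eqP]; first by rewrite subrr.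
by rewrite subr_eq0 => /eqP.
Qed.

Lemma quotmod_surj S (q : quotmod S) : exists x, quotmod_pi S x = q.
Proof. by exists (generic_quotient.repr q); exact: quotmod_reprK. Qed.

End OneModule.

(** Most maps below come out of [choice] as bare functions with a proof of linearity; this bundles
    them. *)
Lemma lin_ex (U V : lmodType A) (f : U -> V) :
  linear f -> exists g : {linear U -> V}, forall x, g x = f x.
Proof.
move=> fl; pose g : {linear U -> V} := HB.pack f (GRing.isLinear.Build _ _ _ _ f fl).
by exists g.
Qed.

Section Exactness.
Variables (X Y Z : lmodType A).

Definition inj0 (U V : lmodType A) (f : {linear U -> V}) := forall x, f x = 0 -> x = 0.
Definition onto (U V : lmodType A) (f : {linear U -> V}) := forall y, exists x, f x = y.
Definition exact_at (f : {linear X -> Y}) (g : {linear Y -> Z}) :=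
  forall y, g y = 0 <-> exists x, f x = y.
Definition ses (f : {linear X -> Y}) (g : {linear Y -> Z}) :=
  [/\ inj0 f, exact_at f g & onto g].

Lemma inj0P (U V : lmodType A) (f : {linear U -> V}) : inj0 f <-> injective f.
Proof.
split=> [f0 x y /eqP|fi x]; last by rewrite -(linear0 f) => /fi.
by rewrite -subr_eq0 -linearB => /eqP /f0 /eqP; rewrite subr_eq0 => /eqP.
Qed.

Lemma image_submodule (U V : lmodType A) (f : {linear U -> V}) S :
  is_submodule S -> is_submodule (f @` S).
Proof.
move=> HS; apply/submoduleP; split; first by exists 0; rewrite ?linear0 //; exact: submod0.
by move=> a _ _ [x Sx <-] [y Sy <-]; exists (a *: x + y); rewrite ?linearP //; exact: submodP.
Qed.

Lemma range_submodule (U V : lmodType A) (f : {linear U -> V}) : is_submodule (range f).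
Proof. exact: (image_submodule f (@submodule_setT U)). Qed.

Lemma preimage_submodule (U V : lmodType A) (f : {linear U -> V}) S :
  is_submodule S -> is_submodule (f @^-1` S).
Proof.
move=> HS; apply/submoduleP; rewrite /= linear0; split; first exact: submod0.
by move=> a x y /= Sx Sy; rewrite linearP; exact: submodP.
Qed.

End Exactness.

Definition ker (U V : lmodType A) (f : {linear U -> V}) : set U := [set x | f x = 0].

Lemma ker_submodule (U V : lmodType A) (f : {linear U -> V}) : is_submodule (ker f).
Proof. exact: (preimage_submodule f (@submodule0 V)). Qed.

Definition iso (U V : lmodType A) := exists f : {linear U -> V}, inj0 f /\ onto f.

Lemma iso_refl U : iso U U.
Proof. by have [g gE] := @lin_ex U U id (fun a x y => erefl); exists g; split=> [x|x]; [rewrite gE|exists x]. Qed.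

Lemma iso_sym U V : iso U V -> iso V U.
Proof.
move=> [f [fi fs]]; have [g gE] := choice fs.
have /lin_ex [h hE] : linear g.
  move=> a x y; apply/(inj0P f).1 => //.
  by rewrite linearP !gE.
exists h; split=> [x|y]; first by rewrite hE => gx; rewrite -(gE x) gx linear0.
by exists (f y); rewrite hE; apply/(inj0P f).1 => //; rewrite gE.
Qed.

Section SubQuot.
Variables (V : lmodType A).

(** [submod S] is the type of the span of S; for a submodule S its elements are those of S. *)
Lemma submod_mem (S : set V) : is_submodule S ->
  forall x, S x -> exists z : submod S, \val z = x.
Proof.
move=> HS x Sx; have P : submod_span_pred S x by apply/asboolP; exact: sub_submod_span.
by exists (Submod P).
Qed.

Lemma submod_valP (S : set V) : is_submodule S -> forall z : submod S, S (\val z).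
Proof. by move=> HS [x Sx] /=; move/asboolP: Sx; rewrite submod_span_id. Qed.

Definition subval (S : set V) : {linear submod S -> V} := \val.
Definition qpi (S : set V) : {linear V -> quotmod S} := quotmod_pi S.

Lemma subvalE S (z : submod S) : subval S z = \val z. Proof. by []. Qed.

Lemma ker_qpi S : is_submodule S -> forall x, qpi S x = 0 <-> S x.
Proof. exact: quotmod_pi0P. Qed.

Lemma surj_qpi S : onto (qpi S).
Proof. by move=> q; have [x] := quotmod_surj q; exists x. Qed.

Lemma inj0_subval (S : set V) : inj0 (subval S).
Proof. by move=> x x0; apply: val_inj; rewrite linear0. Qed.

Lemma range_subval S : is_submodule S -> forall x, S x <-> exists z, subval S z = x.
Proof.
move=> HS x; split; first exact: submod_mem.
by move=> [z <-]; exact: submod_valP.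
Qed.

Lemma ses_subquot S : is_submodule S -> ses (subval S) (qpi S).
Proof.
move=> HS; split; [exact: inj0_subval| |exact: surj_qpi].
by move=> y; rewrite ker_qpi // range_subval.
Qed.

Lemma submod_corestrict (U : lmodType A) (f : {linear U -> V}) S : is_submodule S ->
  (forall x, S (f x)) -> exists g : {linear U -> submod S}, forall x, \val (g x) = f x.
Proof.
move=> HS fS; have [g gE] := choice (fun x => submod_mem HS (fS x)).
have /lin_ex [h hE] : linear g.
  by move=> a x y; apply: val_inj; rewrite linearP /= !gE linearP.
by exists h => x; rewrite hE gE.
Qed.

Lemma iso_quot (W : lmodType A) (f : {linear V -> W}) S :
  onto f -> (forall x, f x = 0 <-> S x) -> iso (quotmod S) W.
Proof.
move=> fs kf; have HS : is_submodule S.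
  by have := ker_submodule f; congr is_submodule; apply/seteqP; split=> x /kf.
have [h hE] := quotmod_lift (fun x => (kf x).2).
exists h; split=> [q|w].
  have [x <-] := quotmod_surj q; rewrite hE => /kf.
  exact: (quotmod_pi0P HS x).2.
by have [x <-] := fs w; exists (qpi S x); rewrite hE.
Qed.

Lemma iso_sub (W : lmodType A) (f : {linear W -> V}) S : is_submodule S ->
  inj0 f -> (forall x, (exists w, f w = x) <-> S x) -> iso W (submod S).
Proof.
move=> HS fi rf.
have fS x : S (f x) by apply/rf; exists x.
have [g gE] := submod_corestrict HS fS.
exists g; split=> [x gx|z]; first by apply: fi; rewrite -gE gx linear0.
have /rf [w wz] := submod_valP HS z.
by exists w; apply: val_inj; rewrite gE.
Qed.

End SubQuot.

Lemma ses_iso2 (X Y Z : lmodType A) (f : {linear X -> Y}) (g : {linear Y -> Z}) : ses f g ->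
  iso (quotmod (range f)) Z.
Proof.
move=> [fi fg gs]; apply: (iso_quot (f := g)) => // y; rewrite fg.
by split=> [[x <-]|[x _ <-]]; exists x.
Qed.

End Submodules.

(** * Length and chain conditions *)

Section Chains.
Variables (T : Type) (P : set (set T)).

(** A chain read from its top: the recursion removes the largest member, which suits inductions on n
    better than a sequence of sets. *)
Fixpoint chain_to (N : set T) (n : nat) : Prop :=
  P N /\ if n is n'.+1 then exists2 N', N' `<` N & chain_to N' n' else True.

Lemma chain_to_top N n : chain_to N n -> P N.
Proof. by case: n => [|n] []. Qed.

Lemma has_chainP n : has_chain P n <-> exists N, chain_to N n.
Proof.
split=> [[c [cP cl]]|].
  exists (c n); have : (n <= n)%N by [].
  elim: {-2}n => [|k IH] kn; first by split=> //; exact: cP.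
  by split; [exact: cP|exists (c k); [exact: cl|apply: IH; exact: ltnW]].
suff H N : chain_to N n -> exists c : nat -> set T, [/\ c n = N,
    (forall i, (i <= n)%N -> P (c i)) & (forall i, (i < n)%N -> c i `<` c i.+1)].
  by move=> [N /H [c [_ c1 c2]]]; exists c.
elim: n N => [|n IH] N /=; first by move=> [PN _]; exists (fun=> N).
move=> [PN [N' lt /IH [c [cn c1 c2]]]].
exists (fun k => if (k <= n)%N then c k else N); split.
- by rewrite ltnn.
- by move=> i _; case: ifP => // /c1.
- move=> i; rewrite ltnS => i_n; rewrite i_n; case: ifP => [/c2 //|/negbT].
  rewrite -leqNgt => ni; have -> : i = n by apply/eqP; rewrite eqn_leq i_n.
  by rewrite cn.
Qed.

Lemma chain_to_le N N' n : chain_to N n -> N `<=` N' -> P N' -> chain_to N' n.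
Proof.
case: n => [|n] /= [PN H] NN' PN'; first by split.
split=> //; have [M MN cM] := H; exists M => //; split; first exact: subset_trans MN.1 NN'.
by move=> N'M; apply: MN.2; exact: subset_trans NN' N'M.
Qed.

Lemma has_chainS n : has_chain P n.+1 -> has_chain P n.
Proof. by move/has_chainP=> [N [_ [N' _ c]]]; apply/has_chainP; exists N'. Qed.

Lemma has_chain_le n k : (k <= n)%N -> has_chain P n -> has_chain P k.
Proof.
by move=> /subnK <-; elim: (n - k)%N => // i IH; rewrite addSn => /has_chainS.
Qed.

Definition fin_chain := exists n, ~ has_chain P n.

(** Bounded chains exclude the default value of [chain_length], which then is a true maximum. *)
Lemma chain_lengthP : fin_chain -> has_chain P 0 ->
  forall k, has_chain P k <-> (k <= chain_length P)%N.
Proof.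
move=> [n nP] P0.
have : exists2 k, has_chain P k & ~ has_chain P k.+1.
  apply: contrapT => H; apply: nP; elim: n => // n IH.
  by apply: contrapT => nP; apply: H; exists n.
move=> [k Pk nPk]; have : [set n | has_chain P n /\ ~ has_chain P n.+1] (chain_length P).
  by apply: (@xgetPex _ 0%N); exists k.
move=> [Pl nPl] i; split=> [Pi|il]; last exact: has_chain_le il Pl.
by rewrite leqNgt; apply/negP => li; apply: nPl; exact: has_chain_le li Pi.
Qed.

Lemma chain_length_unique n : has_chain P n -> ~ has_chain P n.+1 -> chain_length P = n.
Proof.
move=> Pn nPn; have H := chain_lengthP (ex_intro _ n.+1 nPn) (has_chain_le (leq0n n) Pn).
by apply/eqP; rewrite eqn_leq; apply/andP; split; [rewrite leqNgt; apply/negP => /H|apply/H].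
Qed.

End Chains.

Lemma nondec_stab (f : nat -> nat) b :
  (forall n, f n <= f n.+1)%N -> (forall n, f n <= b)%N ->
  exists N, forall n, (N <= n)%N -> f n = f N.
Proof.
move=> fS fb; have fm : {homo f : i j / (i <= j)%N}.
  by apply: homo_leq => //; exact: leq_trans.
apply: contrapT => H.
have K : forall k, exists n, (k <= f n)%N.
  elim=> [|k [n kn]]; first by exists 0%N.
  apply: contrapT => H'; apply: H; exists n => m nm; apply/eqP; rewrite eqn_leq; apply/andP; split; last exact: fm.
  by apply: leq_trans kn; rewrite leqNgt; apply/negP => km; apply: H'; exists m.
by have [n] := K b.+1; rewrite ltnNge fb.
Qed.

Section Length.
Variable A : comNzRingType.
Implicit Types X Y Z V : lmodType A.

(** A separate predicate is needed because [module_length] takes its default value 0 on modules of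
    infinite length. *)
Definition flen V := fin_chain (@is_submodule A V).
Definition schain V n := has_chain (@is_submodule A V) n.

Lemma schain0 V : schain V 0.
Proof. by apply/has_chainP; exists setT; split=> //; exact: submodule_setT. Qed.

Lemma lenP V : flen V -> forall k, schain V k <-> (k <= module_length V)%N.
Proof. by move=> fV; apply: chain_lengthP => //; exact: schain0. Qed.

Section SesLength.
Variables (X Y Z : lmodType A) (f : {linear X -> Y}) (g : {linear Y -> Z}).
Hypothesis fg : ses f g.

(** Nested submodules of Y with the same preimage in X and the same image in Z coincide, so every
    strict step of a chain stays strict on one of the two sides. *)
Lemma ses_chain_up n : schain Y n ->
  exists p q, [/\ (p + q = n)%N, schain X p & schain Z q].
Proof.
have [fi fgE gs] := fg.
suff H N : chain_to (@is_submodule A Y) N n -> exists p q, [/\ (p + q = n)%N,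
    chain_to (@is_submodule A X) (f @^-1` N) p & chain_to (@is_submodule A Z) (g @` N) q].
  move/has_chainP=> [N /H [p [q [pq cp cq]]]]; exists p, q.
  by split=> //; apply/has_chainP; [exists (f @^-1` N)|exists (g @` N)].
elim: n N => [|n IH] N /= [PN].
  move=> _; exists 0%N, 0%N; split=> //; split=> //.
    exact: preimage_submodule.
  exact: image_submodule.
move=> [N' [NN' nNN'] cN'].
have PN' := chain_to_top cN'.
have [p [q [<- cp cq]]] := IH _ cN'.
have fN : f @^-1` N' `<=` f @^-1` N by move=> x; exact: NN'.
have gN : g @` N' `<=` g @` N by move=> _ [x /NN' Nx <-]; exists x.
have [Hf|nf] := pselect (f @^-1` N `<=` f @^-1` N').
  exists p, q.+1; rewrite addnS; split=> //.
    by apply: chain_to_le cp _ _ => //; exact: preimage_submodule.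
  split; first exact: image_submodule.
  exists (g @` N') => //; split=> // gNN'; apply: nNN' => y Ny.
  have [z N'z gzy] : (g @` N') (g y) by apply: gNN'; exists y.
  have : g (y - z) = 0 by rewrite linearB gzy subrr.
  move=> /fgE [x xE]; have : N' (f x).
    by apply: Hf; rewrite /= xE; apply: submodB => //; exact: NN'.
  rewrite xE => N'd; rewrite -(subrK z y); exact: submodD.
exists p.+1, q; split=> //.
  by split; [exact: preimage_submodule|exists (f @^-1` N')].
by apply: chain_to_le cq _ _ => //; exact: image_submodule.
Qed.

(** The image of a chain of X is continued by the preimage of a chain of Z. *)
Lemma ses_chain_low p q : schain X p -> schain Z q -> schain Y (p + q).
Proof.
have [fi fgE gs] := fg.
have gf x : g (f x) = 0 by apply/fgE; exists x.
move=> /has_chainP [M cM] /has_chainP [K cK]; apply/has_chainP; exists (g @^-1` K).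
have cfM : chain_to (@is_submodule A Y) (f @` M) p.
  elim: p M cM => [|p IH] M /= [PM H]; split => //; try exact: image_submodule.
  have [M' [M'M nM'M] cM'] := H; exists (f @` M'); last exact: IH.
  split; first by move=> _ [x /M'M Mx <-]; exists x.
  move=> MM'; apply: nM'M => x Mx.
  have [x' M'x' /(inj0P f).1 <- //] : (f @` M') (f x) by apply: MM'; exists x.
elim: q K cK => [|q IH] K /= [PK H].
  rewrite addn0; apply: (chain_to_le cfM); last exact: preimage_submodule.
  by move=> _ [x _ <-] /=; rewrite gf; exact: submod0.
have [K' [K'K nK'K] /IH cK'] := H.
rewrite addnS; split; first exact: preimage_submodule.
exists (g @^-1` K') => //; split; first by move=> y /= /K'K.
move=> KK'; apply: nK'K => z Kz; have [y yz] := gs z.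
by move: Kz; rewrite -yz; exact: KK'.
Qed.

Lemma ses_flen : flen Y <-> flen X /\ flen Z.
Proof.
split=> [[n nY]|[[a na] [b nb]]].
  split; exists n => c; apply: nY.
    by have := ses_chain_low c (schain0 Z); rewrite addn0.
  by have := ses_chain_low (schain0 X) c.
exists (a + b)%N => /ses_chain_up [p [q [pq cp cq]]].
have [ap|pa] := leqP a p; first by apply: na; exact: has_chain_le ap cp.
by apply: nb; apply: has_chain_le cq; rewrite -(leq_add2l p) pq leq_add2r ltnW.
Qed.

Lemma ses_len : flen Y -> module_length Y = (module_length X + module_length Z)%N.
Proof.
move=> fY; have [fX fZ] := ses_flen.1 fY; apply/eqP; rewrite eqn_leq; apply/andP; split.
  have /ses_chain_up [p [q [<- cp cq]]] := (lenP fY _).2 (leqnn _).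
  by apply: leq_add; [exact/(lenP fX)|exact/(lenP fZ)].
by apply/(lenP fY)/ses_chain_low; [exact/(lenP fX)|exact/(lenP fZ)].
Qed.

End SesLength.

Lemma trivial_flen V : (forall x : V, x = 0) -> flen V /\ module_length V = 0%N.
Proof.
move=> V0; have n1 : ~ schain V 1.
  move=> /has_chainP [N [_ [N' [_ nN] [SN' _]]]]; apply: nN => x _; rewrite (V0 x).
  exact: submod0 SN'.
split; first by exists 1%N.
by apply: chain_length_unique => //; exact: schain0.
Qed.

Lemma ses_surj X Z (g : {linear X -> Z}) : onto g -> ses (subval (ker g)) g.
Proof.
move=> gs; split=> //; first exact: inj0_subval.
by move=> y; rewrite -(range_subval (ker_submodule g)).
Qed.

Lemma ses_inj X Y (f : {linear X -> Y}) : inj0 f -> ses f (qpi (range f)).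
Proof.
move=> fi; split=> //; last exact: surj_qpi.
move=> y; rewrite (ker_qpi (range_submodule f)).
by split=> [[x _ <-]|[x <-]]; exists x.
Qed.

Lemma len0 V : flen V -> module_length V = 0%N -> forall x : V, x = 0.
Proof.
move=> fV V0 x; apply: contrapT => x0.
have : schain V 1.
  apply/has_chainP; exists setT; split; first exact: submodule_setT.
  exists [set 0]; last by split=> //; exact: submodule0.
  by split=> // /(_ x I).
by move/(lenP fV); rewrite V0.
Qed.

Lemma inj_len X Y (f : {linear X -> Y}) : inj0 f -> flen Y ->
  [/\ flen X, (module_length X <= module_length Y)%N &
      (module_length Y <= module_length X)%N -> onto f].
Proof.
move=> fi fY; have s := ses_inj fi; have [fX fZ] := (ses_flen s).1 fY.
have l := ses_len s fY; split=> //; first by rewrite l leq_addr.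
rewrite l -[X in (_ <= X)%N]addn0 leq_add2l leqn0 => /eqP /(len0 fZ) Z0 y.
by have [x _ <-] : range f y; [apply/(ker_qpi (range_submodule f)); exact: Z0|exists x].
Qed.

Lemma surj_len X Y (f : {linear X -> Y}) : onto f -> flen X ->
  [/\ flen Y, (module_length Y <= module_length X)%N &
      (module_length X <= module_length Y)%N -> inj0 f].
Proof.
move=> fs fX; have s := ses_surj fs; have [fK fZ] := (ses_flen s).1 fX.
have l := ses_len s fX; split=> //; first by rewrite l leq_addl.
rewrite l -[X in (_ <= X)%N]add0n leq_add2r leqn0 => /eqP /(len0 fK) K0 x fx.
have [z <-] : exists z, subval (ker f) z = x by apply/(range_subval (ker_submodule f)).
by rewrite (K0 z) linear0.
Qed.

Lemma iso_flen U V : iso U V -> flen U -> flen V /\ module_length V = module_length U.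
Proof.
move=> [f [fi fs]] fU; have [fV le1 _] := surj_len fs fU; split=> //.
by have [_ le2 _] := inj_len fi fV; apply/eqP; rewrite eqn_leq le1.
Qed.

Lemma sub_flen V (S : set V) : flen V -> is_submodule S -> flen (submod S).
Proof. by move=> fV HS; have [] := inj_len (inj0_subval (S := S)) fV. Qed.

Lemma quot_flen V (S : set V) : flen V -> flen (quotmod S).
Proof. by move=> fV; have [] := surj_len (surj_qpi (S := S)) fV. Qed.

(* acc replaces finite generation: over a Noetherian ring the two agree. *)
Definition acc V := forall S : nat -> set V, (forall n, is_submodule (S n)) ->
  (forall n, S n `<=` S n.+1) -> exists N, forall n, (N <= n)%N -> S n `<=` S N.

Lemma inc_le V (S : nat -> set V) : (forall n, S n `<=` S n.+1) ->
  forall i j, (i <= j)%N -> S i `<=` S j.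
Proof.
move=> HS i j /subnK <-; elim: (j - i)%N => // k IH; rewrite addSn.
exact: subset_trans IH (HS _).
Qed.

Lemma ses_acc X Y Z (f : {linear X -> Y}) (g : {linear Y -> Z}) : ses f g ->
  acc Y <-> acc X /\ acc Z.
Proof.
move=> [fi fgE gs]; split=> [aY|[aX aZ] S HS SS].
  split=> S HS SS.
    have [|n|N SN] := aY (fun n => f @` S n).
    - by move=> n; exact: image_submodule.
    - by move=> _ [x /SS Sx <-]; exists x.
    exists N => n Nn x Sx; have [|x' Sx' /(inj0P f).1 <- //] := SN _ Nn (f x).
    by exists x.
  have [|n|N SN] := aY (fun n => g @^-1` S n).
  - by move=> n; exact: preimage_submodule.
  - by move=> y; exact: SS.
  exists N => n Nn z; have [y <-] := gs z; exact: SN.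
have [n|n|N1 H1] := aX (fun n => f @^-1` S n).
- exact: preimage_submodule.
- by move=> x; exact: SS.
have [n|n|N2 H2] := aZ (fun n => g @` S n).
- exact: image_submodule.
- by move=> _ [x /SS Sx <-]; exists x.
exists (maxn N1 N2) => n; rewrite geq_max => /andP [n1 n2] y Sy.
have [|z Sz gzy] := H2 _ n2 (g y); first by exists y.
have : g (y - z) = 0 by rewrite linearB gzy subrr.
move=> /fgE [x xE]; rewrite -(subrK z y); apply: submodD => //; last first.
  by apply: (inc_le SS) Sz; exact: leq_maxr.
apply: (inc_le SS (leq_maxl N1 N2)); rewrite -xE; apply: (H1 n n1).
by rewrite /= xE; apply: submodB => //; exact: (inc_le SS n2).
Qed.

Lemma acc_inj X Y (f : {linear X -> Y}) : inj0 f -> acc Y -> acc X.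
Proof. by move=> /ses_inj /ses_acc H /H []. Qed.

Lemma acc_surj X Y (f : {linear X -> Y}) : onto f -> acc X -> acc Y.
Proof. by move=> /ses_surj /ses_acc H /H []. Qed.

Lemma acc_sub V (S : set V) : acc V -> acc (submod S).
Proof. exact: acc_inj (inj0_subval (S := S)). Qed.

Lemma acc_quot V (S : set V) : acc V -> acc (quotmod S).
Proof. exact: acc_surj (surj_qpi (S := S)). Qed.

Lemma acc_iso U V : iso U V -> acc U -> acc V.
Proof. by move=> [f [_ fs]]; exact: acc_surj fs. Qed.

(** The lengths of the members of an ascending chain are bounded, hence eventually constant, and an
    inclusion of submodules of equal finite length is onto. *)
Lemma flen_acc V : flen V -> acc V.
Proof.
move=> fV S HS SS.
have incl i j : (i <= j)%N -> exists f : {linear submod (S i) -> submod (S j)},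
    forall x, \val (f x) = \val x.
  move=> ij; apply: (submod_corestrict (f := subval (S i))) => // x.
  by apply: (inc_le SS ij); exact: submod_valP.
have inj i j (f : {linear submod (S i) -> submod (S j)}) :
    (forall x, \val (f x) = \val x) -> inj0 f.
  by move=> fE x fx; apply: val_inj; rewrite -fE fx.
have [|n|N HN] := @nondec_stab (fun n => module_length (submod (S n))) (module_length V).
- move=> n; have [f fE] := incl _ _ (leqnSn n).
  by have [] := inj_len (inj _ _ _ fE) (sub_flen fV (HS _)).
- by have [] := inj_len (inj0_subval (S := S n)) fV.
exists N => n Nn x Sx; have [f fE] := incl _ _ Nn.
have [_ _] := inj_len (inj _ _ _ fE) (sub_flen fV (HS _)).
rewrite HN // => /(_ (leqnn _)) fs.
have [z zx] := submod_mem (HS n) Sx; have [y yz] := fs z.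
by rewrite -zx -yz fE; exact: submod_valP.
Qed.

Definition line V (x : V) : set V := range (fun a : A => a *: x).

Lemma line_submodule V (x : V) : is_submodule (line x).
Proof.
apply/submoduleP; split; first by exists 0; rewrite ?scale0r.
by move=> a _ _ [b _ <-] [c _ <-]; exists (a * b + c); rewrite // scalerDl scalerA.
Qed.

Fixpoint lspan V (s : seq V) : set V :=
  if s is x :: s' then addS (line x) (lspan s') else [set 0].

Lemma lspan_submodule V (s : seq V) : is_submodule (lspan s).
Proof.
elim: s => [|x s IH] /=; first exact: submodule0.
by apply: addS_submodule => //; exact: line_submodule.
Qed.

Lemma lspan_mem V (s : seq V) x : x \in s -> lspan s x.
Proof.
elim: s => [//|y s IH]; rewrite inE => /orP [/eqP ->|/IH xs] /=.
  by apply: sub_addSl; [exact: lspan_submodule|exists 1; rewrite ?scale1r].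
by apply: sub_addSr => //; exact: line_submodule.
Qed.

Lemma lspan_min V (s : seq V) (S : set V) : is_submodule S ->
  (forall x, x \in s -> S x) -> lspan s `<=` S.
Proof.
move=> HS; elim: s => [|x s IH] sS /=; first by move=> _ ->; exact: submod0.
apply: addS_sub => //.
  by move=> _ [a _ <-]; apply: submodZ => //; apply: sS; rewrite mem_head.
by apply: IH => y ys; apply: sS; rewrite inE ys orbT.
Qed.

(** Otherwise a vector outside the span of the current list could be added forever. *)
Lemma acc_fg V (S : set V) : acc V -> is_submodule S ->
  exists2 s : seq V, (forall x, x \in s -> S x) & lspan s = S.
Proof.
move=> aV HS; apply: contrapT => H.
have step (s : {s : seq V | forall x, x \in s -> S x}) :
    exists x, S x /\ ~ lspan (sval s) x.
  case: s => s sS /=; apply: contrapT => H'; apply: H; exists s => //.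
  apply/seteqP; split; first exact: lspan_min.
  by move=> x Sx; apply: contrapT => nx; apply: H'; exists x.
have [g gP] := choice step.
have nextP (s : {s : seq V | forall x, x \in s -> S x}) :
    forall x, x \in g s :: sval s -> S x.
  move=> x; rewrite inE => /orP [/eqP ->|]; first by have [] := gP s.
  exact: (proj2_sig s).
pose next s : {s : seq V | forall x, x \in s -> S x} :=
  exist (fun s : seq V => forall x, x \in s -> S x) (g s :: sval s) (nextP s).
have s0 : {s : seq V | forall x, x \in s -> S x} by exists [::].
pose t n := iter n next s0.
have [n|n|N HN] := aV (fun n => lspan (sval (t n))).
- exact: lspan_submodule.
- by move=> x /= sx; apply: sub_addSr => //; exact: line_submodule.
have [_] := gP (t N); apply; apply: (HN N.+1) => //=.
by apply: sub_addSl; [exact: lspan_submodule|exists 1; rewrite ?scale1r].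
Qed.

Lemma acc_lspan V (s : seq V) : acc (A^o : lmodType A) -> lspan s = setT -> acc V.
Proof.
move=> aA; have [n] := ubnP (size s); elim: n V s => [//|n IH] V [|x s] /= sn sT.
  apply: flen_acc; have [] // := @trivial_flen V.
  by move=> y; have : [set: V] y by []; rewrite -sT.
apply: (ses_acc (ses_subquot (line_submodule x))).2; split.
  have gl : linear (fun a : A^o => a *: x) by move=> a b c; rewrite scalerDl -scalerA.
  have [g gE] := lin_ex gl.
  have gx a : line x (g a) by exists a.
  have [h hE] := submod_corestrict (line_submodule x) gx.
  apply: (acc_surj (f := h)) aA => z.
  have [a _ az] := submod_valP (line_submodule x) z.
  by exists a; apply: val_inj; rewrite hE gE.
apply: (IH _ [seq qpi (line x) y | y <- s]); first by rewrite size_map.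
apply/seteqP; split=> // q _; have [y <-] := surj_qpi q.
have [y1 [y2 [y1x y2s ->]]] : addS (line x) (lspan s) y by rewrite sT.
rewrite linearD ((ker_qpi (line_submodule x) _).2 y1x) add0r.
move: y2 y2s; elim: {sT IH sn} s => [|z s IH] y2 /=.
  by move=> ->; rewrite linear0.
move=> [_ [w [[a _ <-] /IH ws ->]]]; rewrite linearD linearZ.
by exists (a *: qpi (line x) z), (qpi (line x) w); split=> //; exists a.
Qed.

Lemma noetherian_acc : noetherian A -> acc (A^o : lmodType A).
Proof.
move=> nA S HS SS; pose U : set A^o := [set a | exists n, S n a].
have HU : is_submodule U.
  apply/submoduleP; split; first by exists 0%N; exact: submod0.
  move=> a x y [i Si] [j Sj]; exists (maxn i j).
  by apply: submodP => //; [exact: (inc_le SS (leq_maxl i j))|exact: (inc_le SS (leq_maxr i j))].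
have [k [g gU]] := nA U HU.
have gS i : exists n, S n (g i).
  by have : U (g i) by rewrite gU; apply: sub_submod_span; exists i.
have [f fS] := choice gS; exists (\max_(i < k) f i) => n _ x Sx.
have : U x by exists n.
rewrite gU; apply: submod_span_min => // _ [i _ <-].
by apply: (inc_le SS _) (fS i); exact: leq_bigmax.
Qed.

Lemma fg_acc V : noetherian A -> finitely_generated V -> acc V.
Proof.
move=> nA [k [g gV]]; apply: (acc_lspan (s := [seq g i | i <- enum 'I_k])).
  exact: noetherian_acc.
apply/seteqP; split=> // x _; have : [set: V] x by []; rewrite gV.
apply: submod_span_min; first exact: lspan_submodule.
by move=> _ [i _ <-]; apply: lspan_mem; apply: map_f; rewrite mem_enum.
Qed.

Lemma ideal_smul_submodule V (I : set A) : is_submodule (ideal_smul (N := V) I).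
Proof. exact: submod_span_submodule. Qed.

Lemma ideal_smul_mem V (I : set A) a (x : V) : I a -> ideal_smul (N := V) I (a *: x).
Proof. by move=> Ia; apply: sub_submod_span; exists a => //; exists x. Qed.

Lemma ideal_smul_min V (I : set A) (S : set V) : is_submodule S ->
  (forall a x, I a -> S (a *: x)) -> ideal_smul (N := V) I `<=` S.
Proof. by move=> HS H; apply: submod_span_min => // _ [a Ia [x _ <-]]; exact: H. Qed.

Section Local.
Variables (m : set A) (m_local : is_local m).

Lemma local_ideal : is_submodule (m : set A^o).
Proof. by case: m_local => -[[m0 _ mL] _] _; split => // a u v; exact: mL. Qed.

Lemma local_not1 : ~ m 1.
Proof. by case: m_local => -[[_ /negP + _] _] _; rewrite in_setE. Qed.

Lemma local_inv x : ~ m x -> exists y, y * x = 1.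
Proof.
move=> mx; apply: contrapT => H; apply: mx.
pose J : set A := [set y | exists z, z * x = y].
apply: (proper_sub_local m_local (J := J)); last by exists 1; rewrite mul1r.
split; rewrite ?in_setE.
- by exists 0; rewrite mul0r.
- by apply/negP; rewrite in_setE.
- move=> a y z; rewrite !in_setE => -[b <-] [c <-].
  by exists (a * b + c); rewrite mulrDl mulrA.
Qed.

Lemma local_1sub a : m a -> exists y, y * (1 - a) = 1.
Proof.
move=> ma; apply: local_inv => m1; apply: local_not1.
by rewrite -(subrK a 1); exact: (submodD local_ideal m1 ma).
Qed.

(** Generators are discarded one at a time. Modulo N and the remaining ones, V = mV gives x = ax
    with a in m for the generator x at hand, and 1 - a is a unit. *)
Lemma nakayama V (N : set V) : acc V -> is_submodule N ->
  (forall x, addS N (ideal_smul m) x) -> forall x, N x.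
Proof.
move=> aV HN HV; have [s _ sT] := acc_fg aV (@submodule_setT A V).
have : forall x, addS N (lspan s) x.
  by move=> x; apply: sub_addSr => //; rewrite sT.
elim: s {sT} => [|x s IH] /= Hs.
  by move=> y; have [u [v [Nu -> ->]]] := Hs y; rewrite addr0.
apply: IH; set N' := addS N (lspan s).
have HN' : is_submodule N' by apply: addS_submodule => //; exact: lspan_submodule.
have decomp y : exists n b, N' n /\ y = n + b *: x.
  have [u [_ [Nu [_ [v [[b _ <-] vs ->]] ->]]]] := Hs y.
  by exists (u + v), b; split; [exists u, v|rewrite [b *: x + v]addrC addrA].
suff N'x : N' x.
  by move=> y; have [n [b [N'n ->]]] := decomp y; apply: submodD => //; exact: submodZ.
pose R : set V := [set y | exists n a, [/\ N' n, m a & y = n + a *: x]].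
have HR : is_submodule R.
  apply/submoduleP; split.
    by exists 0, 0; rewrite scale0r addr0; split=> //; [exact: submod0|exact: (submod0 local_ideal)].
  move=> c _ _ [n1 [a1 [N1 m1 ->]]] [n2 [a2 [N2 m2 ->]]].
  exists (c *: n1 + n2), (c * a1 + a2); split; first exact: submodP.
    exact: (submodP local_ideal).
  by rewrite scalerDr addrACA scalerDl scalerA.
have : R x.
  have [n [y [Nn my ->]]] := HV x; apply: submodD => //.
    exists n, 0; rewrite scale0r addr0; split=> //; last exact: (submod0 local_ideal).
    by apply: sub_addSl => //; exact: lspan_submodule.
  apply: ideal_smul_min my => // a z ma; have [n' [b [N'n' ->]]] := decomp z.
  exists (a *: n'), (a * b); split; first exact: submodZ.
    by rewrite mulrC; exact: (submodZ local_ideal).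
  by rewrite scalerDr scalerA.
move=> [n [a [N'n ma xE]]]; have [y y1] := local_1sub ma.
rewrite -[x]scale1r -y1 -scalerA; apply: submodZ => //.
by rewrite scalerBl scale1r {1}xE addrK.
Qed.

End Local.

End Length.

(** * Artin-Rees, generic and superficial elements *)

Section GradedNoetherian.
Variables (A : comNzRingType) (X : lmodType A).
Hypothesis accX : acc X.
Implicit Types (S T : set X) (B G H : nat -> set X) (s : seq A).

Fixpoint mulS s T : set X :=
  if s is a :: s' then addS (scS a T) (mulS s' T) else [set 0].

Lemma mulS_submodule s T : is_submodule T -> is_submodule (mulS s T).
Proof.
move=> HT; elim: s => [|a s IH] /=; first exact: submodule0.
by apply: addS_submodule => //; exact: scS_submodule.
Qed.

Lemma mulS_mem s T a x : is_submodule T -> a \in s -> T x -> mulS s T (a *: x).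
Proof.
move=> HT; elim: s => [//|b s IH] /=; rewrite inE => /orP [/eqP ->|/IH H] Tx.
  by apply: sub_addSl; [exact: mulS_submodule|exists x].
by apply: sub_addSr; [exact: scS_submodule|exact: H].
Qed.

Lemma mulS_min s T S : is_submodule S -> (forall a x, a \in s -> T x -> S (a *: x)) ->
  mulS s T `<=` S.
Proof.
move=> HS; elim: s => [|a s IH] /= H; first by move=> _ ->; exact: submod0.
apply: addS_sub => //; first by move=> _ [x Tx <-]; apply: H => //; rewrite mem_head.
by apply: IH => b x bs; apply: H; rewrite inE bs orbT.
Qed.

Lemma mulSS s T T' : is_submodule T' -> T `<=` T' -> mulS s T `<=` mulS s T'.
Proof.
move=> HT' TT'; apply: mulS_min; first exact: mulS_submodule.
by move=> a x sa /TT' Tx; exact: mulS_mem.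
Qed.

Local Notation family H := (forall n, is_submodule (H n)).
Local Notation stable s H := (forall a n x, a \in s -> H n x -> H n.+1 (a *: x)).
Local Notation subfam B H := (forall n, B n `<=` H n).
Definition gen_from s B G c :=
  forall n, (c <= n)%N -> G n.+1 `<=` addS (B n.+1) (mulS s (G n)).

(* Hilbert's basis theorem for graded families of submodules lying between B and
   G, on which multiplication by the elements of s raises the degree. *)
Definition noeth_for s := forall B G, family B -> family G -> subfam B G ->
  stable s B -> stable s G -> (exists c, gen_from s B G c) ->
  forall H, family H -> subfam B H -> subfam H G -> stable s H ->
  exists c, gen_from s B H c.

(** The union of the ascending families is generated from its degree c on. Each of the degrees 0,
    ..., c becomes stationary by [acc], and multiplication by s transports this to all higher
    degrees. *)
Lemma acc_fam_of s : noeth_for s -> forall B G, family B -> family G -> subfam B G ->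
  stable s B -> stable s G -> (exists c, gen_from s B G c) ->
  forall H : nat -> nat -> set X, (forall k, family (H k)) ->
  (forall k, subfam B (H k)) -> (forall k, subfam (H k) G) ->
  (forall k, stable s (H k)) -> (forall k, subfam (H k) (H k.+1)) ->
  exists N, forall k, (N <= k)%N -> subfam (H k) (H N).
Proof.
move=> HBs B G fB fG BG sB sG gG H fH BH HG sH Hi.
have Hle n i j : (i <= j)%N -> H i n `<=` H j n.
  exact: (inc_le (S := fun k => H k n) (fun k => Hi k n)).
pose U n : set X := [set x | exists k, H k n x].
have fU : family U.
  move=> n; apply/submoduleP; split; first by exists 0%N; exact: submod0 (fH 0%N n).
  move=> a x y [i Hx] [j Hy]; exists (maxn i j); apply: (submodP (fH _ _)).
    exact: (Hle _ _ _ (leq_maxl i j)) Hx.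
  exact: (Hle _ _ _ (leq_maxr i j)) Hy.
have [n x Bx|n x [k]|a n x sa [k Hx]|c gU] := HBs B G fB fG BG sB sG gG U fU.
- by exists 0%N; exact: BH.
- exact: HG.
- by exists k; exact: sH.
have st n : exists N, forall k, (N <= k)%N -> H k n `<=` H N n.
  by apply: (accX (S := fun k => H k n)) => k; [exact: fH|exact: Hi].
have [f fP] := choice st; pose N := \max_(i < c.+1) f i; exists N.
have UN : forall n, U n `<=` H N n.
  elim=> [|n IH].
    move=> x [k Hx]; have f0 : (f 0 <= N)%N by exact: (leq_bigmax (ord0 : 'I_c.+1)).
    apply: (Hle _ _ _ f0); apply: (fP 0%N (maxn k (f 0))); first exact: leq_maxr.
    exact: (Hle _ _ _ (leq_maxl _ _)) Hx.
  have [nc|cn] := leqP n.+1 c.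
    move=> x [k Hx].
    have f0 : (f n.+1 <= N)%N by exact: (leq_bigmax (Ordinal (nc : n.+1 < c.+1)%N)).
    apply: (Hle _ _ _ f0); apply: (fP _ (maxn k (f n.+1))); first exact: leq_maxr.
    exact: (Hle _ _ _ (leq_maxl _ _)) Hx.
  apply: subset_trans (gU n _) _; first by [].
  apply: addS_sub => //.
  by apply: mulS_min => // a x sa /IH; exact: sH.
by move=> k _ n x Hx; apply: UN; exists k.
Qed.

(** Induction on s, with a the first element: the argument with ideals of leading coefficients,
    where powers of a replace powers of the variable. The induction hypothesis is used for s alone,
    modulo aG. *)
Lemma noeth_all s : noeth_for s.
Proof.
elim: s => [|a s IH] B G fB fG BG sB sG [c gG] H fH BH HG sH.
  exists c => n cn x Hx; have [y [_ [By -> ->]]] := gG n cn x (HG _ _ Hx).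
  by exists y, 0.
have sa : a \in a :: s by rewrite mem_head.
have ss b : b \in s -> b \in a :: s by move=> bs; rewrite inE bs orbT.
(* Modulo B + aG the family G is generated by s without a, so the induction hypothesis applies
   between [B'] and G. *)
pose aG n : set X := if n is n'.+1 then scS a (G n') else [set 0].
have faG : family aG by case=> [|n] /=; [exact: submodule0|exact: scS_submodule].
have aGG : subfam aG G.
  by case=> [|n] x /=; [move=> ->; exact: submod0|move=> [y Gy <-]; exact: sG].
pose B' n := addS (B n) (aG n).
have fB' : family B' by move=> n; exact: addS_submodule.
have B'G : subfam B' G by move=> n; apply: addS_sub.
have sB' : stable s B'.
  move=> b n _ bs [x [y [Bx aGy ->]]]; exists (b *: x), (b *: y); rewrite scalerDr.
  split=> //; first by apply: sB => //; exact: ss.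
  case: n aGy {Bx} => [|n] /=.
    by move=> ->; rewrite scaler0; exists 0; rewrite ?scaler0 //; exact: submod0.
  by move=> [z Gz <-]; exists (b *: z); [apply: sG => //; exact: ss|rewrite !scalerA mulrC].
have sG' : stable s G by move=> b n x bs; apply: sG; exact: ss.
have gG' : exists c, gen_from s B' G c.
  exists c => n cn x /(gG n cn) [y [_ [By [z [w [Gz sw ->]]] ->]]].
  by exists (y + z), w; rewrite addrA; split=> //; exists y, z.
(* [K k] plays the part of the leading coefficients in degree k: elements of G that a^k multiplies
   into H. It increases with k; [L k] below adds [B'] to it. *)
pose K k n : set X := G n `&` [set y | H (n + k)%N (a ^+ k *: y)].
have fK k : family (K k).
  move=> n; apply: submoduleI => //; apply/submoduleP; split.
    by rewrite /= scaler0; exact: submod0.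
  by move=> b x y /= Hx Hy; rewrite scalerDr scalerA mulrC -scalerA; exact: submodP.
have sK k : stable s (K k).
  move=> b n x bs [Gx Hx]; split; first exact: sG'.
  by rewrite /= scalerA mulrC -scalerA addSn; apply: sH Hx; exact: ss.
have KS k : subfam (K k) (K k.+1).
  move=> n x [Gx Hx]; split=> //=; rewrite addnS exprS -scalerA; exact: sH.
pose L k n := addS (K k n) (B' n).
have fL k : family (L k) by move=> n; exact: addS_submodule.
have B'L k : subfam B' (L k) by move=> n; exact: sub_addSr.
have LG k : subfam (L k) G by move=> n; apply: addS_sub => // x [].
have sL k : stable s (L k).
  move=> b n _ bs [x [y [Kx By ->]]]; exists (b *: x), (b *: y); rewrite scalerDr.
  by split=> //; [exact: sK|exact: sB'].
have LS k : subfam (L k) (L k.+1) by move=> n; apply: addSS => //; exact: KS.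
have [k0 Lk0] := acc_fam_of IH fB' fG B'G sB' sG' gG' fL B'L LG sL LS.
have cL k : exists c, gen_from s B' (L k) c.
  exact: (IH B' G fB' fG B'G sB' sG' gG' (L k) (fL k) (B'L k) (LG k) (sL k)).
have [cf cfP] := choice cL; pose c1 := \max_(i < k0.+1) cf i.
have gL k m : (k <= k0)%N -> (c1 <= m)%N -> L k m.+1 `<=` addS (B' m.+1) (mulS s (L k m)).
  move=> kk0 c1m; apply: cfP; apply: leq_trans c1m.
  exact: (leq_bigmax (Ordinal (kk0 : k < k0.+1)%N)).
(* When m + k = n and k <= k0, this bound leaves m >= c1, where [L k] is generated by s. For larger
   k the stability of [L] is used instead. *)
exists (c1 + k0).+1 => n cn.
pose R := addS (B n.+1) (mulS (a :: s) (H n)).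
have fR : is_submodule R by apply: addS_submodule => //; exact: mulS_submodule.
have BR k m x : (m + k = n.+1)%N -> B m x -> R (a ^+ k *: x).
  move=> mk Bx; apply: sub_addSl; first exact: mulS_submodule.
  rewrite -mk; elim: k {mk} => [|k IHk]; first by rewrite expr0 scale1r addn0.
  by rewrite exprS -scalerA addnS; exact: sB.
have HR b x : b \in a :: s -> H n x -> R (b *: x).
  by move=> bs Hx; apply: sub_addSr => //; exact: mulS_mem.
(* The total degree m + k stays n + 1. The induction is on m, each step trading one degree of x for
   one more factor a; the case k = 0 is the claim. *)
suff main : forall m k x, (m + k = n.+1)%N -> K k m x -> R (a ^+ k *: x).
  move=> x Hx; rewrite -[x]scale1r -[1](expr0 a); apply: (main n.+1); rewrite ?addn0 //.
  by split; [exact: HG|rewrite /= expr0 scale1r addn0].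
have fRk k : is_submodule [set y | R (a ^+ k *: y)].
  apply/submoduleP; split; first by rewrite /= scaler0; exact: submod0.
  by move=> d y z /= Hx Hy; rewrite scalerDr scalerA mulrC -scalerA; exact: submodP.
have BK k : subfam B (K k).
  move=> m x Bx; split; first exact: BG.
  apply: BH; elim: k => [|k IHk]; first by rewrite expr0 scale1r addn0.
  by rewrite exprS -scalerA addnS; exact: sB.
have KS' k m g y : G m g -> K k m.+1 y -> y = a *: g -> K k.+1 m g.
  by move=> Gg [_ Hy] yE; split=> //; move: Hy; rewrite /= yE scalerA -exprSr addnS addSn.
have LE i j n' : (i <= j)%N -> L i n' `<=` L j n'.
  exact: (inc_le (S := fun k => L k n') (fun k => LS k n')).
elim=> [|m IHm] k x mk Kx.
  case: k mk Kx => [|k] mk Kx //.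
  have k00 : (k0 <= k)%N.
    move: mk => [->]; apply: leq_trans (ltnW cn); exact: leq_addl.
  have : L k.+1 0%N x by apply: sub_addSl.
  move=> /(Lk0 k.+1 (leqW k00)) /(LE _ _ _ k00).
  move=> [h [_ [[Gh Hh] [b [_ [Bb -> ->]]] ->]]].
  rewrite addr0 scalerDr; apply: submodD => //; last by apply: (BR k.+1 0%N).
  rewrite exprS -scalerA; apply: HR => //.
  by move: mk Hh => [->].
have [k00|k00] := leqP k k0.
  have c1m : (c1 <= m)%N.
    rewrite -(leq_add2r k0); apply: leq_trans (leq_trans (leqnSn _) cn) _.
    by move: mk; rewrite addSn => -[<-]; rewrite leq_add2l.
  have : L k m.+1 x by apply: sub_addSl.
  move=> /(gL k m k00 c1m) [_ [w [[b [_ [Bb [g Gg <-] ->]]] sw xE]]].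
  have : addS (addS (B m.+1) (scS a (G m))) (mulS s (K k m)) w.
    apply: (mulS_min _ _ sw) => [|d _ ds [y [z [Ky [b1 [g1 [Bb1 aGg1 ->]]] ->]]]].
      apply: addS_submodule; last exact: mulS_submodule.
      by apply: addS_submodule => //; exact: scS_submodule.
    exists (d *: (b1 + g1)), (d *: y); split; last by rewrite [in LHS]scalerDr addrC.
      by apply: (sB' d m) => //; exists b1, g1.
    exact: mulS_mem.
  move=> [_ [v [[b2 [_ [Bb2 [g2 Gg2 <-] ->]]] sv wE]]].
  have {xE wE} xE : x = (b + b2) + v + a *: (g + g2).
    by rewrite xE wE scalerDr -!addrA; congr (_ + _); rewrite addrCA; congr (_ + _); rewrite addrA [RHS]addrC.
  have Kv : K k m.+1 v by apply: (mulS_min _ _ sv) => // d y ds Ky; exact: sK.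
  have Kb : K k m.+1 (b + b2) by apply: BK; exact: submodD.
  have Gg3 : G m (g + g2) by exact: submodD.
  rewrite xE 2!scalerDr; apply: submodD => //; first apply: submodD => //.
  - by apply: BR mk _; exact: submodD.
  - apply: (mulS_min (fRk k) _ sv) => d y ds [Gy Hy] /=.
    rewrite scalerA mulrC -scalerA; apply: HR; first exact: ss.
    by move: mk Hy; rewrite addSn => -[<-].
  - rewrite scalerA -exprSr; apply: IHm; first by rewrite addnS -addSn.
    apply: (KS' k m _ (x - (b + b2 + v))) => //; last by rewrite xE addrC addKr.
    by apply: submodB => //; exact: submodD.
case: k mk k00 Kx => // k mk k00 Kx.
(* Beyond k0 stability puts x in [L k]: up to B and aG it is some h with a^k h in H, and a^(k+1) h
   is a times an element of H in degree n. *)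
have : L k.+1 m.+1 x by apply: sub_addSl.
move=> /(Lk0 k.+1 (ltnW k00)) /(LE _ _ _ (k00 : k0 <= k)%N).
move=> [h [_ [Kh [b [_ [Bb [g Gg <-] ->]]] xE]]].
rewrite xE addrA scalerDr [X in X + _]scalerDr; apply: submodD => //; first apply: submodD => //.
- by rewrite exprS -scalerA; apply: HR => //; case: Kh => _; move: mk; rewrite addnS => -[<-].
- by apply: (BR k.+1 m.+1).
- rewrite scalerA -exprSr; apply: IHm; first by rewrite addnS -addSn.
  apply: (KS' k.+1 m _ (x - (h + b))) => //; last by rewrite xE [h + (b + _)]addrA [h + b + _]addrC addrK.
  apply: submodB => //; apply: submodD => //; [exact: KS|exact: BK].
Qed.

Lemma acc_fam s B G : family B -> family G -> subfam B G ->
  stable s B -> stable s G -> (exists c, gen_from s B G c) ->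
  forall H : nat -> nat -> set X, (forall k, family (H k)) ->
  (forall k, subfam B (H k)) -> (forall k, subfam (H k) G) ->
  (forall k, stable s (H k)) -> (forall k, subfam (H k) (H k.+1)) ->
  exists N, forall k, (N <= k)%N -> subfam (H k) (H N).
Proof. exact: acc_fam_of (noeth_all (s := s)) B G. Qed.

End GradedNoetherian.

(** * Kernels of generic terms of a sequence *)

Lemma inf_pigeonhole (P : nat -> Prop) (R : nat -> nat -> Prop) N :
  (forall b, exists2 n, (b <= n)%N & P n) ->
  (forall n, P n -> exists2 i, (i < N)%N & R i n) ->
  exists2 i, (i < N)%N & forall b, exists n, [/\ (b <= n)%N, P n & R i n].
Proof.
move=> Pinf PR; apply: contrapT => H.
have H' (i : 'I_N) : exists b, forall n, (b <= n)%N -> P n -> ~ R i n.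
  apply: contrapT => H2; apply: H; exists i => // b.
  apply: contrapT => H3; apply: H2; exists b => n bn Pn Rn; apply: H3; by exists n.
have [f fP] := choice H'.
have [n nb Pn] := Pinf (\max_(i < N) f i).
have [i iN Rin] := PR n Pn.
by apply: (fP (Ordinal iN) n) => //; apply: leq_trans nb; exact: leq_bigmax.
Qed.

Section GenericElement.
(* The index p : D is a degree, raised by sh when multiplying by some u_i. *)
Variables (A : comNzRingType) (X : lmodType A) (D : Type) (sh : D -> D).
Variables (u : nat -> A) (T G : D -> set X).
Hypothesis HT : forall p, is_submodule (T p).
Hypothesis HG : forall p, is_submodule (G p).
Hypothesis TG : forall p, T p `<=` G p.
Hypothesis Tu : forall i p y, T p y -> T (sh p) (u i *: y).
Hypothesis Gu : forall i p y, G p y -> G (sh p) (u i *: y).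

Definition common_ker (I : seq nat) (p : D) : set X :=
  [set y | G p y /\ forall i, i \in I -> T (sh p) (u i *: y)].

(** An index outside [Th] contributes only T, so the sums over [Th] form one ascending chain indexed
    by all natural numbers. *)
Fixpoint ker_sum (Th : nat -> Prop) (I : seq nat) (N : nat) (p : D) : set X :=
  if N is N'.+1 then
    addS (ker_sum Th I N' p) (if `[< Th N' >] then common_ker (N' :: I) p else T p)
  else T p.

Lemma common_ker_submodule I p : is_submodule (common_ker I p).
Proof.
apply/submoduleP; split; first by split=> [|i _]; rewrite ?scaler0; exact: submod0.
move=> a x y [Gx Hx] [Gy Hy]; split=> [|i iI]; first exact: submodP.
by rewrite scalerDr scalerA mulrC -scalerA; apply: submodP => //; [exact: Hx|exact: Hy].
Qed.

Lemma common_ker_stable b I p y : (forall p y, T p y -> T (sh p) (b *: y)) ->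
  (forall p y, G p y -> G (sh p) (b *: y)) ->
  common_ker I p y -> common_ker I (sh p) (b *: y).
Proof.
move=> Tb Gb [Gy Hy]; split=> [|i iI]; first exact: Gb.
by rewrite scalerA mulrC -scalerA; apply: Tb; exact: Hy.
Qed.

Lemma ker_sum_submodule Th I N p : is_submodule (ker_sum Th I N p).
Proof.
elim: N => [|N IH] //=; apply: addS_submodule => //.
by case: ifP => _ //; exact: common_ker_submodule.
Qed.

Lemma ker_sum_stable b Th I N p y : (forall p y, T p y -> T (sh p) (b *: y)) ->
  (forall p y, G p y -> G (sh p) (b *: y)) ->
  ker_sum Th I N p y -> ker_sum Th I N (sh p) (b *: y).
Proof.
move=> Tb Gb; elim: N p y => [|N IH] p y /=; first exact: Tb.
move=> [z [w [Sz Sw ->]]]; exists (b *: z), (b *: w); rewrite scalerDr; split=> //.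
  exact: IH.
by move: Sw; case: ifP => _; [exact: common_ker_stable|exact: Tb].
Qed.

Lemma ker_sumS Th I N p : ker_sum Th I N p `<=` ker_sum Th I N.+1 p.
Proof.
apply: sub_addSl; case: ifP => _ //; exact: common_ker_submodule.
Qed.

Lemma ker_sum_G Th I N p : ker_sum Th I N p `<=` G p.
Proof.
elim: N => [|N IH] //=; apply: addS_sub => //.
by case: ifP => _ // y [].
Qed.

Lemma T_ker_sum Th I N p : T p `<=` ker_sum Th I N p.
Proof. by elim: N => [|N IH] //; apply: subset_trans IH _; exact: ker_sumS. Qed.

Hypothesis ACC : forall Th I, exists N, forall k, (N <= k)%N ->
  forall p, ker_sum Th I k p `<=` ker_sum Th I N p.
Variable r : nat.
Hypothesis r_gt0 : (0 < r)%N.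
Hypothesis full : forall I, uniq I -> size I = r -> forall p, common_ker I p `<=` T p.

Let bad I n := exists p y, common_ker (n :: I) p y /\ ~ T p y.

(* y lies in a finite sum of kernels, so a product of the u_i carries it into
   T; the last partial product outside T is killed by one more u_i. *)
Lemma ker_sum_bad Th I n M p y : (M <= n)%N -> common_ker (n :: I) p y -> ~ T p y ->
  ker_sum Th I M p y -> exists2 i, (i < M)%N & Th i /\ bad (i :: I) n.
Proof.
move=> Mn; elim: M p y Mn => [|M IH] p y Mn Ky nTy //=.
move=> [z [w [Sz Sw yE]]].
have IH' p' y' : common_ker (n :: I) p' y' -> ~ T p' y' -> ker_sum Th I M p' y' ->
    exists2 i, (i < M.+1)%N & Th i /\ bad (i :: I) n.
  by move=> K1 K2 K3; have [i iM Hi] := IH p' y' (ltnW Mn) K1 K2 K3; exists i => //; exact: ltnW.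
move: Sw; case: ifP => [/asboolP ThM Kw|_ Tw]; last first.
  apply: (IH' p y) => //; rewrite yE; apply: submodD => //; first exact: ker_sum_submodule.
  exact: T_ker_sum.
have [Tuy|nTuy] := pselect (T (sh p) (u M *: y)).
  exists M => //; split=> //; exists p, y; split=> //.
  case: Ky => Gy Hy; split=> // i; rewrite !inE => /or3P [/eqP ->|/eqP ->|iI].
  - by apply: Hy; rewrite mem_head.
  - exact: Tuy.
  - by apply: Hy; rewrite inE iI orbT.
apply: (IH' (sh p) (u M *: y)) => //; first by apply: common_ker_stable => // *; [exact: Tu|exact: Gu].
rewrite yE scalerDr; apply: submodD; first exact: ker_sum_submodule.
  by apply: ker_sum_stable => // *; [exact: Tu|exact: Gu].
by apply: T_ker_sum; case: Kw => _; apply; rewrite mem_head.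
Qed.

(** The chain of sums of kernels is stationary from some N on, so each bad n >= N shares a kernel
    element with an index i < N. One i serves infinitely many n by the pigeonhole principle and is
    added to I. When one more index makes r of them, [full] contradicts badness. *)
Lemma no_infinite_bad k I (Th : nat -> Prop) : uniq I -> (size I + k.+1 = r)%N ->
  (forall b, exists2 n, (b <= n)%N & Th n) -> (forall n, Th n -> n \notin I) ->
  ~ (forall n, Th n -> bad I n).
Proof.
elim: k I Th => [|k IH] I Th uI sI Tinf TI H.
  have [n _ Thn] := Tinf 0%N; have [p [y [Ky nTy]]] := H n Thn.
  apply: nTy; apply: (full _ _ Ky); first by rewrite /= TI.
  by rewrite /= -sI addn1.
have [N HN] := ACC Th I.
pose P n := (N <= n)%N /\ Th n.
have [b|n [Nn Thn]|i iN Hi] := @inf_pigeonhole P (fun i n => Th i /\ bad (i :: I) n) N.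
- have [n bn Thn] := Tinf (maxn b N); move: bn; rewrite geq_max => /andP [bn Nn].
  by exists n.
- have [p [y [Ky nTy]]] := H n Thn.
  apply: (@ker_sum_bad Th I n N p y) => //.
  apply: (HN n.+1); first exact: leqW.
  rewrite /= (_ : `[< Th n >] = true); last exact/asboolP.
  by apply: sub_addSr => //; exact: ker_sum_submodule.
have [n0 [_ _ [Thi _]]] := Hi 0%N.
apply: (IH (i :: I) (fun n => P n /\ bad (i :: I) n)).
- by rewrite /= TI.
- by rewrite /= addSnnS.
- by move=> b; have [n [bn Pn [_ Bn]]] := Hi b; exists n.
- move=> n [[Nn Thn] _]; rewrite inE negb_or TI // andbT; apply/eqP => ni.
  by move: iN; rewrite -ni ltnNge Nn.
- by move=> n [].
Qed.

(** It takes the place of avoiding finitely many associated primes: if it failed for arbitrarily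
    large n, those n would all be bad for the empty list. *)
Lemma generic_kernel : exists N, forall n, (N <= n)%N -> forall p y,
  G p y -> T (sh p) (u n *: y) -> T p y.
Proof.
have sr : (size ([::] : seq nat) + r.-1.+1 = r)%N by rewrite add0n prednK.
apply: contrapT => H; apply: (@no_infinite_bad r.-1 [::] (bad [::])) => //.
move=> b; apply: contrapT => H'; apply: H; exists b => n bn p y Gy Ty.
apply: contrapT => nTy; apply: H'; exists n => //; exists p, y; split=> //.
by split=> // i; rewrite inE => /eqP ->.
Qed.

End GenericElement.

(** * Powers of an ideal, the Artin-Rees lemma and superficial elements *)

Section Powers.
Variable A : comNzRingType.
Implicit Types (X Y Z : lmodType A) (I J : set A).

Definition pw (I : set A) X n : set X := ideal_smul (N := X) (ideal_pow I n).

Lemma pw_submodule I X n : is_submodule (@pw I X n).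
Proof. exact: ideal_smul_submodule. Qed.

Lemma colon_submodule X (S : set X) x : is_submodule S ->
  is_submodule ([set a | S (a *: x)] : set A^o).
Proof.
move=> HS; apply/submoduleP; split; first by rewrite /= scale0r; exact: submod0.
by move=> a b c /= Hb Hc; rewrite scalerDl -scalerA; exact: submodP.
Qed.

Lemma scale_submodule X (S : set X) a : is_submodule S -> is_submodule [set x | S (a *: x)].
Proof.
move=> HS; apply/submoduleP; split; first by rewrite /= scaler0; exact: submod0.
by move=> d y z /= Hx Hy; rewrite scalerDr scalerA mulrC -scalerA; exact: submodP.
Qed.

Lemma pw0 I X (x : X) : pw I 0 x.
Proof. by rewrite -[x]scale1r; apply: ideal_smul_mem. Qed.

Lemma pwS_min I X n (S : set X) : is_submodule S ->
  (forall q x, I q -> pw I n x -> S (q *: x)) -> pw I n.+1 `<=` S.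
Proof.
move=> HS H; apply: ideal_smul_min => // a x.
apply: (submod_span_min (colon_submodule x HS)) => _ [q Iq [b Ib <-]] /=.
by rewrite -scalerA; apply: H => //; exact: ideal_smul_mem.
Qed.

Lemma pwS_mem I X n q (x : X) : I q -> pw I n x -> pw I n.+1 (q *: x).
Proof.
move=> Iq; have HS := scale_submodule q (pw_submodule I X n.+1).
apply: (submod_span_min HS) => _ [b Ib [y _ <-]] /=.
rewrite scalerA; apply: ideal_smul_mem.
by apply: (@sub_submod_span A A^o); exists q => //; exists b.
Qed.

Lemma pwS_sub I X n : @pw I X n.+1 `<=` pw I n.
Proof. by apply: pwS_min => [|q x _]; [exact: pw_submodule|apply: submodZ; exact: pw_submodule]. Qed.

Lemma pw_le I X i j : (i <= j)%N -> @pw I X j `<=` pw I i.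
Proof.
move=> /subnK <-; elim: (j - i)%N => // k IH; rewrite addSn.
exact: subset_trans (@pwS_sub I X _) IH.
Qed.

Lemma pw_lin I X Y (f : {linear X -> Y}) n x : pw I n x -> pw I n (f x).
Proof.
elim: n x => [|n IH] x; first by move=> _; exact: pw0.
apply: (pwS_min (S := f @^-1` (pw I n.+1))); first exact/preimage_submodule/pw_submodule.
by move=> q y Iq /IH fy; rewrite /= linearZ; exact: pwS_mem.
Qed.

Lemma pw_onto I X Y (f : {linear X -> Y}) n : onto f ->
  pw I n `<=` f @` (@pw I X n).
Proof.
move=> fs; elim: n => [|n IH].
  by move=> y _; have [x <-] := fs y; exists x => //; exact: pw0.
apply: pwS_min; first exact/image_submodule/pw_submodule.
move=> q _ Iq /IH [x Ix <-]; exists (q *: x); first exact: pwS_mem.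
by rewrite linearZ.
Qed.

Lemma ideal_pow_submodule I n : is_submodule (ideal_pow I n : set A^o).
Proof. by case: n => [|n] /=; [exact: (@submodule_setT A A^o)|exact: submod_span_submodule]. Qed.

Lemma ideal_powS_min (I : set A) n (S : set A^o) : is_submodule S ->
  (forall q b, I q -> ideal_pow I n b -> S (q * b)) -> ideal_pow I n.+1 `<=` S.
Proof.
move=> HS H; apply: (@submod_span_min A A^o [set a * b | a in I & b in ideal_pow I n] S HS).
by move=> _ [q Iq [b Ib <-]]; exact: (H q b Iq Ib).
Qed.

Lemma ideal_powS_mem I n (q b : A) : I q -> ideal_pow I n b -> ideal_pow I n.+1 (q * b).
Proof. by move=> Iq Ib; apply: (@sub_submod_span A A^o); exists q => //; exists b. Qed.

Lemma ideal_pow_mem I X k n b (y : X) : ideal_pow I k b -> pw I n y -> pw I (k + n) (b *: y).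
Proof.
elim: k b => [|k IH] b.
  by move=> _; apply: submodZ; exact: pw_submodule.
move=> Ib In; move: b Ib; rewrite addSn.
apply: (ideal_powS_min (S := [set b | pw I (k + n).+1 (b *: y)])).
  by apply: colon_submodule; exact: pw_submodule.
by move=> q b Iq Ib /=; rewrite -scalerA; apply: pwS_mem => //; exact: IH.
Qed.

Lemma ideal_powS_sub I n : ideal_pow I n.+1 `<=` ideal_pow I n.
Proof.
apply: ideal_powS_min; first exact: ideal_pow_submodule.
by move=> q b _; exact: (submodZ (ideal_pow_submodule I n)).
Qed.

Lemma ideal_pow_le I i j : (i <= j)%N -> ideal_pow I j `<=` ideal_pow I i.
Proof.
move=> /subnK <-; elim: (j - i)%N => // k IH; rewrite addSn.
exact: subset_trans (@ideal_powS_sub I _) IH.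
Qed.

Section Generated.
Variables (Q : set A) (gs : seq A).
Hypothesis Qgs : @lspan A A^o gs = Q.

Lemma gens_ideal : is_submodule (Q : set A^o).
Proof. by rewrite -Qgs; exact: lspan_submodule. Qed.

Lemma gens_mem g : g \in gs -> Q g.
Proof. by move=> gg; rewrite -Qgs; exact: (@lspan_mem A A^o gs g gg). Qed.

Lemma gens_colon X (S : set X) x : is_submodule S ->
  (forall g, g \in gs -> S (g *: x)) -> forall q, Q q -> S (q *: x).
Proof.
by move=> HS H q; rewrite -Qgs; apply: (@lspan_min A A^o gs _ (colon_submodule x HS)).
Qed.

Lemma gens_mulS X (T : set X) q x : is_submodule T -> Q q -> T x -> mulS gs T (q *: x).
Proof.
move=> HT Qq Tx; apply: gens_colon Qq; first exact: mulS_submodule.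
by move=> g gg; exact: mulS_mem.
Qed.

Lemma pwS_mulS X n : @pw Q X n.+1 `<=` mulS gs (pw Q n).
Proof.
apply: pwS_min; first by apply: mulS_submodule; exact: pw_submodule.
by move=> q x Qq Qx; apply: gens_mulS => //; exact: pw_submodule.
Qed.

(** The basis theorem for graded families between 0 and the powers Q^n X, applied to their
    intersections with S. *)
Lemma artin_rees X (S : set X) : acc X -> is_submodule S ->
  exists c, forall n, (c <= n)%N ->
    S `&` pw Q n.+1 `<=` mulS gs (S `&` pw Q n).
Proof.
move=> aX HS.
have [c Hc] : exists c, gen_from gs (fun=> [set 0]) (fun n => S `&` pw Q n) c.
  apply: (@noeth_all A X aX gs (fun=> [set 0]) (@pw Q X)).
  - by move=> n; exact: submodule0.
  - exact: pw_submodule.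
  - by move=> n x ->; apply: submod0; exact: pw_submodule.
  - by move=> a n x _ ->; rewrite /= scaler0.
  - by move=> a n x /gens_mem Qa Qx; exact: pwS_mem.
  - by exists 0%N => n _ x /pwS_mulS Hx; apply: sub_addSr => //; exact: submodule0.
  - by move=> n; apply: submoduleI => //; exact: pw_submodule.
  - by move=> n x ->; split; [exact: submod0|apply: submod0; exact: pw_submodule].
  - by move=> n x [].
  - move=> a n x ag [Sx Qx]; split; first exact: submodZ.
    by apply: pwS_mem => //; exact: gens_mem.
exists c => n /Hc H x /H [_ [y [-> sy ->]]]; by rewrite add0r.
Qed.

Lemma artin_rees_inj X Z (f : {linear Z -> X}) : acc X -> inj0 f ->
  exists c, forall n z, pw Q (n + c) (f z) -> pw Q n z.
Proof.
move=> aX fi; have [c Hc] := artin_rees aX (range_submodule f).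
exists c; elim=> [|n IH] z; first by move=> _; exact: pw0.
rewrite addSn => Hz.
suff : (f @` pw Q n.+1) (f z) by move=> [z' Hz' /((inj0P f).1 fi) <-].
have : mulS gs (range f `&` pw Q (n + c)) (f z).
  by apply: (Hc _ (leq_addl _ _)); split=> //; exists z.
apply: mulS_min; first exact/image_submodule/pw_submodule.
move=> g _ gg [[y _ <-] /IH Qy]; exists (g *: y); last by rewrite linearZ.
by apply: pwS_mem => //; exact: gens_mem.
Qed.

Section LocalRing.
Variables (m : set A) (m_local : is_local m).
Hypothesis Qm : Q `<=` m.

(** By the Artin-Rees lemma the intersection S of all Q^n X satisfies S = QS, and Nakayama's lemma
    makes it zero. *)
Lemma krull X : acc X -> forall x : X, (forall n, pw Q n x) -> x = 0.
Proof.
move=> aX x Hx; pose S : set X := [set y | forall n, pw Q n y].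
have HS : is_submodule S.
  apply/submoduleP; split=> [n|a y z Sy Sz n]; first by apply: submod0; exact: pw_submodule.
  by apply: (submodP (pw_submodule Q X n)).
have [c Hc] := artin_rees_inj aX (inj0_subval (S := S)).
have [z zx] := submod_mem HS (Hx : S x).
suff : z = 0 by rewrite -zx => ->; rewrite linear0.
have N0 := @nakayama A m m_local (submod S) [set 0] (acc_sub aX) (@submodule0 A (submod S)).
apply: (N0 _ z) => {N0 zx}z.
apply: sub_addSr; first exact: submodule0.
have : pw Q 1 z by apply: (Hc 1%N); exact: (submod_valP HS z (1 + c)%N).
apply: pwS_min; first exact: ideal_smul_submodule.
by move=> q y /Qm mq _; exact: ideal_smul_mem.
Qed.

End LocalRing.

Definition general_position (r : nat) (u : nat -> A) :=
  (forall n, Q (u n)) /\ forall I : seq nat, uniq I -> size I = r ->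
    Q `<=` @lspan A A^o (map u I).

Lemma general_position_colon r u X (S : set X) (I : seq nat) x :
  general_position r u -> is_submodule S -> uniq I -> size I = r ->
  (forall i, i \in I -> S (u i *: x)) -> forall q, Q q -> S (q *: x).
Proof.
move=> [_ ug] HS uI sI H q /(ug _ uI sI).
by apply: (@lspan_min A A^o _ _ (colon_submodule x HS)) => _ /mapP [i iI ->]; exact: H.
Qed.

(** For n >= c and a in Q this says that Q^(n+1) X : a and Q^c X intersect in Q^n X. *)
Definition superficial X (a : A) := exists c, forall n, (c <= n)%N ->
  forall y : X, pw Q c y -> pw Q n.+1 (a *: y) -> pw Q n y.

Section Superficial.
Variables (r : nat) (u : nat -> A).
Hypothesis r_gt0 : (0 < r)%N.
Hypothesis ug : general_position r u.
Variable X : lmodType A.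
Hypothesis aX : acc X.

(** Modulo Q^(n+1) X, [T n] is the degree n part of what a power of the irrelevant ideal kills in
    the associated graded module. *)
Let T n : set X := [set y | pw Q n y /\ exists k, forall b, ideal_pow Q k b ->
  pw Q (n + k).+1 (b *: y)].

Let T_up n (y : X) k k' : (k <= k')%N ->
  (forall b, ideal_pow Q k b -> pw Q (n + k).+1 (b *: y)) ->
  forall b, ideal_pow Q k' b -> pw Q (n + k').+1 (b *: y).
Proof.
move=> /subnK <-; elim: (k' - k)%N => [|j IH] H b; first exact: H.
move: b; apply: (ideal_powS_min (S := [set b | pw Q (n + (j + k).+1).+1 (b *: y)])).
  by apply: colon_submodule; exact: pw_submodule.
move=> q b Qq Qb; rewrite /= -scalerA addnS; apply: pwS_mem => //; exact: IH.
Qed.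

Let HT n : is_submodule (T n).
Proof.
apply/submoduleP; split.
  split; first by apply: submod0; exact: pw_submodule.
  by exists 0%N => b _; rewrite scaler0; exact: (submod0 (pw_submodule Q X _)).
move=> a x y [Qx [i Hx]] [Qy [j Hy]]; split; first exact: (submodP (pw_submodule Q X n)).
exists (maxn i j) => b Qb; rewrite scalerDr scalerA mulrC -scalerA.
apply: (submodP (pw_submodule Q X _)).
  exact: (T_up (leq_maxl i j) Hx).
exact: (T_up (leq_maxr i j) Hy).
Qed.

Let T_stable q n y : Q q -> T n y -> T n.+1 (q *: y).
Proof.
move=> Qq [Qy [k Hk]]; split; first exact: pwS_mem.
exists k => b Qb; rewrite scalerA mulrC -scalerA addSn; apply: pwS_mem => //; exact: Hk.
Qed.

Let pwT n : @pw Q X n.+1 `<=` T n.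
Proof.
move=> y Qy; split; first exact: pwS_sub.
by exists 0%N => b _; rewrite addn0; apply: (submodZ (pw_submodule Q X n.+1)).
Qed.

(** The graded torsion is generated from some degree c on, where finitely many generators are killed
    by a common power of Q; hence it vanishes in high degrees. *)
Let T_small : exists c, forall n, (c <= n)%N -> T n `<=` pw Q n.+1.
Proof.
have [c Hc] : exists c, gen_from gs (fun n => @pw Q X n.+1) T c.
  apply: (@noeth_all A X aX gs (fun n => @pw Q X n.+1) (@pw Q X)).
  - by move=> n; exact: pw_submodule.
  - exact: pw_submodule.
  - by move=> n; exact: pwS_sub.
  - by move=> a n x /gens_mem Qa; exact: pwS_mem.
  - by move=> a n x /gens_mem Qa; exact: pwS_mem.
  - exists 0%N => n _ x /pwS_mulS Hx; apply: sub_addSr => //; exact: pw_submodule.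
  - exact: HT.
  - exact: pwT.
  - by move=> n x [].
  - by move=> a n x /gens_mem Qa; exact: T_stable.
have [s sT Es] := acc_fg aX (HT c).
have [k Hk] : exists k, forall y, y \in s -> forall b, ideal_pow Q k b ->
    pw Q (c + k).+1 (b *: y).
  elim: s sT {Es} => [|x s IH] sT; first by exists 0%N.
  have [|k Hk] := IH; first by move=> y ys; apply: sT; rewrite inE ys orbT.
  have [_ [j Hj]] := sT x (mem_head _ _); exists (maxn j k) => y.
  rewrite inE => /orP [/eqP -> |/Hk Hy]; first exact: T_up (leq_maxl j k) Hj.
  exact: T_up (leq_maxr j k) Hy.
have {}Hk j y b : (k <= j)%N -> T c y -> ideal_pow Q j b -> pw Q (c + j).+1 (b *: y).
  move=> kj; rewrite -Es => sy Qb; move: y sy.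
  apply: (lspan_min (scale_submodule b (@pw_submodule Q X (c + j).+1))).
  by move=> y /Hk Hy /=; exact: (T_up kj Hy).
(* Beyond degree c, T comes from [T c] by multiplication with powers of Q, up to the next power of Q
   on X. *)
have TS j : T (c + j) `<=` addS (pw Q (c + j).+1)
    (submod_span [set z | exists b y, [/\ ideal_pow Q j b, T c y & z = b *: y]]).
  elim: j => [|j IH] x.
    rewrite addn0 => Tx; apply: sub_addSr; first exact: pw_submodule.
    by apply: sub_submod_span; exists 1, x; rewrite scale1r.
  rewrite addnS => /(Hc _ (leq_addr j c)); apply: addS_sub; last first.
  - apply: mulS_min.
      by apply: addS_submodule; [exact: pw_submodule|exact: submod_span_submodule].
    move=> g y /gens_mem Qg /IH [y1 [y2 [Qy1 Sy2 ->]]]; rewrite scalerDr.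
    exists (g *: y1), (g *: y2); split=> //; first exact: pwS_mem.
    move: y2 Sy2; apply: (submod_span_min (scale_submodule g (submod_span_submodule _))).
    move=> _ [b [y2 [Qb Ty2 ->]]] /=; apply: sub_submod_span.
    by exists (g * b), y2; rewrite scalerA; split=> //; exact: ideal_powS_mem.
  - by apply: sub_addSl; exact: submod_span_submodule.
  - by apply: addS_submodule; [exact: pw_submodule|exact: submod_span_submodule].
exists (c + k)%N => n; rewrite addnC => kcn.
have [j -> kj] : exists2 j, n = (c + j)%N & (k <= j)%N.
  exists (n - c)%N; first by rewrite subnKC //; apply: leq_trans kcn; exact: leq_addl.
  by rewrite leq_subRL 1?addnC //; apply: leq_trans kcn; exact: leq_addl.
apply: subset_trans (TS j) _; apply: addS_sub => //; first exact: pw_submodule.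
apply: submod_span_min; first exact: pw_submodule.
by move=> _ [b [y [Qb Ty ->]]]; exact: Hk.
Qed.

(** Relative to the graded torsion T a generic u_n has no kernel. As T vanishes in degrees at least
    c, multiplication by u_n is injective there on the associated graded module. *)
Lemma superficial_generic : exists N, forall n, (N <= n)%N -> superficial X (u n).
Proof.
have [Qu _] := ug; have [c Hc] := T_small.
have Qst q n y : Q q -> @pw Q X n y -> pw Q n.+1 (q *: y) by exact: pwS_mem.
have [N HN] : exists N, forall n, (N <= n)%N -> forall p y, pw Q p y -> T p.+1 (u n *: y) -> T p y.
  have GK := @generic_kernel A X nat S u T (@pw Q X) HT.

  apply: (GK _ _ _ _ r r_gt0) => {GK}.
  - by move=> p; exact: pw_submodule.
  - by move=> i p y; exact: T_stable.
  - by move=> i p y; exact: Qst.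
  - move=> Th I.
    apply: (@acc_fam A X aX gs (fun n => @pw Q X n.+1) (@pw Q X)).
    - by move=> n; exact: pw_submodule.
    - exact: pw_submodule.
    - by move=> n; exact: pwS_sub.
    - by move=> a n x /gens_mem Qa; exact: pwS_mem.
    - by move=> a n x /gens_mem Qa; exact: pwS_mem.
    - exists 0%N => n _ x /pwS_mulS Hx; apply: sub_addSr => //; exact: pw_submodule.
    - move=> k n; apply: ker_sum_submodule => p; first [exact: HT|exact: pw_submodule].
    - by move=> k n; apply: subset_trans (@pwT n) _; apply: T_ker_sum => p; first [exact: HT|exact: pw_submodule].
    - by move=> k n; apply: ker_sum_G => p; first [exact: HT|exact: pw_submodule|by move=> x []].
    - move=> k a n x /gens_mem Qa; apply: ker_sum_stable => p y; [exact: T_stable|exact: Qst].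
    - by move=> k n; apply: ker_sumS => p; first [exact: HT|exact: pw_submodule].
  (* Here r terms, hence all of Q, carry y into T; finitely many generators of Q are then killed on
     y by one power of Q, so y itself lies in T. *)
  - move=> I uI sI p y [Qy Hy].
    have QT q : Q q -> T p.+1 (q *: y) by apply: (general_position_colon ug (HT p.+1) uI sI).
    have [k Hk] : exists k, forall g, g \in gs -> forall b, ideal_pow Q k b ->
        pw Q (p.+1 + k).+1 (b *: (g *: y)).
      have : forall g, g \in gs -> Q g by exact: gens_mem.
      elim: (gs) => [|x s IH] sT; first by exists 0%N.
      have [|k Hk] := IH; first by move=> z ys; apply: sT; rewrite inE ys orbT.
      have [_ [j Hj]] := QT x (sT x (mem_head _ _)); exists (maxn j k) => z.
      rewrite inE => /orP [/eqP -> |/Hk Hz]; first exact: T_up (leq_maxl j k) Hj.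
      exact: T_up (leq_maxr j k) Hz.
    split=> //; exists k.+1.
    apply: (ideal_powS_min (S := [set b | pw Q (p + k.+1).+1 (b *: y)])).
      by apply: colon_submodule; exact: pw_submodule.
    move=> q b Qq Qb /=; rewrite mulrC -scalerA addnS -addSn; move: q Qq.
    apply: (gens_colon (S := [set z | pw Q (p.+1 + k).+1 (b *: z)])).
      exact/scale_submodule/pw_submodule.
    by move=> g gg /=; exact: Hk.
(* Starting in Q^c X, y climbs one power of Q at a time. *)
exists N => n Nn; exists c => k ck y Qcy; rewrite -(subnK ck).
elim: (k - c)%N => [//|j IH]; rewrite addSn => Hy.
have Qy : pw Q (j + c) y by apply: IH; exact: pwS_sub.
apply: (Hc _ (leq_addl _ _)); apply: (HN n Nn) => //; exact: pwT.
Qed.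

End Superficial.

End Generated.

End Powers.

(** * Sequences in general position and regular elements *)

Section GeneralPosition.
Variables (A : comNzRingType) (m : set A).
Hypothesis m_local : is_local m.

Lemma nmem_mul x y : ~ m x -> ~ m y -> ~ m (x * y).
Proof.
move=> /(local_inv m_local) [x' Ex] /(local_inv m_local) [y' Ey] mxy.
apply: (local_not1 m_local).
have -> : 1 = (x' * y') * (x * y) by rewrite mulrACA Ex Ey mulr1.
exact: (submodZ (local_ideal m_local)).
Qed.

(* The terms of u lie on the moment curve, so the relevant determinants are
   Vandermonde determinants of elements that differ modulo m. *)
Lemma exists_general_position (gs : seq A) :
  infinite_set [set: cyclic_module m] ->
  exists u, general_position (@lspan A A^o gs) (size gs) u.
Proof.
move=> /infiniteP /card_leP [g0].
pose f (n : nat) : cyclic_module m := val (g0 (SigSub (mem_set (I : [set: nat] n)))).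
have f_inj : injective f.
  by move=> i j /val_inj /(@inj _ _ _ g0) H; have /(congr1 val) := H (mem_set I) (mem_set I).
pose t n : A := generic_quotient.repr (f n).
have tP i j : i != j -> ~ m (t i - t j).
  move=> ij mt; move/eqP: ij; apply; apply: f_inj.
  rewrite -[f i]quotmod_reprK -[f j]quotmod_reprK.
  by apply/(eq_pi_sub (local_ideal m_local)).
set r := size gs; pose g : 'rV[A]_r := \row_j gs`_j.
pose u n : A := \sum_(j < r) g 0 j * t n ^+ j; exists u.
have HQ : is_submodule (@lspan A A^o gs) by exact: lspan_submodule.
have gQ j : @lspan A A^o gs (g 0 j).
  by rewrite mxE; apply: (@lspan_mem A A^o); apply: mem_nth.
split.
  by move=> n; apply: (submod_sum HQ) => j _; rewrite mulrC; exact: (submodZ HQ).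
move=> I uI sI; set L := @lspan A A^o (map u I).
have HL : is_submodule L by exact: lspan_submodule.
pose a : 'rV[A]_r := \row_i t (nth 0%N I i).
pose V := Vandermonde r a.
have gV i : (g *m V) 0 i = u (nth 0%N I i).
  by rewrite mxE; apply: eq_bigr => j _; rewrite !mxE.
have ndet : ~ m (\det V).
  rewrite det_Vandermonde; elim/big_rec: _ => [|i x _ mx]; first exact: local_not1.
  apply: nmem_mul => //; elim/big_rec: _ => [|j y ij my]; first exact: local_not1.
  apply: nmem_mul => //; rewrite !mxE; apply: tP.
  by rewrite nth_uniq ?sI // neq_ltn ij orbT.
have [y y1] := local_inv m_local ndet.
(* Cramer's rule: the Vandermonde determinant is a unit with inverse y, so the generators are
   combinations of the chosen u_i. *)
have gE : g = y *: ((g *m V) *m \adj V).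
  by rewrite -mulmxA mul_mx_adj -scalemx1 -scalemxAr mulmx1 scalerA y1 scale1r.
apply: (@lspan_min A A^o gs _ HL) => x /(nthP 0) [j jr <-].
have -> : gs`_j = g 0 (Ordinal jr) by rewrite mxE.
rewrite gE mxE mxE; apply: (submodZ HL); apply: (submod_sum HL) => i _.
rewrite gV mulrC; apply: (submodZ HL); apply: (@lspan_mem A A^o).
by apply: map_f; apply: mem_nth; rewrite sI.
Qed.

Lemma exists_regular (X : lmodType A) (gs : seq A) :
  infinite_set [set: cyclic_module m] -> acc X -> (0 < size gs)%N ->
  (forall z : X, (forall a, @lspan A A^o gs a -> a *: z = 0) -> z = 0) ->
  exists2 x, @lspan A A^o gs x & forall z : X, x *: z = 0 -> z = 0.
Proof.
move=> inf aX s0 H; have [u ug] := exists_general_position gs inf.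
(* Generic kernels without grading: the index type is [unit], T = 0 and G is all of X. *)
have [N HN] : exists N, forall n, (N <= n)%N -> forall (p : unit) (y : X),
    setT y -> [set 0] (u n *: y) -> [set (0 : X)] y.
  have GK := @generic_kernel A X unit id u (fun=> [set 0]) (fun=> setT) (fun=> @submodule0 A X).
  apply: (GK _ _ _ _ (size gs)) => {GK} //.
  - by move=> _; exact: submodule_setT.
  - by move=> i _ y ->; rewrite /= scaler0.
  - move=> Th I; have Hs N p : is_submodule (ker_sum id u (fun=> [set 0]) (fun=> [set: X]) Th I N p).
      apply: ker_sum_submodule => _; first [exact: submodule0|exact: submodule_setT].
    have [||N HN] := @aX (fun N => ker_sum id u (fun=> [set 0]) (fun=> [set: X]) Th I N tt).
    - by move=> N; exact: Hs.
    - by move=> N; apply: ker_sumS => _; first [exact: submodule0|exact: submodule_setT].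
    by exists N => k Nk [] y; exact: HN.
  - move=> I uI sI p y [_ Hy] /=; apply: H => a Qa.
    exact: (general_position_colon ug (@submodule0 A X) uI sI Hy Qa).
exists (u N); first by have [Qu _] := ug; exact: Qu.
by move=> z uz; apply: (HN N _ tt).
Qed.

End GeneralPosition.

(** * Prime ideals and dimension *)

Section Primes.
Variable A : comNzRingType.
Implicit Types (X Y Z V : lmodType A) (P J : set A).

Lemma acc_max V (Pr : set V -> Prop) S0 : acc V -> is_submodule S0 -> Pr S0 ->
  exists S, [/\ is_submodule S, Pr S &
    forall T, is_submodule T -> Pr T -> S `<=` T -> T `<=` S].
Proof.
move=> aV HS0 P0; apply: contrapT => H.
have step (S : {S : set V | is_submodule S /\ Pr S}) :
    exists T : {S : set V | is_submodule S /\ Pr S}, sval S `<` sval T.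
  case: S => S [HS PS] /=; apply: contrapT => H'; apply: H; exists S; split=> // T HT PT ST.
  apply: contrapT => nTS; apply: H'; by exists (exist _ T (conj HT PT)).
have [g gP] := choice step.
pose s0 : {S : set V | is_submodule S /\ Pr S} := exist _ S0 (conj HS0 P0).
have [n|n|N HN] := aV (fun n => sval (iter n g s0)).
- by case: (iter n g s0) => S [].
- exact: (gP _).1.
- by have [_] := gP (iter N g s0); apply; exact: (HN N.+1).
Qed.

Lemma prime_idealP P : is_prime P -> [/\ is_submodule (P : set A^o), ~ P 1 &
  forall x y, P (x * y) -> P x \/ P y].
Proof.
move=> [[P0 /negP P1 PL] PM]; split.
- by split => // a u v; exact: PL.
- by move: P1; rewrite in_setE.
- by move=> x y Pxy; have := PM x y; rewrite !in_setE => /(_ Pxy) /orP []; rewrite in_setE; [left|right].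
Qed.

Lemma prime_intro P : is_submodule (P : set A^o) -> ~ P 1 ->
  (forall x y, P (x * y) -> P x \/ P y) -> is_prime P.
Proof.
move=> HP P1 PM; split; first split.
- by rewrite in_setE; exact: (submod0 HP).
- by apply/negP; rewrite in_setE.
- by move=> a u v; rewrite !in_setE => Pu Pv; exact: (submodP HP a Pu Pv).
- by move=> x y; rewrite !in_setE => /PM [Px|Py]; apply/orP; rewrite !in_setE; [left|right].
Qed.

Lemma prime_exp P x n : is_prime P -> P (x ^+ n) -> P x.
Proof.
move=> /prime_idealP [_ P1 PM]; elim: n => [|n IH]; first by rewrite expr0.
by rewrite exprS => /PM [].
Qed.

Lemma primeN_mul P x y : is_prime P -> ~ P x -> ~ P y -> ~ P (x * y).
Proof. by move=> /prime_idealP [_ _ PM] nx ny /PM []. Qed.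

(** An ideal maximal among those that contain J and miss the multiplicative set S is prime; [acc]
    provides it. *)
Lemma prime_avoid J (S : set A) : acc (A^o : lmodType A) -> is_submodule (J : set A^o) ->
  S 1 -> (forall x y, S x -> S y -> S (x * y)) -> (forall x, J x -> ~ S x) ->
  exists P, [/\ is_prime P, J `<=` P & forall x, P x -> ~ S x].
Proof.
move=> aA HJ S1 SM JS.
have [P [HP [JP PS] Pmax]] := @acc_max A^o
  (fun P => J `<=` P /\ forall x, P x -> ~ S x) J aA HJ (conj (fun x h => h) JS).
exists P; split=> //; apply: prime_intro => //; first by move=> /PS.
pose E x : set A^o := addS P (range (fun a => a * x)).
have HR x : is_submodule (range (fun a => a * x) : set A^o).
  apply/submoduleP; split; first by exists 0; rewrite ?mul0r.
  by move=> a _ _ [b _ <-] [c _ <-]; exists (a * b + c); rewrite // mulrDl -mulrA.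
have ES x : ~ P x -> exists a p, P p /\ S (p + a * x).
  move=> nPx; apply: contrapT => H; apply: nPx.
  have HE : is_submodule (E x) by exact: addS_submodule.
  apply: (Pmax (E x) HE); last first.
  - by apply: (@sub_addSr A A^o P _ HP); exists 1; rewrite ?mul1r.
  - exact: (@sub_addSl A A^o P _ (HR x)).
  split; first by apply: subset_trans JP _; exact: (@sub_addSl A A^o P _ (HR x)).
  by move=> _ [p [_ [Pp [a _ <-] ->]]] Sp; apply: H; exists a, p.
move=> x y Pxy; apply: contrapT => /not_orP [/ES [a [p [Pp Sa]]] /ES [b [q [Pq Sb]]]].
have Pm c z : P z -> P (c * z) by move=> Pz; exact: (submodZ HP).
apply: (PS _ _ (SM _ _ Sa Sb)); rewrite mulrDl; apply: (submodD HP).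
  by rewrite mulrC; exact: Pm.
rewrite mulrDr; apply: (submodD HP); first exact: Pm.
by rewrite mulrACA; exact: Pm.
Qed.

Lemma ann_submodule X : is_submodule (annihilator X : set A^o).
Proof.
apply/submoduleP; split=> [x|a b c Xb Xc x]; first by rewrite scale0r.
by rewrite scalerDl -scalerA Xb Xc scaler0 addr0.
Qed.

(* Nakayama's lemma at the prime P, without localizing. *)
Lemma prime_nakayama P X : is_prime P -> acc X ->
  (forall x : X, exists2 s, ~ P s & ideal_smul P (s *: x)) ->
  exists2 s, ~ P s & forall x : X, s *: x = 0.
Proof.
move=> pP aX HX; have [HP nP1 PM] := prime_idealP pP.
have [l _ lT] := acc_fg aX (@submodule_setT A X).
suff /(_ [::] l) : forall l1 l2 : seq X,
    (forall x : X, exists2 s, ~ P s & lspan (l1 ++ l2) (s *: x)) ->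
    forall x, exists2 s, ~ P s & lspan l1 (s *: x).
  rewrite /= lT => H.
  have {}H (x : X) : exists2 s, ~ P s & s *: x = 0.
    have [|s Ps Hs] := H _ x; last by exists s.
    by move=> y; exists 1.
  have [s Ps Hs] : exists2 s, ~ P s & forall x, x \in l -> s *: x = 0.
    elim: (l) => [|x l' [s Ps Hs]]; first by exists 1.
    have [t Pt tx] := H x; exists (s * t); first exact: primeN_mul.
    move=> y; rewrite inE => /orP [/eqP ->|yl]; first by rewrite -scalerA tx scaler0.
    by rewrite mulrC -scalerA Hs // scaler0.
  exists s => // x; have : lspan l x by rewrite lT.
  by apply: (lspan_min (S := [set x | s *: x = 0])) => //; exact: (scale_submodule s (@submodule0 A X)).
move=> l1 l2; elim: l2 l1 => [|x0 l2 IH] l1; first by rewrite cats0.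
rewrite -cat_rcons => H12.
have {}IH := IH (rcons l1 x0) H12.
have HL : is_submodule (lspan l1) by exact: lspan_submodule.
have decomp y : exists s b n, [/\ ~ P s, lspan l1 n & s *: y = n + b *: x0].
  have [s Ps] := IH y; rewrite -cats1 => Hs.
  have : addS (lspan l1) (line x0) (s *: y).
    move: Hs; set w := s *: y; clearbody w; elim: (l1) w => [|z l' IHl] w /=.
      by move=> [_ [_ [[b _ <-] -> ->]]]; exists 0, (b *: x0); rewrite addrC; split=> //; exists b.
    move=> [c [w' [zc /IHl [n [v [ln lv ->]]] ->]]].
    by exists (c + n), v; rewrite addrA; split=> //; exists c, n.
  by move=> [n [_ [ln [b _ <-] E]]]; exists s, b, n.
(* R consists of the y that some s outside P carries into [lspan l1] + P x0. It contains PX, hence a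
   multiple of x0, which gives a relation with coefficient ts - a outside P. *)
pose R : set X := [set y | exists s a n, [/\ ~ P s, P a, lspan l1 n & s *: y = n + a *: x0]].
have HR : is_submodule R.
  apply/submoduleP; split.
    by exists 1, 0, 0; rewrite scaler0 scale0r addr0; split=> //; [exact: (submod0 HP)|exact: submod0].
  move=> c y1 y2 [s1 [a1 [n1 [Ps1 Pa1 ln1 E1]]]] [s2 [a2 [n2 [Ps2 Pa2 ln2 E2]]]].
  exists (s1 * s2), (s2 * c * a1 + s1 * a2), ((s2 * c) *: n1 + s1 *: n2); split.
  - exact: primeN_mul.
  - by apply: (submodD HP); exact: (submodZ HP).
  - by apply: submodD => //; exact: submodZ.
  - have -> : (s1 * s2) *: (c *: y1 + y2) = (s2 * c) *: (s1 *: y1) + s1 *: (s2 *: y2).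
      by rewrite scalerDr !scalerA; congr (_ *: _ + _); rewrite -mulrA mulrC.
    by rewrite E1 E2 2!scalerDr addrACA !scalerA -scalerDl.
have [s Ps Hs] := HX x0.
have [t [a [n [Pt Pa ln E]]]] : R (s *: x0).
  move: Hs; apply: ideal_smul_min => // a z Pa.
  have [s' [b [n [Ps' ln E]]]] := decomp z.
  exists s', (a * b), (a *: n); split=> //; [by rewrite mulrC; exact: (submodZ HP)|exact: submodZ|].
  by rewrite scalerA [s' * a]mulrC -[LHS]scalerA E scalerDr scalerA.
have x0l : lspan l1 ((t * s - a) *: x0) by rewrite scalerBl -scalerA E addrK.
have Pts : ~ P (t * s - a).
  move=> H; apply: (primeN_mul pP Pt Ps); rewrite -(subrK a (t * s)); exact: (submodD HP).
move=> y; have [s' [b [n' [Ps' ln' E']]]] := decomp y.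
exists ((t * s - a) * s'); first exact: primeN_mul.
rewrite -scalerA E' scalerDr; apply: submodD => //; first exact: submodZ.
by rewrite scalerA mulrC -scalerA; exact: submodZ.
Qed.

Lemma prime_nakayama_ann P X : is_prime P -> acc X -> annihilator X `<=` P ->
  ~ (forall x : X, exists2 s, ~ P s & ideal_smul P (s *: x)).
Proof. by move=> pP aX XP /(prime_nakayama pP aX) [s Ps Hs]; apply/Ps/XP. Qed.

Section Local.
Variables (m : set A) (m_local : is_local m).
Hypothesis aA : acc (A^o : lmodType A).

Lemma local_prime : is_prime m.
Proof.
apply: prime_intro; [exact: local_ideal m_local|exact: (local_not1 m_local)|].
move=> x y mxy; apply: contrapT => /not_orP [nx ny].
exact: (nmem_mul m_local nx ny).
Qed.

Lemma prime_sub_local P : is_prime P -> P `<=` m.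
Proof. by move=> [PI _]; exact: (proper_sub_local m_local PI). Qed.

(** Such a line is zero or a copy of the residue field, so a nonzero element of it generates it. *)
Lemma line_no_chain2 X (x : X) : (forall a, m a -> a *: x = 0) -> ~ schain (submod (line x)) 2.
Proof.
move=> mx /has_chainP [N [_ [N1 [N1N nNN1] [HN1 [N2 [N21 nN12] [HN2 _]]]]]].
apply: nNN1 => z _.
have [y [N1y nN2y]] : exists y, N1 y /\ ~ N2 y.
  by apply: contrapT => H; apply: nN12 => y N1y; apply: contrapT => nN2y; apply: H; exists y.
have [b _ yE] := submod_valP (line_submodule x) y.
have nmb : ~ m b.
  move=> /mx bx; apply: nN2y; rewrite (_ : y = 0); first exact: submod0 HN2.
  by apply: val_inj; rewrite linear0 /= -yE bx.
have [c cb] := local_inv m_local nmb.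
have [d _ zE] := submod_valP (line_submodule x) z.
rewrite (_ : z = (d * c) *: y); first exact: (submodZ HN1).
by apply: val_inj; rewrite linearZ /= -yE -zE scalerA -mulrA cb mulr1.
Qed.

Lemma line_flen X (x : X) : (forall a, m a -> a *: x = 0) -> flen (submod (line x)).
Proof. by move=> mx; exists 2%N; exact: line_no_chain2. Qed.

(** Multiply y by each generator of m in turn, as often as the result stays nonzero. *)
Lemma socle_elt X (y : X) : y <> 0 -> (forall a x, m a -> exists n, a ^+ n *: (x : X) = 0) ->
  exists b, b *: y <> 0 /\ forall a, m a -> a *: (b *: y) = 0.
Proof.
move=> y0 nil; have [ms msm Ems] := acc_fg aA (local_ideal m_local).
suff [b [by0 Hb]] : exists b, b *: y <> 0 /\ forall a, a \in ms -> a *: (b *: y) = 0.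
  exists b; split=> // a; rewrite -[m]Ems.
  apply: (@lspan_min A A^o ms [set a | a *: (b *: y) = 0]) => //.
  exact: (colon_submodule (b *: y) (@submodule0 A X)).
elim: ms msm {Ems} => [|a l IH] msm; first by exists 1; rewrite scale1r.
have [|b [by0 Hb]] := IH; first by move=> c cl; apply: msm; rewrite inE cl orbT.
have [n Hn] := nil a (b *: y) (msm a (mem_head _ _)).
have [k [nk Hk]] : exists k, a ^+ k *: (b *: y) <> 0 /\ a ^+ k.+1 *: (b *: y) = 0.
  apply: contrapT => H; elim: n Hn => [|n IHn]; first by rewrite expr0 scale1r.
  by move=> Hn; apply: IHn; apply: contrapT => H'; apply: H; exists n.
exists (a ^+ k * b); rewrite -scalerA; split=> // c; rewrite inE => /orP [/eqP ->|cl].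
  by rewrite (scalerA a) -exprS.
by rewrite (scalerA c) mulrC -scalerA Hb // scaler0.
Qed.

(** A maximal submodule S of finite length is everything: otherwise a socle element of X / S would
    enlarge S by a line. *)
Lemma flen_nilp X : acc X -> (forall a x, m a -> exists n, a ^+ n *: (x : X) = 0) -> flen X.
Proof.
move=> aX nil.
have f0 : flen (submod [set (0 : X)]).
  have [] // := @trivial_flen A (submod [set (0 : X)]).
  move=> x; apply: val_inj; rewrite linear0; exact: (submod_valP (@submodule0 A X) x).
have [S [HS fS Smax]] := @acc_max X (fun S => flen (submod S)) _ aX (@submodule0 A X) f0.
suff ST : forall x, S x.
  have s := ses_subquot HS; apply/(ses_flen s); split=> //.
  have [] // := @trivial_flen A (quotmod S).
  by move=> q; have [x <-] := surj_qpi q; apply/(ker_qpi HS); exact: ST.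
move=> x; apply: contrapT => nSx.
have nilq a (q : quotmod S) : m a -> exists n, a ^+ n *: q = 0.
  move=> ma; have [y <-] := surj_qpi q; have [n Hn] := nil a y ma.
  by exists n; rewrite -linearZ Hn linear0.
have [|b []] := @socle_elt _ (qpi S x) _ nilq; first by move/(ker_qpi HS).
rewrite -linearZ; set z := b *: x => zS mz.
apply: zS; apply/(ker_qpi HS).
pose S' := addS S (line z).
have HS' : is_submodule S' by apply: addS_submodule => //; exact: line_submodule.
have S'z : S' z by apply: sub_addSr => //; exists 1; rewrite ?scale1r.
apply: (Smax S' HS' _ _ _ S'z); last by apply: sub_addSl; exact: line_submodule.
have gS' (w : submod S') : line (qpi S z) (qpi S (\val w)).
  have [s [_ [Ss [c _ <-] ->]]] := submod_valP HS' w.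
  by exists c => //; rewrite linearD ((ker_qpi HS s).2 Ss) add0r [RHS]linearZ.
have gl : linear (fun w : submod S' => qpi S (\val w)).
  by move=> a v w; rewrite !linearP.
have [g0 g0E] := lin_ex gl.
have [|g gE] := @submod_corestrict A _ _ g0 _ (line_submodule (qpi S z)).
  by move=> w; rewrite g0E.
have gs : onto g.
  move=> v; have [c _ vE] := submod_valP (line_submodule (qpi S z)) v.
  have [w wE] := submod_mem HS' (submodZ HS' c S'z).
  by exists w; apply: val_inj; rewrite gE g0E wE linearZ.
apply/(ses_flen (ses_surj gs)); split; last exact: line_flen.
have [|h hE] := @submod_corestrict A X _ (subval S' \o subval (ker g)) S HS.
  move=> w; have := submod_valP (ker_submodule g) w; rewrite /ker /=.
  move=> /(congr1 val); rewrite gE g0E linear0 => /(ker_qpi HS); exact.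
have hi : inj0 h.
  by move=> w hw; apply: val_inj; apply: val_inj; rewrite -[LHS]hE hw !linear0.
by have [] := inj_len hi fS.
Qed.

End Local.

End Primes.

(** * Hilbert coefficients *)

Section HilbertPolynomials.

Definition hval (s : nat) (e : nat -> int) (n : nat) : int :=
  \sum_(i < s.+1) (-1) ^+ i * e i * 'C(n + (s - i), s - i)%:Z.

Lemma hvalS s e n : hval s.+1 e n =
  \sum_(i < s.+1) (-1) ^+ i * e i * 'C(n + (s - i).+1, (s - i).+1)%:Z + (-1) ^+ s.+1 * e s.+1.
Proof.
rewrite /hval big_ord_recr /= subnn bin0 mulr1; congr (_ + _).
by apply: eq_bigr => i _; rewrite subSn // -ltnS.
Qed.

Lemma hval_diff s e n : hval s.+1 e n.+1 - hval s.+1 e n = hval s e n.+1.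
Proof.
rewrite !hvalS opprD addrACA subrr addr0 -sumrB; apply: eq_bigr => i _.
by rewrite -mulrBr addSn binS PoszD addrAC addnS subrr add0r -addSn.
Qed.

Lemma hval_eq s e e' n : (forall i, (i <= s)%N -> e i = e' i) -> hval s e n = hval s e' n.
Proof. by move=> H; apply: eq_bigr => i _; rewrite H // -ltnS. Qed.

Lemma hval_unique s e e' n0 : (forall n, (n0 <= n)%N -> hval s e n = hval s e' n) ->
  forall i, (i <= s)%N -> e i = e' i.
Proof.
elim: s e e' n0 => [|s IH] e e' n0 H.
  move=> i; rewrite leqn0 => /eqP ->.
  by have := H n0 (leqnn _); rewrite /hval !big_ord_recl !big_ord0 !expr0 !mul1r !bin0 !mulr1 !addr0.
have He : forall i, (i <= s)%N -> e i = e' i.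
  apply: (IH e e' n0.+1) => -[//|n] n0n; rewrite -(hval_diff s e) -(hval_diff s e') !H //; exact: leqW.
move=> i; rewrite leq_eqVlt => /orP [/eqP ->|]; last by rewrite ltnS; exact: He.
have := H n0 (leqnn _); rewrite !hvalS.
rewrite (eq_bigr (fun i : 'I_s.+1 => (-1) ^+ i * e' i * 'C(n0 + (s - i).+1, (s - i).+1)%:Z)).
  by move=> /addrI /(congr1 (fun x => (-1) ^+ s.+1 * x)); rewrite !mulrA -expr2 sqrr_sign !mul1r.
by move=> j _; rewrite He // -ltnS.
Qed.

(** Discrete integration. The new last coefficient is the constant of integration, fixed by the
    value at n0. *)
Lemma hval_int (F : nat -> int) s e n0 :
  (forall n, (n0 <= n)%N -> F n.+1 - F n = hval s e n.+1) ->
  exists e', (forall i, (i <= s)%N -> e' i = e i) /\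
    forall n, (n0 <= n)%N -> F n = hval s.+1 e' n.
Proof.
move=> H; pose e0 i : int := if (i <= s)%N then e i else 0.
pose e' i : int := if (i <= s)%N then e i else (-1) ^+ s.+1 * (F n0 - hval s.+1 e0 n0).
have He i : (i <= s)%N -> e' i = e i by rewrite /e' => ->.
exists e'; split=> // n /subnK <-; elim: (n - n0)%N => [|k IH].
  have -> : hval s.+1 e' n0 = hval s.+1 e0 n0 + (F n0 - hval s.+1 e0 n0).
    rewrite [hval s.+1 e' n0]hvalS [X in _ = X + _]hvalS /e' /e0 !ltnn mulr0 addr0.
    rewrite !mulrA -expr2 sqrr_sign mul1r; congr (_ + _); apply: eq_bigr => i _.
    by rewrite -ltnS ltn_ord.
  by rewrite addrC subrK.
rewrite addSn -(subrK (F (k + n0)%N) (F _.+1)) H ?leq_addl // IH.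
by rewrite -(hval_eq _ He) -hval_diff subrK.
Qed.

(** The same polynomial with a zero leading coefficient in front; shifting the index by one changes
    the signs. *)
Lemma hval_raise s e n :
  hval s.+1 (fun i => if i is j.+1 then - e j else 0) n = hval s e n.
Proof.
rewrite [LHS]/hval big_ord_recl /= mulr0 mul0r add0r; apply: eq_bigr => i _.
by rewrite /bump /= add1n subSS exprS mulN1r mulrNN.
Qed.

Lemma hval_addc s e c n :
  hval s (fun i => if i == s then e i + (-1) ^+ s * c else e i) n = hval s e n + c.
Proof.
rewrite /hval !big_ord_recr /= eqxx subnn bin0 !mulr1 mulrDr mulrA -expr2 sqrr_sign mul1r addrA.
by congr (_ + _ + _); apply: eq_bigr => i _; rewrite ltn_eqF.
Qed.

Lemma hval0 e n : hval 0 e n = e 0%N.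
Proof. by rewrite /hval big_ord_recl big_ord0 expr0 mul1r bin0 mulr1 addr0. Qed.

Lemma bin_le_exp n k : ('C(n + k, k) <= n.+1 ^ k)%N.
Proof.
elim: k => [|k IH]; first by rewrite bin0.
rewrite -(leq_pmul2l (ltn0Sn k)) addnS -mul_bin_diag expnS mulnA.
by apply: leq_mul IH; rewrite mulSn -addSn leq_add2l leq_pmulr.
Qed.

Lemma hval_bound s e : exists C, forall n, hval s e n <= (C * n.+1 ^ s)%N%:Z.
Proof.
suff H k : (k <= s.+1)%N -> exists C, forall n,
    \sum_(i < k) (-1) ^+ i * e i * 'C(n + (s - i), s - i)%:Z <= (C * n.+1 ^ s)%N%:Z.
  exact: H.
elim: k => [_|k IH ks]; first by exists 0%N => n; rewrite big_ord0.
have [C HC] := IH (ltnW ks); exists (C + `|e k|)%N => n.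
rewrite big_ord_recr /= mulnDl PoszD; apply: lerD; first exact: HC.
apply: le_trans (ler_norm _) _; rewrite !normrM normrX normrN1 expr1n mul1r.
rewrite PoszM abszE ler_wpM2l ?normr_ge0 // ger0_norm // lez_nat.
apply: leq_trans (bin_le_exp _ _) _; apply: leq_pexp2l => //; exact: leq_subr.
Qed.

End HilbertPolynomials.

Section Colength.
Variable A : comNzRingType.
Implicit Types X Y Z : lmodType A.

Definition colen X (N : set X) := module_length (quotmod N).

Lemma quot_lin X Y (f : {linear X -> Y}) (S : set X) (T : set Y) : is_submodule T ->
  (forall x, S x -> T (f x)) -> exists g : {linear quotmod S -> quotmod T},
  forall x, g (qpi S x) = qpi T (f x).
Proof.
move=> HT ST; have [|g gE] := @quotmod_lift A X _ S (qpi T \o f).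
  by move=> x /ST Tx; apply/(ker_qpi HT).
by exists g.
Qed.

Lemma lin_id X : exists f : {linear X -> X}, forall x, f x = x.
Proof. by have [f fE] := @lin_ex A X X id (fun a x y => erefl); exists f. Qed.

Lemma col_ses X Y (f : {linear X -> Y}) (S : set Y) : is_submodule S ->
  exists (g : {linear quotmod (f @^-1` S) -> quotmod S})
    (h : {linear quotmod S -> quotmod (addS (range f) S)}), ses g h.
Proof.
move=> HS; have HfS := preimage_submodule f HS.
have HR : is_submodule (addS (range f) S) by apply: addS_submodule => //; exact: range_submodule.
have [//|g gE] := @quot_lin _ _ f (f @^-1` S) S HS.
have [i iE] := lin_id Y.
have [|h hE] := @quot_lin _ _ i S (addS (range f) S) HR.
  by move=> x Sx; rewrite iE; apply: sub_addSr => //; exact: range_submodule.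
exists g, h; split.
- by move=> q; have [x <-] := surj_qpi q; rewrite gE => /(ker_qpi HS) fx; apply/(ker_qpi HfS).
- move=> q; have [y <-] := surj_qpi q; rewrite hE iE (ker_qpi HR); split.
    move=> [_ [s [[x _ <-] Ss ->]]]; exists (qpi _ x); rewrite gE linearD.
    by rewrite ((ker_qpi HS s).2 Ss) addr0.
  move=> [q']; have [x <-] := surj_qpi q'; rewrite gE => /esym /(eq_pi_sub HS) Sy.
  by exists (f x), (y - f x); split; [exists x| |rewrite addrC subrK].
- by move=> q; have [y <-] := surj_qpi q; exists (qpi S y); rewrite hE iE.
Qed.

Lemma col_map X Y (f : {linear X -> Y}) (S : set Y) : is_submodule S ->
  flen (quotmod S) -> [/\ flen (quotmod (f @^-1` S)), flen (quotmod (addS (range f) S)) &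
    colen S = (colen (f @^-1` S) + colen (addS (range f) S))%N].
Proof.
move=> HS fS; have [g [h s]] := col_ses f HS.
by have [f1 f2] := (ses_flen s).1 fS; split=> //; exact: ses_len s fS.
Qed.

Lemma col_sub X (S T : set X) : is_submodule S -> is_submodule T -> S `<=` T ->
  flen (quotmod S) ->
  [/\ flen (quotmod T), (colen T <= colen S)%N & (colen S <= colen T)%N -> T `<=` S].
Proof.
move=> HS HT ST fS; have [i iE] := lin_id X.
have [|h hE] := @quot_lin _ _ i S T HT; first by move=> x /ST; rewrite iE.
have hs : onto h by move=> q; have [y <-] := surj_qpi q; exists (qpi S y); rewrite hE iE.
have [f1 f2 f3] := surj_len hs fS; split=> // /f3 hi x Tx.
by apply/(ker_qpi HS)/hi; rewrite hE iE; apply/(ker_qpi HT).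
Qed.

Lemma iso_pre X Z (g : {linear X -> Z}) (S : set Z) : onto g -> is_submodule S ->
  iso (quotmod (g @^-1` S)) (quotmod S).
Proof.
move=> gs HS; apply: (iso_quot (f := qpi S \o g)).
  by move=> q; have [z <-] := surj_qpi q; have [x <-] := gs z; exists x.
by move=> x; exact: (ker_qpi HS).
Qed.

Lemma pre_pw (I : set A) X (N : set X) n : is_submodule N ->
  qpi N @^-1` pw I n = addS N (pw I n).
Proof.
move=> HN; apply/seteqP; split=> x /=.
  move=> /(pw_onto (surj_qpi (S := N))) [y Iy /(eq_pi_sub HN) Ny].
  exists (x - y), y; split; [|by []|by rewrite subrK].
  by rewrite -opprB; exact: submodN.
move=> [y [z [Ny Iz ->]]]; rewrite linearD ((ker_qpi HN y).2 Ny) add0r; exact: pw_lin.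
Qed.

Definition mulm X (a : A) (x : X) := a *: x.

Fact mulm_linear X a : linear (@mulm X a).
Proof. by move=> b x y; rewrite /mulm scalerDr !scalerA mulrC. Qed.
HB.instance Definition _ X a := GRing.isLinear.Build A X X _ (@mulm X a) (@mulm_linear X a).

Definition mq X (a : A) : lmodType A := quotmod (range (@mulm X a : {linear X -> X})).

Definition mk X (a : A) : set X := ker (@mulm X a : {linear X -> X}).

End Colength.

(** The standing hypotheses. [st_dim] bounds the chains of primes of A; without a bound [krull_dim]
    would fall back to its default value 0. *)
Record setting (A : comNzRingType) (m Q : set A) (gs : seq A) (r : nat) (u : nat -> A) : Prop :=
  Setting {
  st_local : is_local m;
  st_acc : acc (A^o : lmodType A);
  st_gs : @lspan A A^o gs = Q;
  st_Qm : Q `<=` m;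
  st_rad : forall x, m x -> exists n, Q (x ^+ n);
  st_r : (0 < r)%N;
  st_u : general_position Q r u;
  st_dim : fin_chain [set p : set A | is_prime p /\ [set 0] `<=` p] }.

(** * Hilbert functions and dimension *)

Section Dimension.
Variables (A : comNzRingType) (m Q : set A) (gs : seq A) (r : nat) (u : nat -> A).
Hypothesis st : setting m Q gs r u.
Implicit Types X Y Z : lmodType A.

Let HQ : is_submodule (Q : set A^o).
Proof. exact: gens_ideal (st_gs st). Qed.

Lemma mem_u n : Q (u n).
Proof. by have [H _] := st_u st; exact: H. Qed.

Lemma exp_pow a n : Q a -> ideal_pow Q n (a ^+ n).
Proof.
move=> Qa; elim: n => [|n IH]; first by [].
by rewrite exprS; exact: ideal_powS_mem.
Qed.

Definition hl X n := module_length (quotmod (@pw A Q X n)).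

Lemma pw_nilp X n a : m a -> exists k, forall x : X, pw Q n (a ^+ k *: x).
Proof.
move=> ma; have [k Qk] := st_rad st ma; exists (k * n)%N => x.
rewrite exprM -[n]addn0; apply: ideal_pow_mem; last exact: pw0.
by rewrite addn0; exact: exp_pow.
Qed.

Lemma flen_pw_nilp X n : acc X -> (forall x : X, pw Q n x -> x = 0) -> flen X.
Proof.
move=> aX Hn; apply: (flen_nilp (st_local st) (st_acc st) aX) => a x ma.
by have [k Hk] := @pw_nilp X n a ma; exists k; exact/Hn.
Qed.

Lemma flen_quot_pw X n : acc X -> flen (quotmod (@pw A Q X n)).
Proof.
move=> aX; apply: (flen_nilp (st_local st) (st_acc st) (acc_quot aX)) => a q ma.
have [k Hk] := @pw_nilp X n a ma; exists k; have [x <-] := surj_qpi q.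
by rewrite -linearZ; apply/(ker_qpi (pw_submodule Q X n)).
Qed.

Lemma hl_mono X i j : acc X -> (i <= j)%N -> (hl X i <= hl X j)%N.
Proof.
move=> aX ij; have [] := col_sub (pw_submodule Q X j) (pw_submodule Q X i) (pw_le ij) (flen_quot_pw j aX).
by [].
Qed.

(** Once the lengths stop growing, Q^N X lies in every Q^n X, and these meet in zero. *)
Lemma pw_stable0 X N : acc X -> (forall n, (N <= n)%N -> (hl X n <= hl X N)%N) ->
  forall x : X, pw Q N x -> x = 0.
Proof.
move=> aX HN x Nx; apply: (krull (st_gs st) (st_local st) (st_Qm st) aX) => n.
have [nN|Nn] := leqP n N; first exact: pw_le nN _ Nx.
have [_ _] := col_sub (pw_submodule Q X n) (pw_submodule Q X N) (pw_le (ltnW Nn)) (flen_quot_pw n aX).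
by apply => //; exact: HN (ltnW Nn).
Qed.

Lemma flen_pw0 X : flen X -> exists N, forall x : X, pw Q N x -> x = 0.
Proof.
move=> fX; have aX := flen_acc fX.
have [n|n|N HN] := @nondec_stab (hl X) (module_length X).
- exact: hl_mono.
- by have [] := surj_len (surj_qpi (S := @pw A Q X n)) fX.
by exists N; apply: pw_stable0 => // n Nn; rewrite HN.
Qed.

Lemma flenP X : acc X -> flen X <-> exists N, forall x : X, pw Q N x -> x = 0.
Proof. by move=> aX; split=> [|[N]]; [exact: flen_pw0|exact: flen_pw_nilp]. Qed.

(** The image of multiplication by a in X / Q^n X is X / (Q^n X : a), and the cokernel is X / aX
    modulo Q^n. *)
Lemma hl_mq X a n : acc X ->
  hl X n = (colen (@mulm A X a @^-1` pw Q n) + hl (mq X a) n)%N.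
Proof.
move=> aX; have HS := pw_submodule Q X n.
have [_ f2 E] := col_map (@mulm A X a : {linear X -> X}) HS (flen_quot_pw n aX).
rewrite /hl -/(colen (pw Q n)) E; congr (_ + _)%N.
have HR := range_submodule (@mulm A X a : {linear X -> X}).
have := iso_pre (surj_qpi (S := range (@mulm A X a : {linear X -> X}))) (pw_submodule Q (mq X a) n).
by rewrite pre_pw // => /iso_flen H; have [] := H f2.
Qed.

Lemma sup_ker X a : acc X -> superficial Q X a ->
  exists c, forall x : X, pw Q c x -> a *: x = 0 -> x = 0.
Proof.
move=> aX [c Hc]; exists c => x cx ax.
apply: (krull (st_gs st) (st_local st) (st_Qm st) aX) => n.
have [nc|cn] := leqP n c; first exact: pw_le nc _ cx.
apply: (Hc n (ltnW cn) x cx); rewrite ax; apply: submod0; exact: pw_submodule.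
Qed.

Lemma sup_ker_flen X a : acc X -> superficial Q X a -> flen (submod (@mk A X a)).
Proof.
move=> aX /(sup_ker aX) [c Hc].
apply: (@flen_pw_nilp _ c (acc_sub aX)) => z cz.
apply: val_inj; rewrite linear0; apply: Hc; first exact: (pw_lin (subval _) cz).
exact: (submod_valP (ker_submodule _) z).
Qed.

(** For large n the colon Q^(n+1) X : a is (0 : a) + Q^n X: Artin-Rees for X / (0 : a) inside X
    brings an element of the colon close to (0 : a), and superficiality does the rest. The sum is
    direct for large n, so (0 : a) contributes its length. *)
Lemma superficial_diff X a : acc X -> Q a -> superficial Q X a -> exists n0, forall n, (n0 <= n)%N ->
  (hl X n.+1 + module_length (submod (@mk A X a)) = hl X n + hl (mq X a) n.+1)%N.
Proof.
move=> aX Qa sa; have [c Hc] := sup_ker aX sa; have [c1 Hc1] := sa.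
pose f : {linear X -> X} := @mulm A X a; pose K := @mk A X a.
have HK : is_submodule K := ker_submodule f.
have [//|g gE] := @quotmod_lift A X X K f.
have gi : inj0 g by move=> q; have [x <-] := surj_qpi q; rewrite gE => fx; exact/(ker_qpi HK).
have [c2 Hc2] := artin_rees_inj (st_gs st) aX gi.
exists (c + c1 + c2)%N => n nc.
have n_c : (c <= n)%N by apply: leq_trans nc; rewrite -addnA leq_addr.
have n_c2 : (c2 <= n)%N by apply: leq_trans nc; rewrite leq_addl.
rewrite (hl_mq a n.+1 aX) addnAC; congr (_ + _)%N.
have -> : @mulm A X a @^-1` pw Q n.+1 = addS (range (subval K)) (pw Q n).
  apply/seteqP; split=> x.
    move=> ax; have : pw Q (n.+1 - c2) (qpi K x).
      by apply: Hc2; rewrite gE subnK //; exact: leqW.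
    have : (qpi K @^-1` pw Q (n.+1 - c2)) x = pw Q (n.+1 - c2) (qpi K x) by [].
    rewrite pre_pw // => <- [k [y [Kk Qy xE]]].
    exists k, y; split=> //; first by have [z zk] := submod_mem HK Kk; exists z.
    have c1n : (c1 <= n - c2)%N by rewrite leq_subRL // addnC; apply: leq_trans nc; rewrite -addnA leq_addl.
    apply: (Hc1 n); first by apply: leq_trans c1n _; exact: leq_subr.
      by apply: (pw_le _ Qy); rewrite subSn //; exact: leqW.
    by move: ax; rewrite xE /= /mulm scalerDr (Kk : a *: k = 0) add0r.
  move=> [_ [y [[z _ <-] Qy ->]]] /=; rewrite /mulm scalerDr.
  have -> : a *: subval K z = 0 by exact: (submod_valP HK z).
  by rewrite add0r; exact: pwS_mem.
have [_ _ E] := col_map (subval K) (pw_submodule Q X n) (flen_quot_pw n aX).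
rewrite /hl -/(colen (pw Q n)) E addnC; congr (_ + _)%N.
have fK := sup_ker_flen aX sa; have [i iE] := lin_id (submod K).
apply/esym; apply: (iso_flen _ fK).2; apply: iso_sym.
apply: (iso_quot (f := i)); first by move=> z; exists z.
move=> z; rewrite iE; split=> [->|Qz].
  exact: (submod0 (preimage_submodule (subval K) (pw_submodule Q X n))).
apply: val_inj; rewrite linear0; apply: Hc; first exact: (pw_le n_c Qz).
exact: (submod_valP HK z).
Qed.

Definition dimge X n := has_chain [set p : set A | is_prime p /\ annihilator X `<=` p] n.

Lemma dimge_fin X : fin_chain [set p : set A | is_prime p /\ annihilator X `<=` p].
Proof.
have [n Hn] := st_dim st; exists n => -[c [cP cl]]; apply: Hn; exists c; split=> // i /cP [pc _].
by split=> // x ->; have [H _ _] := prime_idealP pc; exact: (submod0 H).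
Qed.

(** At n = 0 the equivalence would fail for the zero module: no prime contains its annihilator,
    although its dimension is 0 by convention. *)
Lemma dimP X n : (0 < n)%N -> dimge X n <-> (n <= module_dim X)%N.
Proof.
move=> n0; have [h0|nh0] := pselect (dimge X 0).
  exact: chain_lengthP (dimge_fin X) h0 n.
have nh k : ~ dimge X k by move=> /(has_chain_le (leq0n k)).
split=> [/nh //|]; rewrite /module_dim /krull_dim /chain_length.
case: xgetP => [k _ [/nh //]|_]; by rewrite leqNgt n0.
Qed.

Lemma dim_mono X Y : annihilator X `<=` annihilator Y -> (module_dim Y <= module_dim X)%N.
Proof.
move=> XY; case E : (module_dim Y) => [//|k]; apply/(dimP X (ltn0Sn k)).
have : dimge Y k.+1 by apply/dimP; rewrite ?E.
move=> [c [cP cl]]; exists c; split=> // i /cP [pc Yc]; split=> //; exact: subset_trans Yc.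
Qed.

Lemma dim_inj X Y (f : {linear X -> Y}) : inj0 f -> (module_dim X <= module_dim Y)%N.
Proof. by move=> fi; apply: dim_mono => a Ya x; apply: fi; rewrite linearZ /= Ya. Qed.

Lemma dim_onto X Y (f : {linear X -> Y}) : onto f -> (module_dim Y <= module_dim X)%N.
Proof. by move=> fs; apply: dim_mono => a Xa y; have [x <-] := fs y; rewrite -linearZ /= Xa linear0. Qed.

Lemma dim_iso X Y : iso X Y -> module_dim X = module_dim Y.
Proof.
move=> [f [fi fs]]; apply/eqP; rewrite eqn_leq; apply/andP.
by split; [exact: dim_inj fi|exact: dim_onto fs].
Qed.

Lemma dim_ses X Y Z (f : {linear X -> Y}) (g : {linear Y -> Z}) : ses f g ->
  (module_dim Y <= maxn (module_dim X) (module_dim Z))%N.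
Proof.
move=> [fi fg _]; case E : (module_dim Y) => [//|k].
have : dimge Y k.+1 by apply/dimP; rewrite ?E.
move=> [c [cP cl]]; have [p0 Yp0] := cP 0%N (leq0n _).
have cle i : (i <= k.+1)%N -> c 0%N `<=` c i.
  elim: i => [_ x //|i IH ik]; apply: subset_trans (IH (ltnW ik)) _; exact: (cl i ik).1.
have [HP P1 PM] := prime_idealP p0.
have : annihilator X `<=` c 0%N \/ annihilator Z `<=` c 0%N.
  apply: contrapT => /not_orP [nX nZ].
  have [a Xa npa] : exists2 a, annihilator X a & ~ c 0%N a.
    by apply: contrapT => H; apply: nX => a Xa; apply: contrapT => npa; apply: H; exists a.
  have [b Zb npb] : exists2 b, annihilator Z b & ~ c 0%N b.
    by apply: contrapT => H; apply: nZ => b Xb; apply: contrapT => npb; apply: H; exists b.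
  apply: (primeN_mul p0 npa npb); apply: Yp0 => y; rewrite -scalerA.
  have [x <-] : exists x, f x = b *: y by apply/fg; rewrite linearZ /= Zb.
  by rewrite -linearZ /= Xa linear0.
by move=> [H|H]; rewrite leq_max; apply/orP; [left|right]; apply/dimP => //;
  exists c; split=> // i ik; have [pc _] := cP i ik; split=> //; exact: subset_trans H (cle i ik).
Qed.

Lemma Qpow_prime P c : is_prime P -> ideal_pow Q c `<=` P -> P = m.
Proof.
move=> pP QP.
have mP : m `<=` P.
  move=> x /(st_rad st) [k Qk]; apply: (@prime_exp A P x k) => //.
  by apply: (@prime_exp A P (x ^+ k) c) => //; apply: QP; exact: exp_pow.
apply/seteqP; split=> //; exact: (prime_sub_local (st_local st) pP).
Qed.

(** If no power of some a in m annihilated X, a prime over the annihilator of X avoiding the powers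
    of a would lie strictly below m. *)
Lemma dim0P X : acc X -> module_dim X = 0%N <-> flen X.
Proof.
move=> aX; split=> [d0|fX].
  apply: (flen_nilp (st_local st) (st_acc st) aX) => a x ma.
  suff [n Hn] : exists n, annihilator X (a ^+ n) by exists n; exact: Hn.
  apply: contrapT => H.
  have [||||P [pP XP PS]] := @prime_avoid A (annihilator X) (range (fun n => a ^+ n)) (st_acc st).
  - exact: ann_submodule.
  - by exists 0%N; rewrite ?expr0.
  - by move=> _ _ [i _ <-] [j _ <-]; exists (i + j)%N; rewrite ?exprD.
  - by move=> t Xt [i _ E]; apply: H; exists i; rewrite E.
  suff : dimge X 1 by move/(dimP X (ltn0Sn 0)); rewrite d0.
  apply/has_chainP; exists m; split.
    split; first exact: (local_prime (st_local st)).
    by apply: subset_trans XP _; exact: (prime_sub_local (st_local st) pP).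
  exists P => //; split; first exact: (prime_sub_local (st_local st) pP).
  by move=> /(_ a ma) /PS; apply; exists 1%N; rewrite ?expr1.
have [N HN] := flen_pw0 fX.
case E : (module_dim X) => [//|k].
have : dimge X 1 by apply/dimP; rewrite ?E.
move=> [c [cP cl]].
have cm i : (i <= 1)%N -> c i = m.
  move=> /cP [pc Xc]; apply: (Qpow_prime (c := N)) => // b Qb; apply: Xc => x; apply: HN.
  by rewrite -[N]addn0; apply: ideal_pow_mem; [by []|exact: pw0].
by have [_ H] := cl 0%N isT; case: H; rewrite !cm.
Qed.

(** The lowest prime of a chain for X / aX contains a, and a prime below it that avoids a is wanted.
    It exists unless some s a^k, with s outside the lowest prime, annihilates X; then, a being
    regular on Q^c X, the lowest prime contains Q^c and equals m, so it could not start a chain. *)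
Lemma dim_drop X a c n : acc X -> (forall x : X, pw Q c x -> a *: x = 0 -> x = 0) ->
  (0 < n)%N -> dimge (mq X a) n -> dimge X n.+1.
Proof.
move=> aX Hc n0 [cc [ccP ccl]].
have [p0 Yp0] := ccP 0%N (leq0n _).
have XY : annihilator X `<=` annihilator (mq X a).
  by move=> b Xb q; have [x <-] := surj_qpi q; rewrite -linearZ /= Xb linear0.
have ap0 : cc 0%N a.
  apply: Yp0 => q; have [x <-] := surj_qpi q; rewrite -linearZ.
  by apply/(ker_qpi (range_submodule _)); exists x.
have [HP P1 PM] := prime_idealP p0.
have [||||P [pP XP PS]] := @prime_avoid A (annihilator X)
   [set x | exists s k, ~ cc 0%N s /\ x = s * a ^+ k] (st_acc st).
- exact: ann_submodule.
- by exists 1, 0%N; rewrite expr0 mul1r.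
- move=> _ _ [s1 [k1 [Ps1 ->]]] [s2 [k2 [Ps2 ->]]]; exists (s1 * s2), (k1 + k2)%N.
  by split; [exact: primeN_mul|rewrite exprD mulrACA].
- move=> t Xt [s [k [Ps tE]]].
  have bk b : ideal_pow Q c b -> forall j (y : X), a ^+ j *: y = 0 -> b ^+ j *: y = 0.
    move=> Qb; elim=> [|j IH] y; first by rewrite !expr0.
    rewrite !exprSr -!scalerA => ay; apply: IH; rewrite scalerA mulrC -scalerA; apply: Hc.
      by rewrite -[c]addn0; apply: ideal_pow_mem; [by []|exact: pw0].
    by rewrite -[RHS](scaler0 _ b) -ay !scalerA; congr (_ *: _); rewrite !mulrA -[LHS]mulrA [LHS]mulrC.
  have : cc 0%N = m.
    apply: (Qpow_prime (c := c)) => // b Qb.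
    have : cc 0%N (b ^+ k * s).
      apply/Yp0/XY => y; rewrite -scalerA; apply: bk => //.
      by rewrite scalerA mulrC -tE.
    by move=> /PM [/(prime_exp p0)|/Ps].
  have [_] := ccl 0%N n0 => nsub E; apply: nsub; rewrite E.
  by have [p1 _] := ccP 1%N n0; exact: (prime_sub_local (st_local st) p1).
exists (fun i => if i is j.+1 then cc j else P); split=> [[_|j jn]|[_|j jn]].
- by split.
- by have [pj Yj] := ccP j jn; split=> //; exact: subset_trans Yj.
- split.
    by move=> x Px; apply: contrapT => nx; apply: (PS x Px); exists x, 0%N; rewrite expr0 mulr1.
  by move=> /(_ a ap0) /PS; apply; exists 1, 1%N; rewrite mul1r expr1.
- exact: ccl.
Qed.

Lemma dim_mq_lt X a : acc X -> superficial Q X a -> (0 < module_dim X)%N ->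
  (module_dim (mq X a) < module_dim X)%N.
Proof.
move=> aX sa d0; have [c Hc] := sup_ker aX sa.
case E : (module_dim (mq X a)) => [//|k].
have : dimge (mq X a) k.+1 by apply/dimP; rewrite ?E.
by move=> /(dim_drop aX Hc (ltn0Sn k)) /dimP; apply.
Qed.

Definition growth X s := exists C, forall n, (hl X n <= C * n.+1 ^ s)%N.

Lemma hl_onto X Y (f : {linear X -> Y}) n : acc X -> onto f -> (hl Y n <= hl X n)%N.
Proof.
move=> aX fs; have HS := pw_submodule Q Y n.
have fY := flen_quot_pw n (acc_surj fs aX).
have /iso_sym /iso_flen /(_ fY) [_ E] := iso_pre fs HS.
have [] := col_sub (pw_submodule Q X n) (preimage_submodule f HS) (fun x => @pw_lin _ _ _ _ f n x) (flen_quot_pw n aX).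
by rewrite /colen E.
Qed.

(** Growth alone bounds the dimension, before Hilbert polynomials exist. Passing to X / W makes X
    torsion-free over A modulo the lowest prime P0. An x in the next prime outside P0 is then
    regular, and the quotient by x has slower growth and a chain shorter by one. *)
Lemma growth_dim n s X : acc X -> growth X s -> dimge X n -> (n <= s)%N.
Proof.
elim: n s X => [//|n IH] s X aX [C HC] [c [cP cl]].
have [p0 Xp0] := cP 0%N (leq0n _); have [p1 _] := cP 1%N isT.
set P0 := c 0%N in p0 Xp0 *; set P1 := c 1%N in p1 *.
have [P01 nP10] : P0 `<` P1 by exact: cl.
have [x P1x nP0x] : exists2 x, P1 x & ~ P0 x.
  by apply: contrapT => H; apply: nP10 => x P1x; apply: contrapT => nP0x; apply: H; exists x.
pose W : set X := [set y | exists2 t, ~ P0 t & ideal_smul P0 (t *: y)].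
have HW : is_submodule W.
  have [_ n1 _] := prime_idealP p0.
  apply/submoduleP; split.
    by exists 1 => //; rewrite scaler0; exact: (submod0 (ideal_smul_submodule X P0)).
  move=> b y z [t Pt ty] [t' Pt' tz]; exists (t * t'); first exact: primeN_mul.
  have -> : (t * t') *: (b *: y + z) = (t' * b) *: (t *: y) + t *: (t' *: z).
    by rewrite scalerDr !scalerA; congr (_ *: _ + _); rewrite -mulrA mulrC.
  have HI := ideal_smul_submodule X P0.
  by apply: (submodD HI); exact: (submodZ HI).
pose Y : lmodType A := quotmod W.
have aY : acc Y by exact: acc_quot.
have HY k : (hl Y k <= hl X k)%N by apply: hl_onto (surj_qpi (S := W)).
have annY : annihilator Y `<=` P0.
  move=> t Yt; apply: contrapT => nPt; apply: (prime_nakayama_ann p0 aX Xp0) => y.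
  have : W (t *: y) by apply/(ker_qpi HW); rewrite linearZ; exact: Yt.
  by move=> [t' Pt']; rewrite scalerA => H; exists (t' * t) => //; exact: primeN_mul.
have xreg : inj0 (@mulm A Y x : {linear Y -> Y}).
  move=> q; have [y <-] := surj_qpi q; rewrite /= /mulm -linearZ => /(ker_qpi HW) [t Pt].
  rewrite scalerA => H; apply/(ker_qpi HW); exists (t * x) => //; exact: primeN_mul.
pose Z := mq Y x; have aZ : acc Z by exact: acc_quot.
have annZ : annihilator Z `<=` P1.
  move=> t Zt; apply: contrapT => nPt.
  apply: (prime_nakayama_ann p1 aY (subset_trans annY P01)) => q; exists t => //.
  have : qpi (range (@mulm A Y x : {linear Y -> Y})) (t *: q) = 0 by rewrite linearZ; exact: Zt.
  move=> /(ker_qpi (range_submodule _)) [q' _ <-]; exact: ideal_smul_mem.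
have dZ : dimge Z n.
  have cle i : (i <= n)%N -> P1 `<=` c i.+1.
    elim: i => [_ t //|i IHi ik]; apply: subset_trans (IHi (ltnW ik)) _; exact: (cl i.+1 ik).1.
  exists (fun i => c i.+1); split=> [i ik|i ik]; last exact: cl.
  have [pi _] := cP i.+1 ik; split=> //.
  exact: subset_trans annZ (cle i ik).
case: s HC => [|s] HC.
  have [k|k|N HN] := @nondec_stab (hl Y) C.
  - exact: hl_mono.
  - by apply: leq_trans (HY k) _; have := HC k; rewrite expn0 muln1.
  have Y0 : forall q : Y, pw Q N q -> q = 0 by apply: pw_stable0 => // k Nk; rewrite HN.
  have : P0 = m.
    apply: (Qpow_prime (c := N)) => // b Qb; apply: annY => q; apply: Y0.
    by rewrite -[N]addn0; apply: ideal_pow_mem; [by []|exact: pw0].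
  by move=> E; case: nP10; rewrite E; exact: (prime_sub_local (st_local st) p1).
rewrite ltnS; apply: (IH s Z aZ) => //.
have [c0 Hc0] := artin_rees_inj (st_gs st) aY xreg.
pose c1 := c0.+1.
have step k : (hl Z (k + c1) + hl Y k <= hl Y (k + c1))%N.
  rewrite (hl_mq x (k + c1) aY) addnC leq_add2r.
  have Hpre := preimage_submodule (@mulm A Y x : {linear Y -> Y}) (pw_submodule Q Y (k + c1)).
  have [f1 _ _] := col_map (@mulm A Y x : {linear Y -> Y}) (pw_submodule Q Y (k + c1)) (flen_quot_pw (k + c1) aY).
  have [|_ H _] := col_sub Hpre (pw_submodule Q Y k) _ f1; last exact: H.
  by move=> y /= Hy; apply: Hc0; apply: (pw_le _ Hy); rewrite leq_add2l.
(* Adding up [step] along multiples of c1: j copies of the Hilbert function of Z fit below one value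
   of that of Y. *)
have tele j i : (j * hl Z (i * c1) + hl Y (i * c1) <= hl Y ((i + j) * c1))%N.
  elim: j => [|j IHj]; first by rewrite mul0n add0n addn0.
  rewrite mulSn -addnA addnS mulSn [(c1 + _)%N]addnC; apply: leq_trans (step _).
  apply: leq_add => //; apply: hl_mono => //.
  by apply: leq_trans (leq_addr _ _); rewrite leq_mul2r leq_addr orbT.
(* Take i = j = k + 1 in [tele] and divide by k + 1: the bound C (2(k+1)c1 + 1)^(s+1) is at most C
   ((2 c1 + 1)(k + 1))^(s+1). *)
exists (C * (c1.*2.+1) ^ s.+1)%N => k.
apply: (@leq_trans (hl Z (k.+1 * c1))); first by apply: hl_mono => //; apply: leq_trans (leqnSn k) _; rewrite leq_pmulr.
rewrite -(leq_pmul2l (ltn0Sn k)).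
apply: leq_trans (leq_trans (leq_addr _ _) (tele k.+1 k.+1)) _.
apply: leq_trans (HY _) _; apply: leq_trans (HC _) _.
rewrite mulnCA -mulnA leq_mul2l; apply/orP; right.
rewrite -expnS -expnMn leq_exp2r // mulSn; set b := k.+1; rewrite addnn -doubleMl doubleMr mulnC.
by rewrite -addn1 addnC leq_add2r.
Qed.

Lemma leq_exp2l_base a b k : (a <= b)%N -> (a ^ k <= b ^ k)%N.
Proof. by case: k => // k ab; rewrite leq_exp2r. Qed.

Lemma hp_growth X s e n0 : acc X ->
  (forall n, (n0 <= n)%N -> (hl X n.+1)%:Z = hval s e n) -> growth X s.
Proof.
move=> aX H; have [C HC] := hval_bound s e; exists (C * n0.+1 ^ s)%N => n.
apply: (@leq_trans (hl X (n0 + n).+1)); first by apply: hl_mono => //; apply: leqW; exact: leq_addl.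
rewrite -lez_nat H ?leq_addr //; apply: le_trans (HC _) _; rewrite lez_nat.
rewrite -mulnA leq_mul2l; apply/orP; right; rewrite -expnMn; apply: leq_exp2l_base.
by rewrite mulSn [(n0 + n)%N]addnC -addSn leq_add2l leq_pmulr.
Qed.

(** The polynomial at n measures X / Q^(n+1) X. The degree s may exceed the dimension, leading
    coefficients being allowed to vanish. *)
Definition hp X s e := exists n0, forall n, (n0 <= n)%N -> (hl X n.+1)%:Z = hval s e n.

(** The kernel of a enters the difference function as a constant, so it is felt only in index s;
    index s + 1 is a constant of integration. *)
Lemma hp_integrate X a s e : acc X -> Q a -> superficial Q X a -> hp (mq X a) s e ->
  exists e', [/\ hp X s.+1 e', (forall i, (i < s)%N -> e' i = e i) &
    e' s = e s - (-1) ^+ s * (module_length (submod (@mk A X a)))%:Z].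
Proof.
move=> aX Qa sa [n0 H0]; set l := module_length _.
have [n1 H1] := superficial_diff aX Qa sa.
pose e1 i := if i == s then e i + (-1) ^+ s * (- l%:Z) else e i.
have [n Hn|e' [He' HF]] := @hval_int (fun n => (hl X n.+1)%:Z) s e1 (maxn n0 n1).
  move: Hn; rewrite geq_max => /andP [n0n n1n].
  rewrite hval_addc -H0; last exact: leqW.
  have /(congr1 Posz) := H1 n.+1 (leqW n1n); rewrite !PoszD -/l => E.
  by apply/eqP; rewrite subr_eq addrAC -subr_eq opprK E addrC.
exists e'; split; first by exists (maxn n0 n1).
  by move=> i si; rewrite He' ?(ltnW si) // /e1 ltn_eqF.
by rewrite He' // /e1 eqxx mulrN.
Qed.

Lemma hp_raise X s e k : hp X s e -> (s <= k)%N -> exists e', hp X k e'.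
Proof.
move=> H /subnK <-; elim: (k - s)%N => [|i [e' [n0 H']]]; first by exists e.
by exists (fun i => if i is j.+1 then - e' j else 0), n0 => n /H'; rewrite hval_raise.
Qed.

Lemma ex_superficial X n0 : acc X -> exists2 n, (n0 <= n)%N & superficial Q X (u n).
Proof.
move=> aX; have [N HN] := superficial_generic (st_gs st) (st_r st) (st_u st) aX.
by exists (maxn n0 N); rewrite ?leq_maxl //; apply: HN; exact: leq_maxr.
Qed.

Lemma hp_flen X : flen X -> hp X 0 (fun=> (module_length X)%:Z).
Proof.
move=> fX; have [N HN] := flen_pw0 fX; exists N => n Nn; rewrite hval0; congr Posz.
have [i iE] := lin_id X; apply/esym; apply: (iso_flen _ (flen_quot_pw n.+1 (flen_acc fX))).2.
apply: (iso_quot (f := i)); first by move=> z; exists z.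
move=> z; rewrite iE; split=> [->|Qz]; first exact: (submod0 (pw_submodule Q X n.+1)).
by apply: HN; apply: (pw_le _ Qz); exact: leqW.
Qed.

Lemma hp_exists X : acc X -> exists e, hp X (module_dim X) e.
Proof.
have [k] := ubnP (module_dim X); elim: k X => // k IH X dk aX.
have [d0|d0] := posnP (module_dim X).
  by rewrite d0; have fX := (dim0P aX).1 d0; exists (fun=> (module_length X)%:Z); exact: hp_flen.
have [n _ sn] := ex_superficial 0 aX.
have dq := dim_mq_lt aX sn d0.
have aq : acc (mq X (u n)) by exact: acc_quot.
have [|e He] := IH (mq X (u n)) _ aq; first exact: leq_trans dq dk.
have [e' [He' _ _]] := hp_integrate aX (mem_u n) sn He.
exact: hp_raise He' dq.
Qed.

Lemma dim_le_hp X s e : acc X -> hp X s e -> (module_dim X <= s)%N.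
Proof.
move=> aX [n0 H]; have g := hp_growth aX H.
case E : (module_dim X) => [//|k]; apply: (growth_dim aX g).
by apply/dimP; rewrite ?E.
Qed.

(** That the dimension drops by no more than one is seen on Hilbert functions: integrating the
    polynomial of X / aX gives one for X of degree one higher. *)
Lemma dim_mq X a : acc X -> Q a -> superficial Q X a -> (0 < module_dim X)%N ->
  (module_dim (mq X a)).+1 = module_dim X.
Proof.
move=> aX Qa sa d0; apply/eqP; rewrite eqn_leq dim_mq_lt //=.
have [e He] := hp_exists (acc_quot aX : acc (mq X a)).
have [e' [He' _ _]] := hp_integrate aX Qa sa He.
exact: dim_le_hp He'.
Qed.

Lemma hp_unique X s e e' : hp X s e -> hp X s e' -> forall i, (i <= s)%N -> e i = e' i.
Proof.
move=> [n0 H] [n1 H']; apply: (@hval_unique s e e' (maxn n0 n1)) => n.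
by rewrite geq_max => /andP [/H <- /H' <-].
Qed.

End Dimension.

(** * Local cohomology and its long exact sequence *)

Section Torsion.
Variables (A : comNzRingType) (m : set A).
Implicit Types X Y N : lmodType A.

Definition tors X : set X := torsion X m.

Lemma tors_submodule X : is_submodule (@tors X).
Proof.
apply/submoduleP; split; first by exists 0%N => a _; rewrite scaler0.
move=> b x y [i Hx] [j Hy]; exists (maxn i j) => a Ha.
rewrite scalerDr scalerA mulrC -scalerA Hx ?Hy ?scaler0 ?addr0 //.
  exact: (ideal_pow_le (leq_maxr i j) Ha).
exact: (ideal_pow_le (leq_maxl i j) Ha).
Qed.

Lemma tors_lin X Y (f : {linear X -> Y}) x : tors x -> tors (f x).
Proof. by move=> [n Hn]; exists n => a /Hn ax; rewrite -linearZ /= ax linear0. Qed.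

Lemma tors_inj X Y (f : {linear X -> Y}) x : inj0 f -> tors (f x) -> tors x.
Proof. by move=> fi [n Hn]; exists n => a /Hn ax; apply: fi; rewrite linearZ. Qed.

Lemma injective_ext (K U V : lmodType A) (d : {linear U -> V}) (phi : {linear U -> K}) :
  injective_module K -> (forall x, d x = 0 -> phi x = 0) ->
  exists psi : {linear V -> K}, forall x, psi (d x) = phi x.
Proof.
move=> Kinj H; have HK := ker_submodule d.
have [//|dq dqE] := @quotmod_lift A U V (ker d) d.
have [//|pq pqE] := @quotmod_lift A U K (ker d) phi.
have dqi : inj0 dq by move=> q; have [x <-] := surj_qpi q; rewrite dqE => dx; exact/(ker_qpi HK).
have [psi psiE] := Kinj _ _ dq pq ((inj0P dq).1 dqi).
by exists psi => x; rewrite -dqE psiE pqE.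
Qed.

(** An exact augmented complex with the resolved module in degree 0. Injectivity is kept apart in
    [injc], because lifting a map needs exactness of the source and injectivity of the target. *)
Record cpx := Cpx {
  ob : nat -> lmodType A;
  df : forall n, {linear ob n -> ob n.+1};
  df_inj : inj0 (df 0);
  df_exact : forall n, exact_at (df n) (df n.+1) }.

Arguments df C n : rename.

Lemma df_df C n x : df C n.+1 (df C n x) = 0.
Proof. by apply/df_exact; exists x. Qed.

Definition injc C := forall n, injective_module (ob C n.+1).

Definition aug_ob N (I : injective_resolution N) n : lmodType A :=
  if n is k.+1 then ir_obj I k else N.
Definition aug_df N (I : injective_resolution N) n : {linear aug_ob I n -> aug_ob I n.+1} :=
  match n with 0%N => ir_aug I | k.+1 => ir_d I k end.

Lemma aug_inj N (I : injective_resolution N) : inj0 (aug_df I 0).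
Proof. exact/inj0P/ir_aug_inj. Qed.

Lemma aug_exact N (I : injective_resolution N) n : exact_at (aug_df I n) (aug_df I n.+1).
Proof.
case: n => [|n] y /=; first by rewrite ir_exact0; split=> [[x _ <-]|[x <-]]; exists x.
by rewrite ir_exactS; split=> [[x _ <-]|[x <-]]; exists x.
Qed.

Definition aug N (I : injective_resolution N) : cpx := Cpx (@aug_inj N I) (@aug_exact N I).

Lemma aug_injc N (I : injective_resolution N) : injc (aug I).
Proof. by move=> n; exact: ir_injective. Qed.

Definition chain C K (c : forall n, {linear ob C n -> ob K n}) :=
  forall n x, c n.+1 (df C n x) = df K n (c n x).

Section Lift.
Variables (C K : cpx) (Kinj : injc K) (c0 : {linear ob C 0 -> ob K 0}).

Let inv n (p : {linear ob C n -> ob K n}) := forall x, df C n x = 0 -> df K n (p x) = 0.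

Let inv0 : inv c0.
Proof. by move=> x /df_inj ->; rewrite !linear0. Qed.

Let step n (p : {linear ob C n -> ob K n}) : inv p ->
  exists q : {linear ob C n.+1 -> ob K n.+1}, inv q /\ forall x, q (df C n x) = df K n (p x).
Proof.
move=> ip; have [q qE] := @injective_ext _ _ _ (df C n) (df K n \o p) (@Kinj n) ip.
by exists q; split=> // y /df_exact [x <-]; rewrite qE df_df.
Qed.

(** Each map is stored with the property that allows the next one to be built from it. *)
Let lift : forall n, {p : {linear ob C n -> ob K n} | inv p} :=
  fix F n := match n with
    | 0%N => exist _ c0 inv0
    | k.+1 => let w := cid (step (proj2_sig (F k))) in exist _ (proj1_sig w) (proj1 (proj2_sig w))
    end.

Lemma chain_lift : exists c : forall n, {linear ob C n -> ob K n},
  chain c /\ forall x, c 0%N x = c0 x.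
Proof.
exists (fun n => sval (lift n)); split=> // n x.
exact: (proj2 (proj2_sig (cid (step (proj2_sig (lift n)))))).
Qed.

End Lift.

(* The augmentation shifts indices by one. *)
Definition cyc C j : set (ob C j.+1) := [set z | torsion (ob C j.+1) m z /\ df C j.+1 z = 0].

Definition bnd C j : set (ob C j.+1) :=
  match j return set (ob C j.+1) with
  | 0%N => [set 0]
  | i.+1 => [set z | exists2 y, torsion (ob C i.+1) m y & df C i.+1 y = z]
  end.

(** The shape of [coboundaries] is repeated so that [HC] at an augmented resolution is local
    cohomology by conversion; [bnd] is the same condition in the ambient object. *)
Definition bndS C j : set (submod (@cyc C j)) :=
  match j return set (submod (@cyc C j)) with
  | 0%N => [set 0]
  | i.+1 => [set z | exists2 y, torsion (ob C i.+1) m y & df C i.+1 y = val z]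
  end.

Definition HC C j : lmodType A := quotmod (@bndS C j).

Lemma cyc_submodule C j : is_submodule (@cyc C j).
Proof.
exact: (submoduleI (tors_submodule (ob C j.+1)) (ker_submodule (df C j.+1))).
Qed.

Lemma bnd_submodule C j : is_submodule (@bnd C j).
Proof.
case: j => [|j]; first exact: submodule0.
have := image_submodule (df C j.+1) (tors_submodule (ob C j.+1)); congr is_submodule.
Qed.

Lemma bndSP C j (z : submod (@cyc C j)) : bndS z <-> bnd (\val z).
Proof.
case: j z => [|j] z; last by [].
split=> [->|z0]; first exact: (linear0 (subval (@cyc C 0))).
by apply: val_inj; rewrite [RHS]linear0.
Qed.

Lemma bndS_submodule C j : is_submodule (@bndS C j).
Proof.
have := preimage_submodule (subval (@cyc C j)) (bnd_submodule C j).
congr is_submodule; apply/seteqP; split=> z /=; first by move=> H; apply/bndSP.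
by move/bndSP.
Qed.

(** A relation rather than a map, so that diagram chases work with cocycles x and never with
    elements of the subtype above them. *)
Definition cls C j (h : HC C j) (x : ob C j.+1) :=
  exists z : submod (@cyc C j), \val z = x /\ qpi _ z = h.

Lemma cls_ex C j (h : HC C j) : exists x, cyc x /\ cls h x.
Proof.
have [z <-] := surj_qpi h; exists (\val z); split; last by exists z.
exact: (submod_valP (cyc_submodule C j) z).
Qed.

Lemma cls_of C j (x : ob C j.+1) : cyc x -> exists h, cls h x.
Proof. by move=> /(submod_mem (cyc_submodule C j)) [z zx]; exists (qpi _ z), z. Qed.

Lemma cls_cyc C j h (x : ob C j.+1) : cls h x -> cyc x.
Proof. by move=> [z [<- _]]; exact: (submod_valP (cyc_submodule C j) z). Qed.

Lemma cls_lin C j (h h' : HC C j) x x' a : cls h x -> cls h' x' -> cls (a *: h + h') (a *: x + x').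
Proof. by move=> [z [<- <-]] [z' [<- <-]]; exists (a *: z + z'); rewrite !linearP. Qed.

Lemma cls_eq0 C j (h : HC C j) x : cls h x -> h = 0 <-> bnd x.
Proof. by move=> [z [<- <-]]; rewrite (ker_qpi (bndS_submodule C j)); exact: bndSP. Qed.

Lemma cls_eq C j (h h' : HC C j) x x' : cls h x -> cls h' x' -> bnd (x - x') -> h = h'.
Proof.
move=> hx hx'; have := cls_lin (-1) hx' hx; rewrite !scaleN1r.
move=> /cls_eq0 H b; apply/eqP; rewrite -subr_eq0 addrC; apply/eqP/H.
by rewrite addrC.
Qed.

Lemma cls_uniq C j (h h' : HC C j) x : cls h x -> cls h' x -> h = h'.
Proof. by move=> hx hx'; apply: (cls_eq hx hx'); rewrite subrr; exact: (submod0 (bnd_submodule C j)). Qed.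

Lemma HC_map C K j k (phi : {linear ob C j.+1 -> ob K k.+1}) :
  (forall x, cyc x -> cyc (phi x)) -> (forall x, bnd x -> bnd (phi x)) ->
  exists g : {linear HC C j -> HC K k}, forall h x, cls h x -> cls (g h) (phi x).
Proof.
move=> Hc Hb; have H (h : HC C j) : exists h' : HC K k, forall x, cls h x -> cls h' (phi x).
  have [x [cx hx]] := cls_ex h; have [h' hx'] := cls_of (Hc x cx); exists h' => y hy.
  have [h'' hy'] := cls_of (Hc y (cls_cyc hy)).
  suff -> : h' = h'' by [].
  apply: (cls_eq hx' hy'); rewrite -linearB; apply: Hb.
  have := cls_lin (-1) hy hx; rewrite !scaleN1r addNr addrC => /cls_eq0 H.
  exact/H.
have [g gE] := choice H.
have /lin_ex [G GE] : linear g.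
  move=> a h h'; have [x [_ hx]] := cls_ex h; have [x' [_ hx']] := cls_ex h'.
  apply: (cls_uniq (gE _ _ (cls_lin a hx hx'))); rewrite linearP.
  by apply: cls_lin; exact: gE.
by exists G => h x hx; rewrite GE; exact: gE.
Qed.

Lemma chain_cyc C K (c : forall n, {linear ob C n -> ob K n}) j x : chain c ->
  cyc x -> cyc (c j.+1 x).
Proof.
move=> cc [tx dx]; split; first exact: (tors_lin (c j.+1) tx).
by rewrite -cc dx linear0.
Qed.

Lemma chain_bnd C K (c : forall n, {linear ob C n -> ob K n}) j x : chain c ->
  bnd x -> bnd (c j.+1 x).
Proof.
case: j x => [|j] x cc; first by move=> ->; rewrite linear0.
by move=> [y ty <-]; exists (c j.+1 y); [exact: (tors_lin (c j.+1) ty)|rewrite cc].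
Qed.

Lemma chain_map C K (c : forall n, {linear ob C n -> ob K n}) j : chain c ->
  exists g : {linear HC C j -> HC K j}, forall h x, cls h x -> cls (g h) (c j.+1 x).
Proof. by move=> cc; apply: HC_map => x; [exact: chain_cyc|exact: chain_bnd]. Qed.

(** A chain map over zero is null-homotopic; the homotopy is linear, so it preserves torsion. Only
    its effect on the image of the differential is built, which by exactness contains all
    cocycles. *)
Lemma chain_null C K (c : forall n, {linear ob C n -> ob K n}) j x : chain c -> injc K ->
  (forall x, c 0%N x = 0) -> cyc x -> bnd (c j.+1 x).
Proof.
move=> cc Kinj c0.
have H n : exists h : {linear ob C n.+1 -> ob K n},
    forall x, c n.+1 (df C n x) = df K n (h (df C n x)).
  elim: n => [|n [h hE]].
    have [|h hE] := @lin_ex A (ob C 1) (ob K 0) (fun=> 0).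
      by move=> a y z; rewrite scaler0 addr0.
    by exists h => y; rewrite cc c0 hE linear0.
  have [|p pE] := @lin_ex A (ob C n.+1) (ob K n.+1) (fun y => c n.+1 y - df K n (h y)).
    by move=> a y z; rewrite (linearP (c n.+1)) (linearP h) (linearP (df K n)) scalerBr opprD addrACA.
  have [|h' h'E] := @injective_ext _ _ _ (df C n.+1) p (Kinj n).
    by move=> y /df_exact [z <-]; rewrite pE hE subrr.
  by exists h' => y; rewrite h'E pE linearB df_df subr0 cc.
case: j x => [|j] x [tx /df_exact [y yx]]; first by rewrite -yx cc c0 linear0.
have [h hE] := H j.+1; exists (h x); first exact: (tors_lin h tx).
by rewrite -yx hE.
Qed.

Lemma chain_homotopic C K (c c' : forall n, {linear ob C n -> ob K n}) j x : chain c ->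
  chain c' -> injc K -> (forall x, c 0%N x = c' 0%N x) -> cyc x -> bnd (c j.+1 x - c' j.+1 x).
Proof.
move=> cc cc' Kinj c0 cx.
have H n : exists p : {linear ob C n -> ob K n}, forall y, p y = c n y - c' n y.
  by apply: lin_ex => a y z; rewrite (linearP (c n)) (linearP (c' n)) scalerBr opprD addrACA.
pose p n := projT1 (cid (H n)).
have pE n y : p n y = c n y - c' n y by rewrite /p; case: cid.
rewrite -pE; apply: chain_null => // [n y|y]; last by rewrite pE c0 subrr.
by rewrite !pE cc cc' linearB.
Qed.

(** Quantifying over all lifts of f frees the property from the lift that produced g, so that
    identities and multiplications are recognised in cohomology. *)
Definition induced C K j (f : ob C 0 -> ob K 0) (g : {linear HC C j -> HC K j}) :=
  forall c : (forall n, {linear ob C n -> ob K n}), chain c -> (forall x, c 0%N x = f x) ->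
  forall h x, cls h x -> cls (g h) (c j.+1 x).

Lemma induced_chain C K j (c : forall n, {linear ob C n -> ob K n})
    (g : {linear HC C j -> HC K j}) : injc K -> chain c ->
  (forall h x, cls h x -> cls (g h) (c j.+1 x)) -> induced (c 0%N) g.
Proof.
move=> Kinj cc gE c' cc' c'0 h x hx.
have [h' h'x] := cls_of (chain_cyc cc' (cls_cyc hx)).
suff -> : g h = h' by [].
apply: (cls_eq (gE _ _ hx) h'x); apply: chain_homotopic => //; exact: cls_cyc hx.
Qed.

Lemma induced_id C j (g : {linear HC C j -> HC C j}) : injc C -> induced id g -> forall h, g h = h.
Proof.
move=> Cinj ig h; have [x [_ hx]] := cls_ex h.
have H n : exists i : {linear ob C n -> ob C n}, forall y, i y = y by exact: lin_id.
pose i n := projT1 (cid (H n)).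
have iE n y : i n y = y by rewrite /i; case: cid.
apply: (cls_uniq (x := x)) => //; rewrite -[x](iE j.+1).
by apply: ig hx => [n y|y]; rewrite !iE.
Qed.

Lemma induced_scale C j (g : {linear HC C j -> HC C j}) a : injc C ->
  induced (fun x => a *: x) g -> forall h, g h = a *: h.
Proof.
move=> Cinj ig h; have [x [_ hx]] := cls_ex h.
apply: (cls_uniq (x := a *: x)).
  by apply: (ig (fun n => (@mulm A (ob C n) a : {linear _ -> _}))) => // n y; rewrite /= /mulm linearZ.
have := cls_lin a hx (_ : cls (0 : HC C j) 0); rewrite !addr0; apply.
by exists 0; rewrite !linear0.
Qed.

End Torsion.

(** * The mapping cocone of a chain map *)

Section Cocone.
Variables (A : comNzRingType) (m : set A).
Implicit Types X Y Z U V W : lmodType A.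

Definition prodm U V : lmodType A := (U * V)%type.

Lemma fst_lin U V : exists f : {linear prodm U V -> U}, forall x, f x = x.1.
Proof. exact: (lin_ex (f := fun x : prodm U V => x.1)). Qed.
Lemma snd_lin U V : exists f : {linear prodm U V -> V}, forall x, f x = x.2.
Proof. exact: (lin_ex (f := fun x : prodm U V => x.2)). Qed.

Lemma pair_lin W U V (f : {linear W -> U}) (g : {linear W -> V}) :
  exists h : {linear W -> prodm U V}, forall x, h x = (f x, g x).
Proof.
have H : @GRing.linear_for A W (prodm U V) *:%R (fun x => (f x, g x)).
  by move=> a x y; rewrite !linearP.
by have [h hE] := @lin_ex A W (prodm U V) _ H; exists h.
Qed.

Lemma lin0 U V : exists f : {linear U -> V}, forall x, f x = 0.
Proof.
have /lin_ex [h hE] : linear (fun _ : U => (0 : V)) by move=> a x y; rewrite scaler0 addr0.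
by exists h.
Qed.

Lemma injective_prod U V : injective_module U -> injective_module V ->
  injective_module (prodm U V).
Proof.
move=> Ui Vi X Y i f ii; have [p1 p1E] := fst_lin U V; have [p2 p2E] := snd_lin U V.
have [g1 g1E] := Ui X Y i (p1 \o f) ii; have [g2 g2E] := Vi X Y i (p2 \o f) ii.
have [g gE] := pair_lin g1 g2; exists g => x.
by rewrite gE g1E g2E /= p1E p2E; case: (f x).
Qed.

Lemma tors_pair U V (x : U) (y : V) : tors m x -> tors m y -> tors m ((x, y) : prodm U V).
Proof.
move=> tx ty; have [z0 z0E] := lin0 U V; have [z1 z1E] := lin0 V U.
have [i iE] := lin_id U; have [j jE] := lin_id V.
have [h hE] := pair_lin i z0; have [k kE] := pair_lin z1 j.
have -> : ((x, y) : prodm U V) = h x + k y.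
  by rewrite hE kE iE z0E z1E jE; congr pair; rewrite /= ?addr0 ?add0r.
by apply: (submodD (tors_submodule m _)); exact: tors_lin.
Qed.

Lemma tors_pairP U V (x : prodm U V) : tors m x -> tors m x.1 /\ tors m x.2.
Proof.
move=> tx; have [p1 p1E] := fst_lin U V; have [p2 p2E] := snd_lin U V.
by rewrite -p1E -p2E; split; exact: tors_lin.
Qed.

Variables (X : lmodType A) (C K : cpx A) (psi : forall n, {linear ob C n -> ob K n}).
Variable f : {linear X -> ob C 0}.
Hypothesis cpsi : chain psi.
Hypothesis fg : ses f (psi 0).

(* The mapping cocone of psi, an augmented injective resolution of X = ker (psi 0). *)
Definition coc_ob n : lmodType A :=
  match n with 0%N => X | 1%N => ob C 1 | k.+2 => prodm (ob C k.+2) (ob K k.+1) end.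

Lemma coc1_ex : exists d : {linear ob C 1 -> prodm (ob C 2) (ob K 1)},
  forall y, d y = (df C 1 y, psi 1 y).
Proof. exact: pair_lin. Qed.

Lemma coc2_ex k : exists d : {linear prodm (ob C k.+2) (ob K k.+1) ->
    prodm (ob C k.+3) (ob K k.+2)},
  forall y, d y = (df C k.+2 y.1, psi k.+2 y.1 - df K k.+1 y.2).
Proof.
have H : @GRing.linear_for A (prodm (ob C k.+2) (ob K k.+1)) (prodm (ob C k.+3) (ob K k.+2))
    *:%R (fun y => (df C k.+2 y.1, psi k.+2 y.1 - df K k.+1 y.2)).
  move=> a y z; congr pair; first exact: (linearP (df C k.+2)).
  by rewrite /= (linearP (psi k.+2)) (linearP (df K k.+1)) opprD addrACA scalerBr.
by have [h hE] := lin_ex H; exists h.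
Qed.

Definition coc_df n : {linear coc_ob n -> coc_ob n.+1} :=
  match n return {linear coc_ob n -> coc_ob n.+1} with
  | 0%N => df C 0 \o f
  | 1%N => projT1 (cid coc1_ex)
  | k.+2 => projT1 (cid (coc2_ex k))
  end.

Lemma coc_df0 x : coc_df 0 x = df C 0 (f x). Proof. by []. Qed.
Lemma coc_df1 y : coc_df 1 y = (df C 1 y, psi 1 y).
Proof. by rewrite /coc_df; case: cid. Qed.
Lemma coc_df2 k y : coc_df k.+2 y = (df C k.+2 y.1, psi k.+2 y.1 - df K k.+1 y.2).
Proof. by rewrite /coc_df; case: cid. Qed.

Lemma coc_inj : inj0 (coc_df 0).
Proof. by move=> x; rewrite coc_df0 => /df_inj; have [fi _ _] := fg; exact: fi. Qed.

Lemma coc_exact n : exact_at (coc_df n) (coc_df n.+1).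
Proof.
have [fi fgE gs] := fg; case: n => [|[|k]].
- move=> y; rewrite coc_df1; split=> [[dy py]|[x <-]]; last first.
    rewrite coc_df0 df_df cpsi (_ : psi 0 (f x) = 0) ?linear0 //.
    by apply/fgE; exists x.
  have [y0 y0E] := (@df_exact A C 0 y).1 dy.
  have /fgE [x xE] : psi 0 y0 = 0 by apply: (@df_inj _ K); rewrite -cpsi y0E.
  by exists x; rewrite coc_df0 xE.
- move=> [y z]; split=> [|[y' <-]]; last by rewrite coc_df1 coc_df2 /= df_df cpsi subrr.
  rewrite coc_df2 /= => -[dy pz].
  have [y' y'E] := (@df_exact A C 1 y).1 dy.
  have /(@df_exact A K 0) [z0 z0E] : df K 1 (psi 1 y' - z) = 0 by rewrite linearB -cpsi y'E.
  have [y0 y0E] := gs z0; exists (y' - df C 0 y0).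
  by rewrite coc_df1 !linearB df_df subr0 y'E cpsi y0E z0E opprB addrC subrK.
- move=> [y z]; split=> [|[[y' z'] <-]].
    rewrite coc_df2 /= => -[dy pz].
    have [y' y'E] := (@df_exact A C k.+2 y).1 dy.
    have /(@df_exact A K k.+1) [z' z'E] : df K k.+2 (psi k.+2 y' - z) = 0 by rewrite linearB -cpsi y'E.
    by exists (y', z'); rewrite coc_df2 /= y'E z'E opprB addrC subrK.
  by rewrite [coc_df k.+2 _]coc_df2 coc_df2 /= df_df cpsi linearB df_df subr0 subrr.
Qed.

Definition coc : cpx A := Cpx coc_inj coc_exact.

Lemma coc_injc : injc C -> injc K -> injc coc.
Proof. by move=> Ci Ki [|n]; [exact: Ci|apply: injective_prod; [exact: Ci|exact: Ki]]. Qed.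

Lemma coc_pr_ex n : exists p : {linear prodm (ob C n.+2) (ob K n.+1) -> ob C n.+2},
  forall x, p x = x.1.
Proof. exact: fst_lin. Qed.

Lemma coc_id_ex : exists p : {linear ob C 1 -> ob C 1}, forall x, p x = x.
Proof. exact: lin_id. Qed.

Definition coc_pr n : {linear ob coc n -> ob C n} :=
  match n return {linear ob coc n -> ob C n} with
  | 0%N => f
  | 1%N => projT1 (cid coc_id_ex)
  | k.+2 => projT1 (cid (coc_pr_ex k))
  end.

Lemma coc_pr1 x : coc_pr 1 x = x. Proof. by rewrite /coc_pr; case: cid. Qed.
Lemma coc_pr2 k x : coc_pr k.+2 x = x.1. Proof. by rewrite /coc_pr; case: cid. Qed.

Lemma coc_pr_chain : chain coc_pr.
Proof.
case=> [|[|k]] x; first by rewrite coc_pr1.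
  by rewrite coc_pr1 coc_pr2 /= coc_df1.
by rewrite !coc_pr2 /= coc_df2.
Qed.

Lemma coc_delta_ex j : exists p : {linear ob K j.+1 -> ob coc j.+2}, forall z, p z = (0, z).
Proof.
have [i iE] := lin_id (ob K j.+1); have [z0 z0E] := lin0 (ob K j.+1) (ob C j.+2).
by have [h hE] := pair_lin z0 i; exists h => z; rewrite hE z0E iE.
Qed.

(** Torsion commutes with the products that form the cocone, so the torsion part of the cocone is
    again a cocone and has the usual long exact sequence. *)
Lemma coc_les : exists (F : forall j, {linear HC m coc j -> HC m C j})
  (G : forall j, {linear HC m C j -> HC m K j})
  (Dl : forall j, {linear HC m K j -> HC m coc j.+1}),
  [/\ inj0 (F 0%N), forall j, exact_at (F j) (G j), forall j, exact_at (G j) (Dl j),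
      forall j, exact_at (Dl j) (F j.+1) &
      (forall j h x, cls h x -> cls (F j h) (coc_pr j.+1 x)) /\
      (forall j h x, cls h x -> cls (G j h) (psi j.+1 x))].
Proof.
have HF j := chain_map m j coc_pr_chain.
have HG j := chain_map m j cpsi.
have [d dE] : exists d : forall j, {linear ob K j.+1 -> ob coc j.+2}, forall j z, d j z = (0, z).
  exists (fun j => projT1 (cid (coc_delta_ex j))) => j z; by case: cid.
have HD j : exists g : {linear HC m K j -> HC m coc j.+1}, forall h x, cls h x -> cls (g h) (d j x).
  apply: HC_map => x.
    move=> [tx dx]; split; first exact: (tors_lin (d j) tx).
    by rewrite dE /= coc_df2 /= dx !linear0 ?subr0 ?addr0.
  case: j x => [|j] x; first by move=> ->; rewrite linear0; exact: (submod0 (bnd_submodule m coc 1)).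
  move=> [y ty <-]; exists ((0, - y) : prodm _ _).
    apply: tors_pair; first exact: (submod0 (tors_submodule m _)).
    exact: (submodN (tors_submodule m _)).
  by rewrite dE /= coc_df2 /= linearN opprK !linear0 add0r.
pose F j := projT1 (cid (HF j)); pose G j := projT1 (cid (HG j)); pose Dl j := projT1 (cid (HD j)).
have FE j h x : cls h x -> cls (F j h) (coc_pr j.+1 x) by rewrite /F; case: cid => ? /= H /H.
have GE j h x : cls h x -> cls (G j h) (psi j.+1 x) by rewrite /G; case: cid => ? /= H /H.
have DE j h x : cls h x -> cls (Dl j h) (d j x) by rewrite /Dl; case: cid => ? /= H /H.
exists F, G, Dl; split=> //.
- move=> h; have [x [cx hx]] := cls_ex h.
  by move=> /(cls_eq0 (FE _ _ _ hx)) /=; rewrite coc_pr1 => x0; apply/(cls_eq0 hx).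
- move=> j h; have [y [cy hy]] := cls_ex h; have [ty dy] := cy.
  split=> [/(cls_eq0 (GE _ _ _ hy))|[h' <-]]; last first.
    have [x [[tx dx] hx]] := cls_ex h'; apply/(cls_eq0 (GE _ _ _ (FE _ _ _ hx))).
    case: j {h y cy hy ty dy} h' x tx dx hx => [|j] h' x tx dx hx.
      by rewrite coc_pr1; move: dx; rewrite /= coc_df1 => -[_ ->].
    have [_ tx2] := tors_pairP tx.
    rewrite coc_pr2; exists x.2 => //.
    by move: dx; rewrite /= coc_df2 => -[_ /eqP]; rewrite subr_eq0 => /eqP.
  case: j h y cy hy ty dy => [|j] h y cy hy ty dy.
    move=> p0; have cx : cyc m (C := coc) (j := 0) y by split=> //; rewrite /= coc_df1 dy p0.
    have [h' hx] := cls_of cx; exists h'; apply: (cls_uniq (FE _ _ _ hx)).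
    by rewrite coc_pr1.
  move=> [z' tz' z'E].
  have cx : cyc m (C := coc) (j := j.+1) ((y, z') : prodm _ _).
    by split; [exact: tors_pair|rewrite /= coc_df2 /= dy z'E subrr].
  have [h' hx] := cls_of cx; exists h'; apply: (cls_uniq (FE _ _ _ hx)).
  by rewrite coc_pr2.
- move=> j h; have [z [cz hz]] := cls_ex h; have [tz dz] := cz.
  split=> [/(cls_eq0 (DE _ _ _ hz))|[h' <-]]; last first.
    have [y [[ty dy] hy]] := cls_ex h'; apply/(cls_eq0 (DE _ _ _ (GE _ _ _ hy))).
    rewrite dE; case: j {h z cz hz tz dz} h' y ty dy hy => [|j] h' y ty dy hy.
      by exists y => //; rewrite /= coc_df1 dy.
    exists ((y, 0) : prodm _ _).
      by apply: tors_pair => //; exact: (submod0 (tors_submodule m _)).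
    by rewrite /= coc_df2 /= dy linear0 subr0.
  rewrite dE; case: j h z cz hz tz dz => [|j] h z cz hz tz dz.
    move=> [y ty]; rewrite /= coc_df1 => -[dy pz].
    have [h' hy] := cls_of (conj ty dy : cyc m (C := C) (j := 0) y).
    by exists h'; apply: (cls_uniq (GE _ _ _ hy)); rewrite pz.
  move=> [[y z'] /tors_pairP [ty tz']]; rewrite /= coc_df2 /= => -[dy pz].
  have [h' hy] := cls_of (conj ty dy : cyc m (C := C) (j := j.+1) y).
  exists h'; apply: (cls_eq (GE _ _ _ hy) hz); exists z' => //.
  by rewrite -pz opprB addrC subrK.
- move=> j h; have [[y z] [[/tors_pairP [ty tz]]]] := cls_ex h.
  rewrite /= coc_df2 /= => -[dy pz] hx.
  split=> [/(cls_eq0 (FE _ _ _ hx))|[h' <-]]; last first.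
    have [x [_ hx']] := cls_ex h'; apply/(cls_eq0 (FE _ _ _ (DE _ _ _ hx'))).
    by rewrite dE coc_pr2; exact: (submod0 (bnd_submodule m C j.+1)).
  rewrite coc_pr2 /= => -[y' ty' y'E].
  have cz : cyc m (C := K) (j := j) (z - psi j.+1 y').
    split; first by apply: (submodB (tors_submodule m _)) => //; exact: tors_lin.
    by rewrite linearB -cpsi y'E; move/eqP: pz; rewrite subr_eq0 => /eqP ->; rewrite subrr.
  have [h' hz] := cls_of cz; exists h'; apply: (cls_eq (DE _ _ _ hz) hx).
  have E : d j (z - psi j.+1 y') - ((y, z) : prodm _ _) = - ((y, psi j.+1 y') : prodm _ _).
    by rewrite dE; congr pair; rewrite /= ?sub0r // addrAC subrr sub0r.
  rewrite E; apply: (submodN (bnd_submodule m coc j.+1)).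
  clear E hz h' cz pz dy hx h.
  case: j y z ty tz y' ty' y'E => [|j] y z ty tz y' ty' y'E.
    by exists y' => //; rewrite /= coc_df1 y'E.
  exists ((y', 0) : prodm _ _); last by rewrite /= coc_df2 /= y'E linear0 subr0.
  by apply: tors_pair => //; exact: (submod0 (tors_submodule m _)).
Qed.

End Cocone.

Section LongExact.
Variables (A : comNzRingType) (m : set A).
Variables (res : forall N : lmodType A, injective_resolution N).

(** The cocone of a lift of g is an injective resolution of X. Lifts of the identity in both
    directions compare it with the chosen one, and uniqueness up to homotopy makes them mutually
    inverse on cohomology. *)
Theorem long_exact (X Y Z : lmodType A) (f : {linear X -> Y}) (g : {linear Y -> Z}) : ses f g ->
  exists (F : forall j, {linear local_cohomology m res j X -> local_cohomology m res j Y})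
    (G : forall j, {linear local_cohomology m res j Y -> local_cohomology m res j Z})
    (Dl : forall j, {linear local_cohomology m res j Z -> local_cohomology m res j.+1 X}),
  [/\ inj0 (F 0%N), forall j, exact_at (F j) (G j), forall j, exact_at (G j) (Dl j),
      forall j, exact_at (Dl j) (F j.+1) &
      (forall j, @induced A m (aug (res X)) (aug (res Y)) j f (F j)) /\
      (forall j, @induced A m (aug (res Y)) (aug (res Z)) j g (G j))].
Proof.
move=> fg; pose CX := aug (res X); pose CY := aug (res Y); pose CZ := aug (res Z).
have iX : injc CX := aug_injc (I := res X).
have iY : injc CY := aug_injc (I := res Y).
have iZ : injc CZ := aug_injc (I := res Z).
have [psi [cpsi psi0]] := @chain_lift A CY CZ iZ g.
have fg' : ses (f : {linear X -> ob CY 0}) (psi 0%N).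
  have [fi fe gs] := fg; split=> //.
    by move=> y; rewrite psi0; exact: fe.
  by move=> z; have [y yz] := gs z; exists y; rewrite psi0.
pose D := coc cpsi fg'; have iD : injc D by exact: coc_injc.
have [F [G [Dl [F0 FG GD DF [FE GE]]]]] := coc_les m cpsi fg'.
have [i iE] := lin_id X.
have [al [cal al0]] := @chain_lift A CX D iD i.
have [be [cbe be0]] := @chain_lift A D CX iX i.
have Ha j := chain_map m j cal; have Hb j := chain_map m j cbe.
pose a j := projT1 (cid (Ha j)); pose b j := projT1 (cid (Hb j)).
have aE j h x : cls h x -> cls (a j h) (al j.+1 x) by rewrite /a; case: cid => ? /= H /H.
have bE j h x : cls h x -> cls (b j h) (be j.+1 x) by rewrite /b; case: cid => ? /= H /H.
have bal n : exists c : {linear ob CX n -> ob CX n}, forall x, c x = be n (al n x).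
  by exists (be n \o al n).
have idl : linear (fun x : X => x) by [].
have ab j h : a j (b j h) = h.
  apply: (@induced_id A m D j (a j \o b j) iD).
  have cc : chain (fun n => al n \o be n : {linear ob D n -> ob D n}) by move=> n x /=; rewrite cbe cal.
  move=> c' cc' c'0; apply: (induced_chain iD cc _ cc') => [h' x hx|x] /=; first by apply: aE; exact: bE.
  by rewrite c'0 al0 iE be0 iE.
have ba j h : b j (a j h) = h.
  apply: (@induced_id A m CX j (b j \o a j) iX).
  have cc : chain (fun n => be n \o al n : {linear ob CX n -> ob CX n}) by move=> n x /=; rewrite cal cbe.
  move=> c' cc' c'0; apply: (induced_chain iX cc _ cc') => [h' x hx|x] /=; first by apply: bE; exact: aE.
  by rewrite c'0 be0 iE al0 iE.
exists (fun j => F j \o a j), G, (fun j => b j.+1 \o Dl j); split=> /=.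
- by move=> h /F0 ah; rewrite -(ba _ h) ah linear0.
- move=> j h; rewrite FG; split=> [[h' <-]|[h' <-]]; first by exists (b j h'); rewrite /= ab.
  by exists (a j h').
- move=> j h; rewrite -GD /=; split=> [bd|->]; last by rewrite linear0.
  by rewrite -(ab _ (Dl j h)) bd linear0.
- move=> j h; rewrite /= DF; split=> [[h' h'E]|[h' <-]].
    by exists h'; rewrite /= h'E ba.
  by exists h'; rewrite /= ab.
- split=> j c cc c0 h x hx; last first.
    by apply: (@induced_chain A m CY CZ j psi (G j) iZ cpsi (GE j) c cc _ h x hx) => y; rewrite c0 psi0.
  have cp : chain (fun n => coc_pr cpsi fg' n \o al n : {linear ob CX n -> ob CY n}).
    by move=> n y /=; rewrite cal; exact: (@coc_pr_chain A X CY CZ psi f cpsi fg' n (al n y)).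
  apply: (@induced_chain A m CX CY j _ (F j \o a j) iY cp _ c cc _ h x hx) => [h' y hy|y] /=.
    by apply: FE; exact: aE.
  by rewrite c0 al0 iE.
Qed.

End LongExact.

(** * Matlis duality *)

Section Dual.
Variables (A : comNzRingType) (E : lmodType A).
Hypothesis Einj : injective_module E.
Implicit Types U V W X Y Z : lmodType A.

Definition mdual U : lmodType A := Defs.hom U E.

Lemma dual_ext U (f g : mdual U) : (forall x, f x = g x) -> f = g.
Proof. by move=> fg; apply: val_inj; apply: funext. Qed.

Lemma dual_linE U (f g : mdual U) a x : (a *: f + g : mdual U) x = a *: f x + g x.
Proof.
have := linearP (val : {linear Defs.hom U E -> (U -> E)}) a f g.
by move=> /(congr1 (fun h => h x)).
Qed.

Lemma dual0 U x : (0 : mdual U) x = 0.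
Proof. by have := linear0 (val : {linear Defs.hom U E -> (U -> E)}) => /(congr1 (fun h => h x)). Qed.

Lemma dualZ U (f : mdual U) a x : (a *: f : mdual U) x = a *: f x.
Proof. by rewrite -[a *: f]addr0 dual_linE dual0 addr0. Qed.

Lemma dual_lin U (f : mdual U) : exists g : {linear U -> E}, forall x, g x = f x.
Proof. by apply: (lin_ex (f := f)); exact: Defs.hom_linear. Qed.

Lemma lin_dual U (f : {linear U -> E}) : exists g : mdual U, forall x, g x = f x.
Proof.
have P : Defs.linear_pred f by apply/asboolP; exact: linearP.
by exists (Defs.Hom P).
Qed.

Lemma dual_map U V (f : {linear U -> V}) :
  exists g : {linear mdual V -> mdual U}, forall phi x, g phi x = phi (f x).
Proof.
have H (phi : mdual V) : exists psi : mdual U, forall x, psi x = phi (f x).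
  have [p pE] := dual_lin phi; have [q qE] := lin_dual (p \o f).
  by exists q => x; rewrite qE /= pE.
have [g gE] := choice H.
have gl : @GRing.linear_for A (mdual V) (mdual U) *:%R g.
  by move=> a p q; apply: dual_ext => x; rewrite gE !dual_linE !gE.
by have [h hE] := lin_ex gl; exists h => p x; rewrite hE gE.
Qed.

Lemma dual_exact X Y Z (f : {linear X -> Y}) (g : {linear Y -> Z})
    (f' : {linear mdual Y -> mdual X}) (g' : {linear mdual Z -> mdual Y}) :
  (forall phi x, f' phi x = phi (f x)) -> (forall phi x, g' phi x = phi (g x)) ->
  exact_at f g -> exact_at g' f'.
Proof.
move=> f'E g'E fg phi; split=> [phi0|[psi <-]]; last first.
  apply: dual_ext => x; rewrite f'E g'E dual0.
  have -> : g (f x) = 0 by apply/fg; exists x.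
  by have [p pE] := dual_lin psi; rewrite -pE linear0.
have [p pE] := dual_lin phi.
have [|q qE] := @injective_ext A E Y Z g p Einj.
  by move=> y /fg [x <-]; rewrite pE -f'E phi0 dual0.
have [psi psiE] := lin_dual q; exists psi; apply: dual_ext => y.
by rewrite g'E psiE qE pE.
Qed.

Lemma dual_inj U V (g : {linear U -> V}) (g' : {linear mdual V -> mdual U}) :
  (forall phi x, g' phi x = phi (g x)) -> onto g -> inj0 g'.
Proof.
move=> g'E gs phi phi0; apply: dual_ext => v; have [u <-] := gs v.
by rewrite -g'E phi0 !dual0.
Qed.

Lemma dual_onto U V (f : {linear U -> V}) (f' : {linear mdual V -> mdual U}) :
  (forall phi x, f' phi x = phi (f x)) -> inj0 f -> onto f'.
Proof.
move=> f'E fi phi; have [p pE] := dual_lin phi.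
have [|q qE] := @injective_ext A E U V f p Einj; first by move=> x /fi ->; rewrite linear0.
by have [psi psiE] := lin_dual q; exists psi; apply: dual_ext => x; rewrite f'E psiE qE pE.
Qed.

Lemma dual_ses X Y Z (f : {linear X -> Y}) (g : {linear Y -> Z}) : ses f g ->
  exists (g' : {linear mdual Z -> mdual Y}) (f' : {linear mdual Y -> mdual X}), ses g' f'.
Proof.
move=> [fi fg gs]; have [f' f'E] := dual_map f; have [g' g'E] := dual_map g.
by exists g', f'; split; [exact: dual_inj gs|exact: dual_exact fg|exact: dual_onto fi].
Qed.

Lemma dual_iso U V : iso U V -> iso (mdual V) (mdual U).
Proof.
move=> [f [fi fs]]; have [f' f'E] := dual_map f.
by exists f'; split; [exact: dual_inj fs|exact: dual_onto fi].
Qed.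

(** The finiteness tested on local cohomology: its Matlis dual is Noetherian. *)
Definition cof U := acc (mdual U).

Lemma cof_ses X Y Z (f : {linear X -> Y}) (g : {linear Y -> Z}) : ses f g ->
  cof Y <-> cof X /\ cof Z.
Proof. by move=> /dual_ses [g' [f' s]]; rewrite /cof (ses_acc s); split=> -[]. Qed.

Lemma cof_inj X Y (f : {linear X -> Y}) : inj0 f -> cof Y -> cof X.
Proof. by move=> /ses_inj /cof_ses H /H []. Qed.

Lemma cof_onto X Y (f : {linear X -> Y}) : onto f -> cof X -> cof Y.
Proof. by move=> /ses_surj /cof_ses H /H []. Qed.

Lemma cof_iso U V : iso U V -> cof U -> cof V.
Proof. by move=> [f [_ fs]]; exact: cof_onto fs. Qed.

End Dual.

Section Matlis.
Variables (A : comNzRingType) (m : set A) (E : lmodType A).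
Hypothesis m_local : is_local m.
Hypothesis aA : acc (A^o : lmodType A).
Hypothesis E_env : injective_envelope (cyclic_module m) E.
Implicit Types U V W X Y Z : lmodType A.

Let Einj : injective_module E.
Proof. by have [] := E_env. Qed.

Lemma separates X (x : X) : (forall f : mdual E X, f x = 0) -> x = 0.
Proof.
move=> H; apply: contrapT => /eqP /(separating m_local E_env) [f]; have [g gE] := lin_dual f.
by rewrite -gE H eqxx.
Qed.

Lemma flen_pwm X : flen X -> exists N, forall x : X, pw m N x -> x = 0.
Proof.
move=> fX; have aX := flen_acc fX.
have [ms _ Ems] := acc_fg aA (local_ideal m_local).
have fq n : flen (quotmod (@pw A m X n)) by exact: quot_flen.
have sub i j : (i <= j)%N -> [/\ flen (quotmod (@pw A m X i)),
    (colen (@pw A m X i) <= colen (@pw A m X j))%N &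
    (colen (@pw A m X j) <= colen (@pw A m X i))%N -> @pw A m X i `<=` pw m j].
  by move=> ij; exact: (col_sub (pw_submodule m X j) (pw_submodule m X i) (pw_le ij) (fq j)).
have [n|n|N HN] := @nondec_stab (fun n => colen (@pw A m X n)) (module_length X).
- by have [] := sub _ _ (leqnSn n).
- by have [] := surj_len (surj_qpi (S := @pw A m X n)) fX.
exists N => x Nx; apply: (krull Ems m_local (fun x h => h) aX) => n.
have [nN|Nn] := leqP n N; first exact: (pw_le nN Nx).
by have [_ _ H] := sub _ _ (ltnW Nn); apply: H => //; rewrite HN // ltnW.
Qed.

Lemma flen_tors X : flen X -> forall x : X, tors m x.
Proof.
move=> /flen_pwm [N HN] x; exists N => a Ha; apply: HN.
by rewrite -[N]addn0; apply: ideal_pow_mem; [|exact: pw0].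
Qed.

Lemma tors_nilp X (x : X) a : tors m x -> m a -> exists n, a ^+ n *: x = 0.
Proof.
move=> [n Hn] ma; exists n; apply: Hn; elim: n => [|n IH]; first by [].
by rewrite exprS; exact: ideal_powS_mem.
Qed.

Lemma acc_tors_flen X : acc X -> (forall x : X, tors m x) -> flen X.
Proof. by move=> aX H; apply: (flen_nilp m_local aA aX) => a x ma; exact: tors_nilp. Qed.

Lemma acc_line X (x : X) : acc (submod (line x)).
Proof.
have gl : @GRing.linear_for A (A^o : lmodType A) X *:%R (fun a => a *: x).
  by move=> a b c; rewrite scalerDl -scalerA.
have [g gE] := lin_ex gl.
have gx a : line x (g a) by rewrite gE; exists a.
have [h hE] := submod_corestrict (line_submodule x) gx.
apply: (acc_surj (f := h)) aA => z.
have [a _ az] := submod_valP (line_submodule x) z.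
by exists a; apply: val_inj; rewrite hE gE.
Qed.

Lemma m_kill_quot a (q : cyclic_module m) : m a -> a *: q = 0.
Proof.
move=> ma; have [b <-] := surj_qpi q; rewrite -linearZ.
by apply/(ker_qpi (local_ideal m_local)); change (m (a * b)); rewrite mulrC; exact: (submodZ (local_ideal m_local)).
Qed.

(** For a in m the annihilators of a^n x become stationary at some N. An element of the line of y =
    a^N x inside the residue field is killed by a, hence is zero, so y = 0 by essentiality. *)
Lemma E_tors (x : E) : tors m x.
Proof.
have [_ [i [ii ess]]] := E_env.
suff nil a : m a -> exists n, a ^+ n *: x = 0.
  have fl : flen (submod (line x)).
    apply: (flen_nilp m_local aA (acc_line (x := x))) => a z ma.
    have [n Hn] := nil a ma; exists n; apply: val_inj.
    have [b _ bE] := submod_valP (line_submodule x) z.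
    by rewrite linear0 linearZ /= -bE scalerA mulrC -scalerA Hn scaler0.
  have [z zE] : exists z : submod (line x), \val z = x.
    by apply: (submod_mem (line_submodule x)); exists 1; rewrite ?scale1r.
  by have := tors_lin (subval (line x)) (flen_tors fl z); rewrite subvalE zE.
move=> ma; pose J n : set A^o := [set b | a ^+ n *: (b *: x) = 0].
have [n|n b /= H|N HN] := aA (S := J).
- apply/submoduleP; split; first by rewrite /J /= scale0r scaler0.
  move=> c b b'; rewrite /J /= => H1 H2.
  have -> : (c *: b + b') *: x = c *: (b *: x) + b' *: x.
    by rewrite scalerDl; congr (_ + _); rewrite scalerA.
  by rewrite scalerDr H2 addr0 scalerA mulrC -scalerA H1 scaler0.
- by rewrite /J /= exprS -scalerA H scaler0.
exists N; pose y := a ^+ N *: x.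
have Ly : line y = [set 0].
  apply: ess; first exact: line_submodule.
  apply/seteqP; split=> [s|_ ->]; last first.
    by split; [exact: (submod0 (line_submodule y))|exists 0; rewrite ?linear0].
  move=> [[b _ bE] [q _ qE]]; rewrite /= -bE /y scalerA mulrC -scalerA.
  apply: (HN N.+1 (leqnSn N) b); rewrite /J /=.
  have -> : a ^+ N.+1 *: (b *: x) = a *: (b *: y).
    by rewrite /y exprS !scalerA -mulrA [a ^+ N * b]mulrC mulrA.
  rewrite bE -qE.
  by rewrite -linearZ m_kill_quot // linear0.
have : line y y by exists 1; rewrite ?scale1r.
by rewrite Ly.
Qed.

(** By essentiality the line of a nonzero y killed by m meets the residue field, and the multiplier
    that gets there is a unit. *)
Lemma socleE : exists e : E, (forall a, m a -> a *: e = 0) /\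
  forall y : E, (forall a, m a -> a *: y = 0) -> line e y.
Proof.
have [_ [i [ii ess]]] := E_env; pose e := i (qpi (m : set A^o) 1); exists e; split.
  by move=> a ma; rewrite /e -linearZ m_kill_quot // linear0.
move=> y my; have [->|y0] := pselect (y = 0); first exact: (submod0 (line_submodule e)).
have [s [[b _ bE] [q _ qE]] s0] : exists2 s, (line y `&` range i) s & s <> 0.
  apply: contrapT => H; apply: y0.
  have Ly : line y = [set 0].
    apply: ess; first exact: line_submodule.
    apply/seteqP; split=> [s Hs|_ ->]; last first.
      by split; [exact: (submod0 (line_submodule y))|exists 0; rewrite ?linear0].
    by apply: contrapT => s0; apply: H; exists s.
  have : line y y by exists 1; rewrite ?scale1r.
  by rewrite Ly.
have nmb : ~ m b by move=> /my by0; apply: s0; rewrite -bE.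
have [c cb] := local_inv m_local nmb.
have [t tE] := surj_qpi q.
exists (c * t) => //; rewrite -[y]scale1r -cb -[RHS]scalerA bE -qE -[LHS]scalerA; congr (_ *: _).
rewrite /e -linearZ -tE; congr (i _); rewrite -linearZ; congr (qpi _ _).
exact: mulr1.
Qed.

Lemma line_len X (x : X) : x <> 0 -> (forall a, m a -> a *: x = 0) ->
  flen (submod (line x)) /\ module_length (submod (line x)) = 1%N.
Proof.
move=> x0 mx; have fl := line_flen m_local mx; split=> //.
apply/eqP; rewrite eqn_leq; apply/andP; split.
  rewrite leqNgt; apply/negP => /(lenP fl).
  exact: (line_no_chain2 m_local mx).
rewrite lt0n; apply/eqP => /(len0 fl) H.
have [z zE] : exists z : submod (line x), \val z = x.
  by apply: (submod_mem (line_submodule x)); exists 1; rewrite ?scale1r.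
by apply: x0; rewrite -zE (H z) [LHS](linear0 (subval _)).
Qed.

(** Split off a socle line and induct on the length. The dual of such a line embeds in the socle of
    E, which is itself a line, and is nonzero since E separates points. *)
Lemma dual_len W : flen W -> flen (mdual E W) /\ module_length (mdual E W) = module_length W.
Proof.
have [n] := ubnP (module_length W); elim: n W => // n IH W Wn fW.
have [H0|[x x0]] : (forall x : W, x = 0) \/ exists x : W, x <> 0.
  by apply: contrapT => /not_orP [H1 H2]; apply: H1 => x; apply: contrapT => x0; apply: H2; exists x.
  have D0 (f : mdual E W) : f = 0.
    apply: dual_ext => x; rewrite (H0 x) dual0; have [g gE] := dual_lin f.
    by rewrite -gE linear0.
  by have [_ l1] := trivial_flen H0; have [f2 l2] := trivial_flen D0; rewrite l1 l2.
have nilW a (w : W) : m a -> exists n, a ^+ n *: w = 0 by apply: tors_nilp; exact: flen_tors.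
have [b []] := socle_elt m_local aA x0 nilW.
set z := b *: x => z0 mz.
have s := ses_subquot (line_submodule z).
have [fl l1] := line_len z0 mz.
have [_ fq] := (ses_flen s).1 fW; have lW := ses_len s fW.
have [fD lD] : flen (mdual E (submod (line z))) /\ module_length (mdual E (submod (line z))) = 1%N.
  have [e [me He]] := socleE.
  have [z' z'E] : exists z' : submod (line z), \val z' = z.
    by apply: (submod_mem (line_submodule z)); exists 1; rewrite ?scale1r.
  have ev_lin : @GRing.linear_for A (mdual E (submod (line z))) E *:%R (fun f => f z').
    by move=> a f g; rewrite dual_linE.
  have [ev evE] := lin_ex ev_lin.
  have [|g gE] := @submod_corestrict A E _ ev (line e) (line_submodule e).
    move=> f; rewrite evE; apply: He => a ma; have [p pE] := dual_lin f.
    rewrite -pE -linearZ (_ : a *: z' = 0) ?linear0 //.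
    by apply: val_inj; rewrite linear0 linearZ /= z'E; exact: mz.
  have gi : inj0 g.
    move=> f /(congr1 val); rewrite gE evE linear0 => fz.
    apply: dual_ext => w; rewrite dual0.
    have [c _ cE] := submod_valP (line_submodule z) w.
    have -> : w = c *: z' by apply: val_inj; rewrite linearZ /= z'E.
    by have [p pE] := dual_lin f; rewrite -pE linearZ pE /= fz scaler0.
  have fle : flen (submod (line e)) by exact: (line_flen m_local me).
  have [fD le1 _] := inj_len gi fle; split=> //.
  apply/eqP; rewrite eqn_leq; apply/andP; split.
    apply: leq_trans le1 _; have [e0|e0] := pselect (e = 0).
      have [|_ ->] // := @trivial_flen A (submod (line e)).
      move=> w; apply: val_inj; have [c _ cE] := submod_valP (line_submodule e) w.
      by rewrite linear0 -cE e0 scaler0.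
    by have [_ ->] := line_len e0 me.
  rewrite lt0n; apply/eqP => /(len0 fD) H; apply: z0; rewrite -z'E.
  rewrite (@separates _ z') ?[LHS](linear0 (subval _)) // => f.
  by rewrite (H f) dual0.
have [|fDq lDq] := IH (quotmod (line z)) _ fq.
  by move: Wn; rewrite lW l1 add1n ltnS.
have [g' [f' s']] := dual_ses Einj s.
have fDW : flen (mdual E W) by apply/(ses_flen s').
by split=> //; rewrite (ses_len s' fDW) lD lDq lW l1 addnC.
Qed.

End Matlis.

(** * Endomorphisms of E and finiteness of the duals of local cohomology *)

Section Cofinite.
Variables (A : comNzRingType) (m : set A) (E : lmodType A).
Hypothesis m_local : is_local m.
Hypothesis aA : acc (A^o : lmodType A).
Hypothesis m_complete : adically_complete m.
Hypothesis E_env : injective_envelope (cyclic_module m) E.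
Variables (res : forall N : lmodType A, injective_resolution N).
Implicit Types U V W X Y Z T : lmodType A.

Let Einj : injective_module E.
Proof. by have [] := E_env. Qed.

Let En n : set E := [set x | forall a, ideal_pow m n a -> a *: x = 0].

Let HEn n : is_submodule (En n).
Proof.
apply/submoduleP; split=> [a _|b x y Hx Hy a Ha]; first by rewrite scaler0.
by rewrite scalerDr scalerA mulrC -scalerA Hx // Hy // scaler0 addr0.
Qed.

Lemma quot_ideal_pow_flen n : flen (quotmod (ideal_pow m n : set A^o)).
Proof.
apply: (flen_nilp m_local aA (acc_quot aA)) => a q ma; exists n.
have [b <-] := surj_qpi q; rewrite -linearZ; apply/(ker_qpi (ideal_pow_submodule m n)).
change (ideal_pow m n (a ^+ n * b)); rewrite mulrC; apply: (submodZ (ideal_pow_submodule m n)).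
elim: n {q b} => [|n IH]; first by [].
by rewrite exprS; exact: ideal_powS_mem.
Qed.

Let Rn n : lmodType A := quotmod (ideal_pow m n : set A^o).

Let R1 n : Rn n := qpi (ideal_pow m n : set A^o) 1.

Let R1_gen n (q : Rn n) : exists a, q = a *: R1 n.
Proof.
have [a <-] := surj_qpi q; exists a; rewrite /R1 -linearZ; congr (qpi _ _).
by change (a = a * 1); rewrite mulr1.
Qed.

Let R1_kill n a : ideal_pow m n a -> a *: R1 n = 0.
Proof.
move=> Ha; rewrite /R1 -linearZ; apply/(ker_qpi (ideal_pow_submodule m n)).
by change (ideal_pow m n (a * 1)); rewrite mulr1.
Qed.

Let R1_kill' n a : a *: R1 n = 0 -> ideal_pow m n a.
Proof.
rewrite /R1 -linearZ => /(ker_qpi (ideal_pow_submodule m n)) H.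
by rewrite -[a]mulr1; exact: H.
Qed.

Let dual_Rn n : iso (mdual E (Rn n)) (submod (En n)).
Proof.
have gl : @GRing.linear_for A (mdual E (Rn n)) E *:%R (fun f => f (R1 n)).
  by move=> a f g; rewrite dual_linE.
have [g gE] := lin_ex gl; apply: (iso_sub (f := g)) => //.
  move=> f; rewrite gE => f1; apply: dual_ext => q; have [a ->] := R1_gen q.
  by have [p pE] := dual_lin f; rewrite dual0 -pE linearZ pE /= f1 scaler0.
move=> x; split=> [[f <-] a Ha|Hx].
  by have [p pE] := dual_lin f; rewrite gE -pE -linearZ R1_kill // linear0.
have hl : @GRing.linear_for A (A^o : lmodType A) E *:%R (fun a => a *: x).
  by move=> a b c; rewrite scalerDl -scalerA.
have [h hE] := lin_ex hl.
have [|k kE] := @quotmod_lift A _ E (ideal_pow m n : set A^o) h.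
  by move=> a Ha; rewrite hE; exact: Hx.
by have [f fE] := lin_dual k; exists f; rewrite gE fE kE hE scale1r.
Qed.

Let En_faithful n a : (forall x, En n x -> a *: x = 0) -> ideal_pow m n a.
Proof.
move=> H; apply: R1_kill'; apply: (separates m_local E_env) => f.
have [p pE] := dual_lin f; rewrite -pE linearZ /=; apply: H => b Hb.
by rewrite -linearZ R1_kill // linear0.
Qed.

(** The ring A / m^n acts faithfully on the part of E killed by m^n, whose dual has the same length
    as A / m^n; so every map from this part to E is a multiplication. *)
Let local_mult (f : mdual E E) n : exists a, forall x, En n x -> f x = a *: x.
Proof.
have fR := quot_ideal_pow_flen n.
have [fDR lDR] := dual_len m_local aA E_env fR.
have [fS lS] := iso_flen (dual_Rn n) fDR.
have [fDS lDS] := dual_len m_local aA E_env fS.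
have H (a : A) : exists g : mdual E (submod (En n)), forall z, g z = a *: \val z.
  have gl : @GRing.linear_for A (submod (En n)) E *:%R (fun z => a *: \val z).
    by move=> b x y; rewrite -!subvalE (linearP (subval (En n))) scalerDr !scalerA mulrC.
  by have [g gE] := lin_ex gl; have [k kE] := lin_dual g; exists k => z; rewrite kE gE.
have [mu muE] := choice H.
have mul : @GRing.linear_for A (A^o : lmodType A) (mdual E (submod (En n))) *:%R mu.
  move=> a b c; apply: dual_ext => z; rewrite dual_linE !muE scalerDl; congr (_ + _).
  by rewrite scalerA.
have [M ME] := lin_ex mul.
have [|M' M'E] := @quotmod_lift A _ _ (ideal_pow m n : set A^o) M.
  move=> a Ha; rewrite ME; apply: dual_ext => z; rewrite muE dual0.
  exact: (submod_valP (HEn n) z a Ha).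
have M'i : inj0 M'.
  move=> q; have [a <-] := surj_qpi q; rewrite M'E ME => Ma.
  apply/(ker_qpi (ideal_pow_submodule m n)); apply: En_faithful => x Hx.
  have [z <-] := submod_mem (HEn n) Hx; by rewrite -muE Ma dual0.
have [_ _ M's] := inj_len M'i fDS.
have {}M's : onto M' by apply: M's; rewrite lDS lS lDR.
have [fr frE] := dual_map E (subval (En n)).
have [q qE] := M's (fr f); have [a aq] := surj_qpi q; exists a => x Hx.
have [z zx] := submod_mem (HEn n) Hx.
by rewrite -zx -muE -ME -M'E -/(qpi _ a) aq qE frE.
Qed.

(** The multipliers that represent an endomorphism on the parts killed by m^n form a Cauchy sequence
    by faithfulness. Its limit in the complete ring A represents the endomorphism on all of E. *)
Lemma cof_E : cof E E.
Proof.
have H (a : A) : exists g : mdual E E, forall x, g x = a *: x.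
  by have [g gE] := lin_dual (@mulm A E a : {linear E -> E}); exists g => x; rewrite gE.
have [mu muE] := choice H.
have mul : @GRing.linear_for A (A^o : lmodType A) (mdual E E) *:%R mu.
  move=> a b c; apply: dual_ext => z; rewrite dual_linE !muE scalerDl; congr (_ + _).
  by rewrite scalerA.
have [M ME] := lin_ex mul; apply: (acc_surj (f := M)) aA => f.
have [w wE] := choice (local_mult f).
have EnS n : En n `<=` En n.+1 by move=> x Hx a /ideal_powS_sub; exact: Hx.
have [_ /(_ w)] := m_complete.
case=> [n|a aE].
  apply: En_faithful => x Hx; rewrite scalerBl -!wE ?subrr //; exact: EnS.
exists a; rewrite ME; apply: dual_ext => x; rewrite muE.
have [n Hn] := E_tors m_local aA E_env x.
rewrite (wE n x Hn); apply/eqP; rewrite -subr_eq0 -scalerBl; apply/eqP; exact: Hn.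
Qed.

Lemma cof_prod U V : cof E U -> cof E V -> cof E (prodm U V).
Proof.
move=> cU cV; have [p2 p2E] := snd_lin U V; have [i iE] := lin_id U.
have [z0 z0E] := lin0 U V; have [h hE] := pair_lin i z0.
suff s : ses h p2 by apply/(cof_ses Einj s).
split.
- by move=> x; rewrite hE iE => -[].
- move=> [x y]; rewrite p2E /=; split=> [->|[u]]; last by rewrite hE z0E => -[_ <-].
  by exists x; rewrite hE iE z0E.
- by move=> y; exists (0, y); rewrite p2E.
Qed.

Fixpoint Epow n : lmodType A := if n is k.+1 then prodm E (Epow k) else E.

Lemma cof_Epow n : cof E (Epow n).
Proof. by elim: n => [|n IH]; [exact: cof_E|apply: cof_prod => //; exact: cof_E]. Qed.

Lemma inj_Epow n : injective_module (Epow n).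
Proof. by elim: n => [|n IH]; [exact: Einj|exact: injective_prod]. Qed.

Lemma tors_Epow n (x : Epow n) : tors m x.
Proof.
elim: n x => [|n IH] x; first exact: (E_tors m_local aA E_env).
by case: x => x y; apply: tors_pair => //; exact: (E_tors m_local aA E_env).
Qed.

(** Finitely many generators of the dual of T are the coordinates of the embedding; [Epow n] has n +
    1 factors. *)
Lemma cof_embed T : cof E T -> exists n (g : {linear T -> Epow n}), inj0 g.
Proof.
move=> cT; have [s _ sT] := acc_fg cT (@submodule_setT A (mdual E T)).
suff [n [g gE]] : exists n (g : {linear T -> Epow n}),
    forall x, g x = 0 -> forall f, f \in s -> f x = 0.
  exists n, g => x gx; apply: (separates m_local E_env) => f.
  have : lspan s f by rewrite sT.
  apply: (lspan_min (S := [set f : mdual E T | f x = 0])) => [|f' fs /=]; last exact: gE.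
  apply/submoduleP; split; first exact: (@dual0 A E T x).
  move=> a f1 f2 /= f10 f20; have := @dual_linE A E T f1 f2 a x.
  by rewrite f10 f20 scaler0 addr0.
elim: s {sT} => [|f s [n [g gE]]].
  by have [z zE] := lin0 T E; exists 0%N, z.
have [p pE] := dual_lin f; have [h hE] := pair_lin p g.
exists n.+1, h => x; rewrite hE => -[px gx] f'; rewrite inE => /orP [/eqP ->|]; first by rewrite -pE.
exact: gE.
Qed.

(** An embedding of the kernel of a into a power of E extends to T by injectivity. The extension
    stays injective, because every nonzero t in T has a nonzero multiple killed by a. *)
Lemma cof_of_ker T a : (forall x : T, tors m x) -> m a -> cof E (submod (@mk A T a)) -> cof E T.
Proof.
move=> tT ma /cof_embed [n [g gi]].
have [|h hE] := @injective_ext A (Epow n) _ T (subval (@mk A T a)) g (@inj_Epow n).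
  by move=> x /inj0_subval ->; rewrite linear0.
apply: (cof_inj Einj (f := h)); last exact: cof_Epow.
move=> t ht; apply: contrapT => t0; have [N HN] := tors_nilp (tT t) ma.
have [k [nk Hk]] : exists k, a ^+ k *: t <> 0 /\ a ^+ k.+1 *: t = 0.
  apply: contrapT => H; elim: N HN => [|N IHN]; first by rewrite expr0 scale1r.
  by move=> HN; apply: IHN; apply: contrapT => H'; apply: H; exists N.
have Ht : @mk A T a (a ^+ k *: t) by rewrite /mk /ker /= /mulm scalerA -exprS.
have [z zE] := submod_mem (ker_submodule _) Ht.
apply: nk; rewrite -zE (gi z) ?[LHS](linear0 (subval _)) //.
by rewrite -hE subvalE zE linearZ /= ht scaler0.
Qed.

Lemma flen_cof W : flen W -> cof E W.
Proof. by move=> /(dual_len m_local aA E_env) [/flen_acc]. Qed.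

Local Notation H j X := (local_cohomology m res j X).

Lemma coh_tors j X (h : H j X) : tors m h.
Proof.
have [x [[[n Hn] dx] hx]] := @cls_ex A m (aug (res X)) j h; exists n => a Ha.
have h0 : cls (0 : HC m (aug (res X)) j) 0 by exists 0; rewrite !linear0.
have := cls_lin a hx h0; rewrite !addr0 Hn // => ha; exact: (cls_uniq ha h0).
Qed.

Lemma coh0 X : iso (submod (@tors A m X)) (H 0 X).
Proof.
pose C := aug (res X).
have cx (z : submod (@tors A m X)) : @cyc A m C 0 (df C 0 (\val z)).
  split; last exact: df_df.
  exact: (tors_lin (df C 0) (submod_valP (tors_submodule m X) z)).
have [g gE] := choice (fun z => cls_of (cx z)).
have gl : @GRing.linear_for A (submod (@tors A m X)) (HC m C 0) *:%R g.
  move=> a x y; apply: (cls_uniq (gE _)).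
  have -> : df C 0 (\val (a *: x + y)) = a *: df C 0 (\val x) + df C 0 (\val y).
    rewrite -(linearP (df C 0)); congr (df C 0 _); exact: (linearP (subval (@tors A m X))).
  exact: cls_lin.
have [G GE] := lin_ex gl; exists G; split.
  move=> z; rewrite GE => /(cls_eq0 (gE z)) z0; apply: val_inj.
  by rewrite linear0; exact: (@df_inj A C).
move=> h; have [x [[tx dx] hx]] := @cls_ex A m C 0 h.
have [x0 x0E] := (@df_exact A C 0 x).1 dx.
have tx0 : tors m x0 by apply: (@tors_inj A m _ _ (df C 0)); [exact: df_inj|rewrite x0E].
have [z zE] := submod_mem (tors_submodule m X) tx0.
exists z; rewrite GE; apply: (cls_uniq (gE z)); by rewrite zE x0E.
Qed.

(** The resolution of an injective module splits, and the splittings are linear, so they respect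
    torsion. *)
Lemma coh_injective K j : injective_module K -> forall h : H j.+1 K, h = 0.
Proof.
move=> Ki h; pose C := aug (res K).
have iC n : injective_module (ob C n) by case: n => [//|n]; exact: ir_injective.
have HS n : exists s : {linear ob C n.+1 -> ob C n}, forall x, df C n (s (df C n x)) = df C n x.
  elim: n => [|n [s sE]].
    have [i iE] := lin_id K.
    have [|s sE] := @injective_ext A K K (ob C 1) (df C 0) i (iC 0%N).
      by move=> x /df_inj ->; rewrite linear0.
    by exists s => x; rewrite sE iE.
  have pl : @GRing.linear_for A (ob C n.+1) (ob C n.+1) *:%R (fun y => y - df C n (s y)).
    by move=> a x y; rewrite (linearP s) (linearP (df C n)) opprD addrACA scalerBr.
  have [p pE] := lin_ex pl.
  have [|s' s'E] := @injective_ext A _ _ _ (df C n.+1) p (iC n.+1).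
    by move=> y /df_exact [x <-]; rewrite pE sE subrr.
  by exists s' => y; rewrite s'E pE linearB df_df subr0.
have [x [[tx dx] hx]] := @cls_ex A m C j.+1 h.
apply/(cls_eq0 hx); have [y yx] := (@df_exact A C j.+1 x).1 dx.
have [s sE] := HS j.+1; exists (s x); first exact: (tors_lin s tx).
by rewrite -yx sE.
Qed.

(** Dimension shifting along T inside a power of E, which is torsion and injective. In degree one,
    classes of the quotient in H^0 lift, since all elements of that power of E are torsion. *)
Lemma coh_cof0 T j : (forall x : T, tors m x) -> cof E T -> forall h : H j.+1 T, h = 0.
Proof.
elim: j T => [|j IH] T tT cT h; have [n [i ii]] := cof_embed cT;
  have s := ses_inj ii; have [F [G [Dl [F0 FG GD DF [_ GE]]]]] := long_exact m res s.
  have /DF [c cE] : F 1%N h = 0 by apply: coh_injective; exact: inj_Epow.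
  rewrite -cE; apply/GD.
  pose CK := aug (res (Epow n)); pose CC := aug (res (quotmod (range i))).
  have iC : injc CC := @aug_injc A _ (res (quotmod (range i))).
  have [psi [cpsi psi0]] := @chain_lift A CK CC iC (qpi (range i)).
  have [x [[tx dx] cx]] := @cls_ex A m CC 0 c.
  have [q qE] := (@df_exact A CC 0 x).1 dx; have [k kE] := surj_qpi (S := range i) q.
  have ck : @cyc A m CK 0 (df CK 0 k).
    by split; [exact: (tors_lin (df CK 0) (tors_Epow k))|exact: df_df].
  have [h' h'k] := cls_of ck; exists h'.
  apply: (cls_uniq (GE 0%N psi cpsi psi0 _ _ h'k)).
  by rewrite cpsi psi0 kE qE.
have /DF [c cE] : F j.+2 h = 0 by apply: coh_injective; exact: inj_Epow.
rewrite -cE (IH _ _ _ c) ?linear0 //.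
  move=> q; have [k <-] := surj_qpi q; exact: (tors_lin (qpi _) (tors_Epow k)).
by apply: (cof_onto Einj (surj_qpi (S := range i))); exact: cof_Epow.
Qed.

Lemma flen_coh0 W j : flen W -> forall h : H j.+1 W, h = 0.
Proof. by move=> fW; apply: coh_cof0; [exact: flen_tors fW|exact: flen_cof]. Qed.

Definition modt X : lmodType A := quotmod (@tors A m X).

Lemma tors_flen X : acc X -> flen (submod (@tors A m X)).
Proof.
move=> aX; apply: (acc_tors_flen m_local aA (acc_sub aX)) => z.
apply: (tors_inj (f := subval (@tors A m X))); first exact: inj0_subval.
exact: (submod_valP (tors_submodule m X) z).
Qed.

Lemma modt_tors X (x : modt X) : acc X -> tors m x -> x = 0.
Proof.
move=> aX [n Hn]; have [y yx] := surj_qpi x; rewrite -yx in Hn *.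
apply/(ker_qpi (tors_submodule m X)).
suff fl : flen (submod (line y)).
  have [z zE] : exists z : submod (line y), \val z = y.
    by apply: (submod_mem (line_submodule y)); exists 1; rewrite ?scale1r.
  by have := tors_lin (subval (line y)) (flen_tors m_local aA fl z); rewrite subvalE zE.
apply: (flen_nilp m_local aA (acc_line aA (x := y))) => a z ma.
have [b _ bE] := submod_valP (line_submodule y) z.
have an : ideal_pow m n (a ^+ n).
  by elim: n {Hn} => [|n IH]; [|rewrite exprS; exact: ideal_powS_mem].
have ty : tors m (a ^+ n *: y).
  by apply/(ker_qpi (tors_submodule m X)); rewrite linearZ; exact: Hn.
have [k Hk] := tors_nilp ty ma; exists (k + n)%N; apply: val_inj.
by rewrite linear0 linearZ /= -bE exprD -scalerA (scalerA _ b) [a ^+ n * b]mulrC -scalerA scalerA mulrC -scalerA Hk scaler0.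
Qed.

Lemma coh_modt X j : acc X -> iso (H j.+1 X) (H j.+1 (modt X)).
Proof.
move=> aX; have s := ses_subquot (tors_submodule m X).
have [F [G [Dl [F0 FG GD DF _]]]] := long_exact m res s.
have fT := tors_flen aX.
exists (G j.+1); split.
  by move=> h /FG [h' <-]; rewrite (flen_coh0 fT h') linear0.
by move=> h; apply/GD; exact: (flen_coh0 fT).
Qed.

Section ParameterSetting.
Variables (Q : set A) (gs : seq A) (r : nat) (u : nat -> A).
Hypothesis st : setting m Q gs r u.

Lemma sup_regular X a : acc X -> (forall x : X, tors m x -> x = 0) -> superficial Q X a ->
  forall x : X, a *: x = 0 -> x = 0.
Proof.
move=> aX X0 sa x ax; apply: X0.
have Kx : @mk A X a x by [].
have [z zE] := submod_mem (ker_submodule _) Kx; rewrite -zE.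
exact: (tors_lin (subval _) (flen_tors m_local aA (sup_ker_flen st aX sa) z)).
Qed.

Lemma mul_ses X a : (forall x : X, a *: x = 0 -> x = 0) ->
  ses (@mulm A X a : {linear X -> X}) (qpi (range (@mulm A X a : {linear X -> X}))).
Proof. by move=> reg; apply: ses_inj => x; exact: reg. Qed.

Lemma mul_les X a : (forall x : X, a *: x = 0 -> x = 0) ->
  exists (G : forall j, {linear H j X -> H j (mq X a)})
         (Dl : forall j, {linear H j (mq X a) -> H j.+1 X}),
  [/\ forall j, exact_at (@mulm A (H j X) a : {linear _ -> _}) (G j),
      forall j, exact_at (G j) (Dl j) &
      forall j, exact_at (Dl j) (@mulm A (H j.+1 X) a : {linear _ -> _})].
Proof.
move=> /mul_ses s; have [F [G [Dl [F0 FG GD DF [FE _]]]]] := long_exact m res s.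
have FM j h : F j h = a *: h.
  exact: (@induced_scale A m (aug (res X)) j (F j) a (@aug_injc A X (res X)) (FE j) h).
exists G, Dl; split=> // j h.
- rewrite FG; split=> [[h' <-]|[h' <-]]; exists h'; by rewrite FM.
- by rewrite -DF FM.
Qed.

(** Torsion does not affect positive degrees, so a superficial u_n may be taken regular. Its kernel
    on H^(j+1) is then an image of H^j of X / u_n X, cofinite by induction, and a torsion module
    with cofinite kernel is cofinite. *)
Lemma coh_cof X j : acc X -> cof E (H j X).
Proof.
elim: j X => [|j IH] X aX.
  apply: (cof_iso Einj (coh0 X)); apply: flen_cof; exact: tors_flen.
have aX' : acc (modt X) by exact: acc_quot.
apply: (cof_iso Einj (iso_sym (coh_modt j aX))).
have [n _ sn] := ex_superficial st 0 aX'.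
have reg := sup_regular aX' (fun x => @modt_tors X x aX) sn.
have [G [Dl [MG GD DM]]] := mul_les reg.
apply: (@cof_of_ker _ (u n)); first exact: coh_tors.
  by apply: (st_Qm st); exact: (mem_u st).
have DK h : @mk A (H j.+1 (modt X)) (u n) (Dl j h) by apply/DM; exists h.
have [D' D'E] := submod_corestrict (ker_submodule _) DK.
apply: (cof_onto Einj (f := D')); last by apply: IH; exact: acc_quot.
move=> z; have /DM [h hE] := submod_valP (ker_submodule _) z.
by exists h; apply: val_inj; rewrite D'E.
Qed.

Definition DC j X : lmodType A := dual_cohomology m E res j X.

Lemma acc_DC j X : acc X -> acc (DC j X).
Proof. exact: coh_cof. Qed.

Lemma five_ses U V W a (g : {linear U -> V}) (h : {linear V -> W}) :
  exact_at (@mulm A U a : {linear U -> U}) g -> exact_at g h ->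
  exact_at h (@mulm A W a : {linear W -> W}) ->
  exists (p : {linear mq U a -> V}) (q : {linear V -> submod (@mk A W a)}), ses p q.
Proof.
move=> eg egh eh; have HR := range_submodule (@mulm A U a : {linear U -> U}).
have [|p pE] := @quotmod_lift A U V (range (@mulm A U a : {linear U -> U})) g.
  by move=> x [y _ <-]; apply/eg; exists y.
have hK v : @mk A W a (h v) by apply/eh; exists v.
have [q qE] := submod_corestrict (ker_submodule _) hK.
exists p, q; split.
- move=> y; have [x <-] := surj_qpi y; rewrite pE => /eg [z zE].
  by apply/(ker_qpi HR); exists z.
- move=> v; split=> [/(congr1 val)|[y <-]].
    rewrite qE linear0 => /egh [x <-]; by exists (qpi _ x); rewrite pE.
  have [x <-] := surj_qpi y; apply: val_inj; rewrite qE pE linear0.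
  by apply/egh; exists x.
- move=> z; have /eh [v vE] := submod_valP (ker_submodule _) z.
  by exists v; apply: val_inj; rewrite qE.
Qed.

(** Multiplication by a is its own dual, so dualizing the long exact sequence exchanges kernels and
    cokernels of a. *)
Lemma DC_ses X a j : (forall x : X, a *: x = 0 -> x = 0) ->
  exists (p : {linear mq (DC j.+1 X) a -> DC j (mq X a)})
         (q : {linear DC j (mq X a) -> submod (@mk A (DC j X) a)}), ses p q.
Proof.
move=> /mul_les [G [Dl [MG GD DM]]].
have [G' G'E] := dual_map E (G j); have [D' D'E] := dual_map E (Dl j).
have mE U phi x : (@mulm A (mdual E U) a) phi x = phi (@mulm A U a x).
  by have [p pE] := dual_lin phi; rewrite /mulm dualZ -pE -linearZ pE.
apply: (@five_ses (DC j.+1 X) (DC j (mq X a)) (DC j X) a D' G').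
- exact: (dual_exact Einj D'E (mE (H j.+1 X)) (DM j)).
- exact: (dual_exact Einj G'E D'E (GD j)).
- exact: (dual_exact Einj (mE (H j X)) G'E (MG j)).
Qed.

End ParameterSetting.

End Cofinite.

(** * Homological degree *)

Section LeadingCoefficient.

Lemma hvalD s e e' n : hval s (fun i => e i + e' i) n = hval s e n + hval s e' n.
Proof. by rewrite /hval -big_split; apply: eq_bigr => i _; rewrite mulrDr mulrDl. Qed.

Lemma hvalN s e n : hval s (fun i => - e i) n = - hval s e n.
Proof. by rewrite /hval -sumrN; apply: eq_bigr => i _; rewrite mulrN mulNr. Qed.

Lemma hval_shift s k e : exists e', e' 0%N = e 0%N /\ forall n, hval s e (n + k) = hval s e' n.
Proof.
elim: k e => [|k IHk] e; first by exists e; split=> // n; rewrite addn0.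
have [e1 [e10 He1]] : exists e', e' 0%N = e 0%N /\ forall n, hval s e n.+1 = hval s e' n.
  elim: s e {IHk} => [|s IH] e; first by exists e; split=> // n; rewrite !hval0.
  have [e1 [e10 He1]] := IH e.
  exists (fun i => e i + (if i is j.+1 then - e1 j else 0)); split; first by rewrite addr0.
  by move=> n; rewrite hvalD hval_raise -He1 -(hval_diff s e n) addrC subrK.
have [e2 [e20 He2]] := IHk e1; exists e2; split; first by rewrite e20 e10.
by move=> n; rewrite addnS He1 He2.
Qed.

Lemma hval_neg s e : e 0%N < 0 -> exists N, forall n, (N <= n)%N -> hval s e n <= -1.
Proof.
move=> e0; elim: s => [|s [N IH]].
  by exists 0%N => n _; rewrite hval0 -ltzD1 addNr.
pose b := `|hval s.+1 e N|%N; exists (N + b.+1)%N => n /subnK <-.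
have H k : hval s.+1 e (N + k) <= hval s.+1 e N - k%:Z.
  elim: k => [|k IHk]; first by rewrite addn0 subr0.
  rewrite addnS -(subrK (hval s.+1 e (N + k)) (hval s.+1 e (N + k).+1)) hval_diff addrC.
  have -> : hval s.+1 e N - k.+1%:Z = (hval s.+1 e N - k%:Z) + -1.
    by rewrite -[k.+1]addn1 PoszD opprD addrA.
  by apply: lerD IHk (IH _ _); apply: leqW; exact: leq_addr.
rewrite addnC -addnA; apply: le_trans (H _) _.
rewrite lerBlDr; apply: le_trans (ler_norm _) _; rewrite -abszE -/b addrC.
by rewrite lerBrDr -PoszD lez_nat addn1 leq_addr.
Qed.

Lemma hval_lead_le s e e' k (c : int) n0 : (0 < s)%N ->
  (forall n, (n0 <= n)%N -> hval s e n <= hval s e' (n + k) + c) -> e 0%N <= e' 0%N.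
Proof.
move=> s0 H; rewrite leNgt; apply/negP => lt.
have [e1 [e10 He1]] := hval_shift s k e'.
pose e2 i := (if i == s then (e1 i - e i) + (-1) ^+ s * c else e1 i - e i).
have E n : hval s e2 n = hval s e' (n + k) - hval s e n + c.
  by rewrite hval_addc hvalD hvalN He1.
have [|N HN] := @hval_neg s e2.
  by rewrite /e2 eq_sym (gtn_eqF s0) e10 subr_lt0.
have := HN (maxn n0 N) (leq_maxr _ _); rewrite E => H1.
have := H (maxn n0 N) (leq_maxl _ _); rewrite -subr_ge0 addrAC => H2.
by have := le_trans H2 H1.
Qed.

End LeadingCoefficient.

(** * Hilbert coefficients and modules of finite length *)

Section Multiplicity.
Variables (A : comNzRingType) (m Q : set A) (gs : seq A) (r : nat) (u : nat -> A).
Hypothesis st : setting m Q gs r u.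
Implicit Types U V W X Y Z : lmodType A.
Local Notation hl := (hl Q).
Local Notation hp := (hp Q).

(** [hilbert_coef] picks each coefficient separately; existence excludes its default value and
    uniqueness makes the choices belong to one polynomial. *)
Lemma hcP X : acc X -> hp X (module_dim X) (fun i => hilbert_coef Q i X).
Proof.
move=> aX; have [e [n0 He]] := hp_exists st aX; exists n0 => n /He ->.
apply: hval_eq => i si.
have [e' [[n1 He'] <-]] : [set c | exists e, is_hilbert_coefs Q X e /\ e i = c] (hilbert_coef Q i X).
  by apply: (@xgetPex _ 0); exists (e i), e; split=> //; exists n0.
apply: (@hp_unique A Q X (module_dim X) e e' _ _ i si); first by exists n0 => k /He ->.
by exists n1; exact: He'.
Qed.

Lemma hc_unique X e i : acc X -> hp X (module_dim X) e -> (i <= module_dim X)%N ->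
  hilbert_coef Q i X = e i.
Proof. by move=> aX H2 iX; exact: (hp_unique (hcP aX) H2 iX). Qed.

Lemma hl_iso X Y n : acc X -> iso X Y -> hl X n = hl Y n.
Proof.
move=> aX [f [fi fs]]; have aY : acc Y by apply: (acc_iso _ aX); exists f.
apply/eqP; rewrite eqn_leq (hl_onto st n aX fs) andbT.
have /iso_sym [g [_ gs']] : iso X Y by exists f.
exact: (hl_onto st n aY gs').
Qed.

Lemma hc_iso X Y i : acc X -> iso X Y -> (i <= module_dim X)%N ->
  hilbert_coef Q i X = hilbert_coef Q i Y.
Proof.
move=> aX XY ie; apply: (@hc_unique X (fun i => hilbert_coef Q i Y)) => //.
have [n0 H] := hcP (acc_iso XY aX); rewrite (dim_iso st XY); exists n0 => n /H <-.
by rewrite (hl_iso _ aX XY).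
Qed.

Lemma hc_dim0 X : acc X -> module_dim X = 0%N -> hilbert_coef Q 0 X = (module_length X)%:Z.
Proof.
move=> aX d0; rewrite (@hc_unique X (fun=> (module_length X)%:Z) 0 aX) //.
by rewrite d0; apply: (hp_flen st); exact/(dim0P st aX).
Qed.

Lemma hc_mq X a i : acc X -> Q a -> superficial Q X a -> (i.+1 < module_dim X)%N ->
  hilbert_coef Q i X = hilbert_coef Q i (mq X a).
Proof.
move=> aX Qa sa id.
have d0 : (0 < module_dim X)%N by apply: leq_trans id.
have dq := dim_mq st aX Qa sa d0.
have [e' [He' E _]] := hp_integrate st aX Qa sa (hcP (acc_quot aX : acc (mq X a))).
rewrite (@hc_unique X e') //; first by rewrite E // -ltnS dq.
  by rewrite -dq.
exact: leq_trans (leqnSn _) (ltnW id).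
Qed.

Lemma hc_mq_last X a i : acc X -> Q a -> superficial Q X a -> i.+1 = module_dim X ->
  hilbert_coef Q i X = hilbert_coef Q i (mq X a) - (-1) ^+ i * (module_length (submod (@mk A X a)))%:Z.
Proof.
move=> aX Qa sa id.
have d0 : (0 < module_dim X)%N by rewrite -id.
have dq := dim_mq st aX Qa sa d0; have {}dq : module_dim (mq X a) = i by apply/eqP; rewrite -eqSS dq id.
have [e' [He' _ E]] := hp_integrate st aX Qa sa (hcP (acc_quot aX : acc (mq X a))).
rewrite (@hc_unique X e') //; first by rewrite -[in LHS]dq E dq.
  by rewrite -id -[in X in hp _ X _]dq.
by rewrite -id.
Qed.

(** Superficial elements reduce to dimension one, where e_0 = 0 would make the Hilbert function
    eventually constant and the dimension 0. *)
Lemma e0_gt0 X : acc X -> (0 < module_dim X)%N -> 0 < hilbert_coef Q 0 X.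
Proof.
have [k] := ubnP (module_dim X); elim: k X => // k IH X dk aX d0.
have [n _ sn] := ex_superficial st 0 aX.
have Qa := mem_u st n.
have dq := dim_mq st aX Qa sn d0.
have [d1|d1] := posnP (module_dim (mq X (u n))); last first.
  rewrite (hc_mq aX Qa sn) -?dq //; apply: IH => //; last exact: acc_quot.
  by rewrite -ltnS dq.
have E : module_dim X = 1%N by rewrite -dq d1.
have [n0 H] := hcP aX; rewrite E in H.
have D k0 : (n0 <= k0)%N -> hilbert_coef Q 0 X = (hl X k0.+2)%:Z - (hl X k0.+1)%:Z.
  by move=> k0n; rewrite !H ?leqW // hval_diff hval0.
rewrite lt_neqAle; apply/andP; split; last first.
  by rewrite (D n0) // subr_ge0 lez_nat; exact: (hl_mono st).
apply/eqP => e0.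
suff : (module_dim X <= 0)%N by rewrite leqNgt d0.
apply: (@dim_le_hp _ _ _ _ _ _ st X 0 (fun=> (hl X n0.+1)%:Z) aX); exists n0 => j /subnK <-.
rewrite hval0; elim: (j - n0)%N => [|i IHi]; first by rewrite add0n.
by rewrite addSn -IHi; apply/eqP; rewrite -subr_eq0 -D ?leq_addl // -e0.
Qed.

Lemma col_flen_ses W Y V (f : {linear W -> Y}) (g : {linear Y -> V}) n : ses f g -> acc Y ->
  hl Y n = (colen (f @^-1` pw Q n) + hl V n)%N.
Proof.
move=> [fi fg gg] aY; have HS := pw_submodule Q Y n.
have [_ f2 E] := col_map f HS (flen_quot_pw st n aY).
rewrite /hl -/(colen (pw Q n)) E; congr (_ + _)%N.
have := iso_pre gg (pw_submodule Q V n).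
have -> : g @^-1` pw Q n = addS (range f) (pw Q n).
  apply/seteqP; split=> y /=; last first.
    move=> [_ [z [[w _ <-] Qz ->]]]; rewrite linearD (_ : g (f w) = 0) ?add0r; first exact: pw_lin.
    by apply/fg; exists w.
  move=> /(pw_onto gg) [z Qz gz]; have /fg [w wE] : g (y - z) = 0 by rewrite linearB gz subrr.
  by exists (f w), z; split; [exists w| |rewrite wE subrK].
by move=> /iso_flen /(_ f2) [_ ->].
Qed.

Lemma hl_flen_sub W Y V (f : {linear W -> Y}) (g : {linear Y -> V}) : ses f g -> acc Y -> flen W ->
  exists n0, forall n, (n0 <= n)%N -> hl Y n = (module_length W + hl V n)%N.
Proof.
move=> s aY fW; have [fi _ _] := s; have [c Hc] := artin_rees_inj (st_gs st) aY fi.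
have [N HN] := flen_pw0 st fW; exists (N + c)%N => n Nn.
rewrite (col_flen_ses n s aY); congr (_ + _)%N.
have [i iE] := lin_id W; apply/esym.
have HS := preimage_submodule f (pw_submodule Q Y n).
have fq : flen (quotmod (f @^-1` pw Q n)) by exact: quot_flen.
apply: (iso_flen _ fq).2; apply: (iso_quot (f := i)); first by move=> z; exists z.
move=> z; rewrite iE; split=> [->|Qz]; first exact: (submod0 HS).
by apply: HN; apply: Hc; exact: (pw_le Nn Qz).
Qed.

Lemma dim_flen_sub W Y V (f : {linear W -> Y}) (g : {linear Y -> V}) : ses f g -> acc Y -> flen W ->
  module_dim Y = module_dim V.
Proof.
move=> s aY fW; apply/eqP; rewrite eqn_leq; apply/andP; split.
  apply: leq_trans (dim_ses st s) _.
  by rewrite ((dim0P st (flen_acc fW)).2 fW) max0n.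
by have [_ _ gg] := s; exact: (dim_onto st gg).
Qed.

(** For large n, Q^n Y meets W trivially by the Artin-Rees lemma, so the two Hilbert functions
    eventually differ by the length of W, a constant. *)
Lemma hc_flen_sub W Y V (f : {linear W -> Y}) (g : {linear Y -> V}) : ses f g -> acc Y -> flen W ->
  (forall i, (i < module_dim Y)%N -> hilbert_coef Q i Y = hilbert_coef Q i V) /\
  hilbert_coef Q (module_dim Y) Y = hilbert_coef Q (module_dim Y) V +
    (-1) ^+ (module_dim Y) * (module_length W)%:Z.
Proof.
move=> s aY fW; have [_ _ gg] := s; have dE := dim_flen_sub s aY fW.
have [n0 H0] := hl_flen_sub s aY fW; have [n1 H1] := hcP (acc_surj gg aY).
pose e i := if i == module_dim Y then hilbert_coef Q i V + (-1) ^+ (module_dim Y) * (module_length W)%:Z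
  else hilbert_coef Q i V.
have He : hp Y (module_dim Y) e.
  exists (maxn n0 n1) => n; rewrite geq_max => /andP [Hn0 Hn1].
  by rewrite hval_addc dE -H1 // H0 ?leqW // addnC PoszD.
split=> [i iY|]; rewrite (@hc_unique Y e) //; [by rewrite /e ltn_eqF|exact: ltnW|by rewrite /e eqxx].
Qed.

Lemma pw_cokernel X Y Z (f : {linear X -> Y}) (g : {linear Y -> Z}) k : exact_at f g ->
  (forall z : Z, pw Q k z -> z = 0) ->
  forall n y, pw Q (n + k) y -> exists2 x, pw Q n x & f x = y.
Proof.
move=> fg Hk; elim=> [|n IH] y Hy.
  by have /fg [x xE] : g y = 0 by [apply: Hk; exact: pw_lin]; exists x => //; exact: pw0.
move: y Hy; rewrite addSn.
apply: (pwS_min (S := [set y | exists2 x, pw Q n.+1 x & f x = y])).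
  exact: (image_submodule f (pw_submodule Q X n.+1)).
by move=> q y Qq /IH [x Qx <-]; exists (q *: x); [exact: pwS_mem|rewrite linearZ].
Qed.

Lemma dim_flen_quot X Y Z (f : {linear X -> Y}) (g : {linear Y -> Z}) : ses f g -> acc Y -> flen Z ->
  module_dim X = module_dim Y.
Proof.
move=> s aY fZ; apply/eqP; rewrite eqn_leq; apply/andP; split.
  by have [fi _ _] := s; exact: (dim_inj st fi).
apply: leq_trans (dim_ses st s) _.
by rewrite ((dim0P st (flen_acc fZ)).2 fZ) maxn0.
Qed.

(** The Hilbert functions bound each other up to the constant length of Z and a shift by k, where
    Q^k Z = 0. In positive degree neither affects the leading coefficient. *)
Lemma e0_flen_quot X Y Z (f : {linear X -> Y}) (g : {linear Y -> Z}) : ses f g -> acc Y -> flen Z ->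
  (0 < module_dim Y)%N -> hilbert_coef Q 0 X = hilbert_coef Q 0 Y.
Proof.
move=> s aY fZ d0; have [fi fg gg] := s; have aX := acc_inj fi aY.
have dE := dim_flen_quot s aY fZ.
have [k Hk] := flen_pw0 st fZ.
have HR := range_submodule f.
have le1 n : (hl Y n <= hl X n + module_length Z)%N.
  have HS := pw_submodule Q Y n.
  have [f1 f2 E] := col_map f HS (flen_quot_pw st n aY).
  rewrite /hl -/(colen (@pw A Q Y n)) E; apply: leq_add.
    have [_ + _] := col_sub (pw_submodule Q X n) (preimage_submodule f HS) (fun x => @pw_lin _ _ _ _ f n x) (flen_quot_pw st n aX).
    by [].
  have iZ := ses_iso2 s; have [f3 l3] := iso_flen (iso_sym iZ) fZ.
  rewrite -l3; have [_ + _] := col_sub HR (addS_submodule HR HS) (sub_addSl HS) f3.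
  by [].
have le2 n : (hl X n <= hl Y (n + k))%N.
  have HS := pw_submodule Q Y (n + k).
  have [f1 f2 E] := col_map f HS (flen_quot_pw st (n + k) aY).
  rewrite /hl -/(colen (@pw A Q Y (n + k))) E; apply: leq_trans (leq_addr _ _).
  have [|_ + _] := col_sub (preimage_submodule f HS) (pw_submodule Q X n) _ f1; last by [].
  by move=> x /(pw_cokernel fg Hk) [x' Qx'] /((inj0P f).1 fi) <-.
have [n0 H0] := hcP aX; have [n1 H1] := hcP aY; rewrite dE in H0.
apply: le_anti; apply/andP; split.
  apply: (@hval_lead_le (module_dim Y) (fun i => hilbert_coef Q i X) (fun i => hilbert_coef Q i Y) k 0 (maxn n0 n1) d0) => n.
  rewrite geq_max => /andP [Hn0 Hn1]; rewrite addr0 -H0 // -H1; last by apply: leq_trans Hn1 (leq_addr _ _).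
  by rewrite lez_nat -addSn.
apply: (@hval_lead_le (module_dim Y) (fun i => hilbert_coef Q i Y) (fun i => hilbert_coef Q i X) 0 (module_length Z)%:Z (maxn n0 n1) d0) => n.
rewrite geq_max => /andP [Hn0 Hn1]; rewrite addn0 -H0 // -H1 //.
by rewrite -PoszD lez_nat.
Qed.

End Multiplicity.

Lemma eventually_forall (P : nat -> nat -> Prop) J :
  (forall j, (j < J)%N -> exists N, forall n, (N <= n)%N -> P j n) ->
  exists N, forall n, (N <= n)%N -> forall j, (j < J)%N -> P j n.
Proof.
move=> H; have H' (j : 'I_J) : exists N, forall n, (N <= n)%N -> P j n by exact: H.
have [f fP] := choice H'; exists (\max_(j < J) f j) => n Hn j jJ.
by apply: (fP (Ordinal jJ)); apply: leq_trans Hn; exact: (leq_bigmax (Ordinal jJ)).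
Qed.

Lemma pascal_sum t (h : nat -> int) :
  \sum_(j < t.+1) 'C(t, j)%:Z * (h j.+1 + h j) = \sum_(j < t.+2) 'C(t.+1, j)%:Z * h j.
Proof.
have E2 : \sum_(j < t.+1) 'C(t, j)%:Z * h j = h 0%N + \sum_(i < t.+1) 'C(t, i.+1)%:Z * h i.+1.
  have := @big_ord_recr int 0 +%R t.+1 (fun j : 'I_t.+2 => 'C(t, j)%:Z * h j).
  rewrite /= [X in X%:Z * h t.+1]bin_small // mul0r addr0 => <-.
  by rewrite big_ord_recl /= bin0 mul1r.
rewrite [RHS]big_ord_recl /= bin0 mul1r.
under [in RHS]eq_bigr => i _ do rewrite /bump /= add1n binS PoszD mulrDl.
rewrite big_split /= addrA -E2; under eq_bigr => i _ do rewrite mulrDr.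
by rewrite big_split /= addrC.
Qed.

(** * Homological degrees modulo a generic element *)

Section HomologicalDegree.
Variables (A : comNzRingType) (m Q : set A) (gs : seq A) (r : nat) (u : nat -> A) (E : lmodType A).
Hypothesis st : setting m Q gs r u.
Hypothesis m_complete : adically_complete m.
Hypothesis E_env : injective_envelope (cyclic_module m) E.
Variables (res : forall N : lmodType A, injective_resolution N).
Implicit Types U V W X Y Z : lmodType A.

Local Notation H j X := (local_cohomology m res j X).
Local Notation DC := (@DC A m E res).
Local Notation e0 X := (hilbert_coef Q 0 X).
Let m_local := st_local st.
Let aA := st_acc st.

Let Einj : injective_module E.
Proof. by have [] := E_env. Qed.

Lemma accDC j X : acc X -> acc (DC j X).
Proof. exact: (acc_DC m_local aA m_complete E_env st). Qed.

Arguments accDC j {X} _.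

Lemma coh_trivial j Z : (forall z : Z, z = 0) -> forall h : H j Z, h = 0.
Proof.
move=> Z0; have [fZ _] := trivial_flen Z0; case: j => [|j] h; last first.
  exact: (flen_coh0 m_local aA m_complete E_env).
have [f [_ fs]] := coh0 m res Z; have [z <-] := fs h.
by rewrite (_ : z = 0) ?linear0 //; apply: val_inj; rewrite linear0.
Qed.

Lemma coh_iso j X Y : iso X Y -> iso (H j X) (H j Y).
Proof.
move=> [f [fi fs]]; have s := ses_inj fi.
have Z0 (z : quotmod (range f)) : z = 0.
  have [y <-] := surj_qpi z; have [x <-] := fs y.
  by apply/(ker_qpi (range_submodule f)); exists x.
have [F [G [Dl [F0 FG GD DF _]]]] := long_exact m res s.
exists (F j); split; last by move=> h; apply/FG; exact: coh_trivial.
case: j => [//|j] h /DF [c <-]; by rewrite (coh_trivial Z0 c) linear0.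
Qed.

Lemma DC_iso j X Y : iso X Y -> iso (DC j X) (DC j Y).
Proof. by move=> XY; apply: (dual_iso Einj); apply: coh_iso; exact: iso_sym. Qed.

Lemma DC_modt j X : acc X -> iso (DC j.+1 X) (DC j.+1 (modt m X)).
Proof.
move=> aX; apply: (dual_iso Einj); apply: iso_sym.
exact: (coh_modt m_local aA m_complete E_env res j aX).
Qed.

(** Modulo a superficial element, [DC j.+1] embeds in [DC j] of the quotient module, so its
    dimension is at most one more. *)
Lemma dim_DC j X : acc X -> (module_dim (DC j X) <= j)%N.
Proof.
elim: j X => [|j IH] X aX.
  rewrite leqn0; apply/eqP; apply/(dim0P st); first exact: accDC.
  have fT := tors_flen m_local aA aX; have [fH _] := iso_flen (coh0 m res X) fT.
  by have [] := dual_len m_local aA E_env fH.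
rewrite (dim_iso st (DC_modt j aX)); set X' := modt m X.
have aX' : acc X' by exact: acc_quot.
have [N1 HN1] := superficial_generic (st_gs st) (st_r st) (st_u st) aX'.
have [n N1n sY] := ex_superficial st N1 (accDC j.+1 aX').
have [d0|d0] := posnP (module_dim (DC j.+1 X')); first by rewrite d0.
have Qa := mem_u st n.
rewrite -(dim_mq st (accDC j.+1 aX') Qa sY d0) ltnS.
have reg := sup_regular m_local aA st aX' (fun x => @modt_tors A m m_local aA X x aX) (HN1 n N1n).
have [p [q [pi _ _]]] := DC_ses E_env res j reg.
by apply: leq_trans (dim_inj st pi) _; apply: IH; exact: acc_quot.
Qed.

Local Notation is_hd := (is_hdeg m E res Q).
Local Notation hd := (hdeg m E res Q).

Lemma is_hdeg_exists X : acc X -> exists h, is_hd X h.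
Proof.
have [k] := ubnP (module_dim X); elim: k X => // k IH X dk aX.
have [d0|d0] := posnP (module_dim X); first by eexists; exact: IsHdeg0.
have H' (j : 'I_(module_dim X)) : exists h, is_hd (DC j X) h.
  apply: IH; last exact: accDC.
  by apply: leq_ltn_trans (dim_DC j aX) _; apply: leq_trans (ltn_ord j) _; rewrite -ltnS.
have [h hE] := choice H'.
pose h' j := if insub j is Some i then h i else 0.
eexists; apply: (@IsHdegS _ _ _ _ _ _ h') => // j jd.
by rewrite /h' (insubT (fun k => (k < module_dim X)%N) jd); exact: (hE (Ordinal jd)).
Qed.

(** [is_hdeg] is a relation on types of modules; invariance under isomorphism includes the
    uniqueness of its value. *)
Lemma is_hdeg_iso X h : is_hd X h -> forall Y h', acc X -> iso X Y -> is_hd Y h' -> h = h'.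
Proof.
elim=> {X h} [X d0|X h d0 _ IH] Y h' aX XY hY.
  have fX := (dim0P st aX).1 d0; have [fY lY] := iso_flen XY fX.
  case: hY (dim_iso st XY) lY => [Y' _ _ -> //|Y' h1 dY _ E1]; by rewrite -E1 d0 in dY.
case: hY XY (dim_iso st XY) => [Y' dY|Y' h1 dY H1] XY E1; first by rewrite E1 dY in d0.
rewrite (hc_iso st aX XY (leq0n _)) E1; congr (_ + _); rewrite -E1; apply: eq_bigr => j _.
congr (_ * _); apply: (IH j (ltn_ord j) (DC j Y')); [exact: accDC|exact: DC_iso|].
by apply: H1; rewrite -E1.
Qed.

Lemma hdegP X : acc X -> is_hd X (hd X).
Proof. by move=> /is_hdeg_exists [h hX]; apply: (@xgetPex _ 0); exists h. Qed.

Lemma hd_iso X Y : acc X -> iso X Y -> hd X = hd Y.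
Proof.
move=> aX XY; apply: (is_hdeg_iso (hdegP aX) aX XY); apply: hdegP; exact: acc_iso XY aX.
Qed.

Lemma hd_eq X h : acc X -> is_hd X h -> hd X = h.
Proof. by move=> aX; apply: (is_hdeg_iso (hdegP aX) aX); exact: iso_refl. Qed.

Lemma hd_dim0 X : acc X -> module_dim X = 0%N -> hd X = (module_length X)%:Z.
Proof. by move=> aX d0; apply: hd_eq => //; exact: IsHdeg0. Qed.

Lemma hd_flen X : flen X -> hd X = (module_length X)%:Z.
Proof. by move=> fX; have aX := flen_acc fX; apply: hd_dim0 => //; exact/(dim0P st). Qed.

Lemma hd_dimS X : acc X -> (0 < module_dim X)%N ->
  hd X = e0 X + \sum_(j < module_dim X) 'C((module_dim X).-1, j)%:Z * hd (DC j X).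
Proof.
move=> aX d0; apply: hd_eq => //; apply: (@IsHdegS _ _ _ _ _ _ (fun j => hd (DC j X))) => // j _.
by apply: hdegP; exact: accDC.
Qed.

Lemma hd_ge0 X : acc X -> 0 <= hd X.
Proof.
have [k] := ubnP (module_dim X); elim: k X => // k IH X dk aX.
have [d0|d0] := posnP (module_dim X); first by rewrite hd_dim0.
rewrite hd_dimS //; apply: addr_ge0; first exact/ltW/(e0_gt0 st).
apply: sumr_ge0 => j _; apply: mulr_ge0 => //; apply: IH; last exact: accDC.
by apply: leq_ltn_trans (dim_DC j aX) _; apply: leq_trans (ltn_ord j) _; rewrite -ltnS.
Qed.

Definition t0 X := module_length (submod (@tors A m X)).

Lemma coh0_len X : acc X -> flen (H 0 X) /\ module_length (H 0 X) = t0 X.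
Proof. by move=> aX; apply: (iso_flen (coh0 m res X)); exact: (tors_flen m_local aA). Qed.

Lemma DC0_len X : acc X -> flen (DC 0 X) /\ module_length (DC 0 X) = t0 X.
Proof. by move=> /coh0_len [fH <-]; exact: (dual_len m_local aA E_env fH). Qed.

Lemma hd_DC0 X : acc X -> hd (DC 0 X) = (t0 X)%:Z.
Proof. by move=> /DC0_len [f0 l0]; rewrite hd_flen // l0. Qed.

Lemma t0_flen X : flen X -> t0 X = module_length X.
Proof.
move=> fX; apply/esym; apply: (iso_flen _ (sub_flen fX (tors_submodule m X))).2.
exists (subval (@tors A m X)); split; first exact: inj0_subval.
by move=> x; apply/(range_subval (tors_submodule m X)); exact: (flen_tors m_local aA fX).
Qed.

Lemma t0_0 X : (forall x : X, tors m x -> x = 0) -> t0 X = 0%N.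
Proof.
move=> X0; have [] // := @trivial_flen A (submod (@tors A m X)).
move=> z; apply: val_inj; rewrite [RHS](linear0 (subval _)); apply: X0.
exact: (submod_valP (tors_submodule m X) z).
Qed.

(** In positive dimension only H^0 changes, by the length of W, and its dual enters the homological
    degree with coefficient 1. *)
Lemma hd_flen_sub W Y V (f : {linear W -> Y}) (g : {linear Y -> V}) : ses f g -> acc Y -> flen W ->
  hd Y = hd V + (module_length W)%:Z.
Proof.
move=> s aY fW; have [fi fg gg] := s; have aV := acc_surj gg aY.
have dE := dim_flen_sub st s aY fW.
have [d0|d0] := posnP (module_dim Y).
  have fY := (dim0P st aY).1 d0; have [_ fV] := (ses_flen s).1 fY.
  by rewrite !hd_flen // (ses_len s fY) addnC PoszD.
have [eE _] := hc_flen_sub st s aY fW.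
rewrite !hd_dimS // -?dE // eE // -addrA; congr (_ + _).
have [F [G [Dl [F0 FG GD DF _]]]] := long_exact m res s.
have HW j (h : H j.+1 W) : h = 0 by exact: (flen_coh0 m_local aA m_complete E_env).
have t0E : t0 Y = (module_length W + t0 V)%N.
  have [fY lY] := coh0_len aY; have [fV lV] := coh0_len aV.
  have s0 : ses (F 0%N) (G 0%N) by split=> // h; apply/GD; exact: HW.
  rewrite -lY (ses_len s0 fY) -lV; congr (_ + _)%N.
  by have [_ ->] := coh0_len (flen_acc fW); exact: t0_flen.
have iE j : hd (DC j.+1 Y) = hd (DC j.+1 V).
  apply: hd_iso; first exact: accDC.
  apply: (dual_iso Einj); apply: iso_sym; exists (G j.+1); split=> [h /FG [h' <-]|h].
    by rewrite (HW j h') linear0.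
  by apply/GD; exact: HW.
case E1 : (module_dim Y) d0 => [//|s'] _.
rewrite 2!big_ord_recl /= bin0 !mul1r !hd_DC0 // t0E PoszD [RHS]addrC addrA; congr (_ + _).
by apply: eq_bigr => j _; rewrite /bump /= add1n iE.
Qed.

Lemma hd_modt X : acc X -> hd X = hd (modt m X) + (t0 X)%:Z.
Proof.
move=> aX; exact: (hd_flen_sub (ses_subquot (tors_submodule m X)) aX (tors_flen m_local aA aX)).
Qed.

Lemma hd_gt_t0 X : acc X -> (0 < module_dim X)%N -> (t0 X)%:Z < hd X.
Proof.
move=> aX d0; have aX' : acc (modt m X) by exact: acc_quot.
have dE := dim_flen_sub st (ses_subquot (tors_submodule m X)) aX (tors_flen m_local aA aX).
rewrite hd_modt // ltrDr (hd_dimS aX') -?dE //.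
apply: ltr_wpDr; last by apply: (e0_gt0 st) => //; rewrite -dE.
by apply: sumr_ge0 => j _; apply: mulr_ge0 => //; apply: hd_ge0; exact: accDC.
Qed.

Lemma t0_inj U V (f : {linear U -> V}) : inj0 f -> acc V -> (t0 U <= t0 V)%N.
Proof.
move=> fi aV; have fV := tors_flen m_local aA aV.
have [|g gE] := @submod_corestrict A V _ (f \o subval (@tors A m U)) _ (tors_submodule m V).
  by move=> z; exact: (tors_lin f (submod_valP (tors_submodule m U) z)).
have [] // := @inj_len A _ _ g _ fV.
by move=> z gz; apply: inj0_subval; apply: fi; rewrite -[LHS]gE gz linear0.
Qed.

(** Meant for [DC 1], of dimension at most one. In dimension one the homological degree is e_0 plus
    the length of the torsion; e_0 is unchanged and the torsion can only shrink in U. *)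
Lemma hd_sub_dim1 U V Z (f : {linear U -> V}) (g : {linear V -> Z}) : ses f g -> acc V -> flen Z ->
  (module_dim V <= 1)%N -> hd U <= hd V.
Proof.
move=> s aV fZ d1; have [fi _ _] := s; have aU := acc_inj fi aV.
have dE := dim_flen_quot st s aV fZ.
have [d0|d0] := posnP (module_dim V).
  have fV := (dim0P st aV).1 d0; have [fU le1 _] := inj_len fi fV.
  by rewrite !hd_flen // lez_nat.
have {}d1 : module_dim V = 1%N by apply/eqP; rewrite eqn_leq d1.
rewrite !hd_dimS ?dE // d1 !big_ord_recl !big_ord0 /= bin0 !mul1r !addr0 !hd_DC0 //.
rewrite (e0_flen_quot st s aV fZ) ?d1 // lerD2l lez_nat; exact: t0_inj fi aV.
Qed.

(** A quotient of finite length touches H^0 and H^1 only. The torsion grows by at most the length of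
    Z, and the dual of H^1 of Y embeds in that of X with a cokernel of finite length. *)
Lemma hd_flen_quot X Y Z (f : {linear X -> Y}) (g : {linear Y -> Z}) : ses f g -> acc Y -> flen Z ->
  hd Y <= hd X + (module_length Z)%:Z.
Proof.
move=> s aY fZ; have [fi fg gg] := s; have aX := acc_inj fi aY.
have dE := dim_flen_quot st s aY fZ.
have [d0|d0] := posnP (module_dim Y).
  have fY := (dim0P st aY).1 d0; have [fX _] := (ses_flen s).1 fY.
  by rewrite !hd_flen // (ses_len s fY) PoszD.
rewrite !hd_dimS ?dE // (e0_flen_quot st s aY fZ d0) -addrA lerD2l.
have [F [G [Dl [F0 FG GD DF _]]]] := long_exact m res s.
have HZ j (h : H j.+1 Z) : h = 0 by exact: (flen_coh0 m_local aA m_complete E_env).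
have [fZ0 lZ0] := coh0_len (flen_acc fZ).
have t0E : (t0 Y <= t0 X + module_length Z)%N.
  have [fY lY] := coh0_len aY; have [fX lX] := coh0_len aX.
  have HK := ker_submodule (G 0%N).
  have s1 := ses_subquot HK; rewrite -lY (ses_len s1 fY); apply: leq_add.
    have [|F' F'E] := @submod_corestrict A _ _ (F 0%N) (ker (G 0%N)) HK.
      by move=> x; apply/FG; exists x.
    have F's : onto F'.
      move=> z; have /FG [x xE] := submod_valP HK z.
      by exists x; apply: val_inj; rewrite F'E.
    by rewrite -lX; have [] := surj_len F's fX.
  have [//|G' G'E] := @quotmod_lift A _ _ (ker (G 0%N)) (G 0%N).
  have G'i : inj0 G'.
    by move=> q; have [y <-] := surj_qpi q; rewrite G'E => Gy; exact/(ker_qpi HK).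
  by have [_ le1 _] := inj_len G'i fZ0; rewrite -(t0_flen fZ) -lZ0.
have i2 j : hd (DC j.+2 Y) = hd (DC j.+2 X).
  apply: hd_iso; first exact: accDC.
  apply: (dual_iso Einj); exists (F j.+2); split=> [h /DF [c <-]|h].
    by rewrite (HZ j c) linear0.
  by apply/FG; exact: HZ.
have F1s : onto (F 1%N) by move=> h; apply/FG; exact: HZ.
have le1 : hd (DC 1 Y) <= hd (DC 1 X).
  have [g' [f' s']] := dual_ses Einj (ses_surj F1s).
  apply: (hd_sub_dim1 s'); [exact: accDC| |exact: dim_DC].
  have HK := ker_submodule (F 1%N).
  have [|D' D'E] := @submod_corestrict A _ _ (Dl 0%N) (ker (F 1%N)) HK.
    by move=> x; apply/DF; exists x.
  have D's : onto D'.
    move=> z; have /DF [x xE] := submod_valP HK z.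
    by exists x; apply: val_inj; rewrite D'E.
  have [fK _ _] := surj_len D's fZ0.
  by have [] := dual_len m_local aA E_env fK.
case E1 : (module_dim Y) d0 => [//|s'] _.
rewrite 2!big_ord_recl /= bin0 !mul1r !hd_DC0 // addrAC; apply: lerD; first by rewrite -PoszD lez_nat.
apply: ler_sum => -[[|j] js] _; rewrite /bump /= add1n ler_wpM2l //.
by rewrite i2.
Qed.

Lemma mk_t0 U a : acc U -> superficial Q U a -> flen (submod (@mk A U a)) /\
  (module_length (submod (@mk A U a)) <= t0 U)%N.
Proof.
move=> aU sa; have fK := sup_ker_flen st aU sa; split=> //.
have fT := tors_flen m_local aA aU.
have [|g gE] := @submod_corestrict A U _ (subval (@mk A U a)) _ (tors_submodule m U).
  by move=> z; exact: (tors_lin (subval _) (flen_tors m_local aA fK z)).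
have [] // := @inj_len A _ _ g _ fT.
by move=> z gz; apply: inj0_subval; rewrite -[LHS]gE gz linear0.
Qed.

(* The kernel of a is torsion, and the torsion of U is shorter than hd U unless
   U has finite length. *)
Lemma mk_hd U a : acc U -> superficial Q U a ->
  (module_length (submod (@mk A U a)))%:Z <= hd U /\
  (hd U <= (module_length (submod (@mk A U a)))%:Z ->
     module_dim U = 0%N /\ forall x : U, a *: x = 0).
Proof.
move=> aU sa; have [fK le1] := mk_t0 aU sa.
have [d0|d0] := posnP (module_dim U).
  have fU := (dim0P st aU).1 d0; rewrite hd_flen // !lez_nat.
  have [_ le2 on] := inj_len (inj0_subval (S := @mk A U a)) fU; split=> // le3; split=> // x.
  by have [z <-] := on le3 x; exact: (submod_valP (ker_submodule (@mulm A U a : {linear U -> U})) z).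
have lt := hd_gt_t0 aU d0; have le1' : (module_length (submod (@mk A U a)))%:Z <= (t0 U)%:Z by rewrite lez_nat.
split; first exact: le_trans le1' (ltW lt).
by move=> le2; have := lt_le_trans lt (le_trans le2 le1'); rewrite ltxx.
Qed.

Definition depth_pos X := forall x : X, tors m x -> x = 0.

Lemma hd_DC_mq X n j : acc X -> depth_pos X -> superficial Q X (u n) ->
  superficial Q (DC j X) (u n) -> hd (mq (DC j.+1 X) (u n)) <= hd (DC j.+1 X) ->
  hd (DC j (mq X (u n))) <= hd (DC j.+1 X) + (module_length (submod (@mk A (DC j X) (u n))))%:Z.
Proof.
move=> aX X0 sX sD le1; have reg := sup_regular m_local aA st aX X0 sX.
have [p [q s]] := DC_ses E_env res j reg.
have fK := sup_ker_flen st (accDC j aX) sD.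
apply: le_trans (hd_flen_quot s _ fK) _; last by rewrite lerD2r.
by apply: accDC; exact: acc_quot.
Qed.

(** The kernel of X / aX onto the same quotient of [modt m X] is an image of the torsion of X. *)
Lemma mq_modt X n : acc X -> superficial Q (modt m X) (u n) ->
  hd (mq X (u n)) <= hd (mq (modt m X) (u n)) + (t0 X)%:Z.
Proof.
move=> aX sX; set a := u n; set X' := modt m X; have aX' : acc X' by exact: acc_quot.
have aP : acc (mq X a) by exact: acc_quot.
have HR' := range_submodule (@mulm A X' a : {linear X' -> X'}).
have HR := range_submodule (@mulm A X a : {linear X -> X}).
have [|g gE] := @quot_lin A X X' (qpi (@tors A m X)) (range (@mulm A X a)) (range (@mulm A X' a)) HR'.
  by move=> _ [y _ <-]; exists (qpi (@tors A m X) y) => //; rewrite /mulm [RHS]linearZ.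
have gg : onto g.
  move=> q; have [x' <-] := surj_qpi q; have [x <-] := surj_qpi (S := @tors A m X) x'.
  by exists (qpi _ x); rewrite gE.
have s := ses_surj gg.
have fT := tors_flen m_local aA aX.
have HK := ker_submodule g.
have [|h hE] := @submod_corestrict A _ _ (qpi (range (@mulm A X a : {linear X -> X})) \o subval (@tors A m X)) (ker g) HK.
  move=> z; rewrite /ker /= gE.
  by rewrite ((ker_qpi (tors_submodule m X) _).2 (submod_valP (tors_submodule m X) z)) linear0.
have hs : onto h.
  move=> z; have := submod_valP HK z; rewrite /ker /=; have [x xE] := surj_qpi (\val z).
  rewrite -xE gE => /(ker_qpi HR') [x' _ E1]; have [y yE] := surj_qpi (S := @tors A m X) x'.
  have Tx : tors m (x - a *: y).
    apply/(ker_qpi (tors_submodule m X)); rewrite linearB linearZ /= yE -E1.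
    by rewrite /mulm subrr.
  have [w wE] := submod_mem (tors_submodule m X) Tx; exists w; apply: val_inj.
  rewrite hE /= wE -xE; apply/(eq_pi_sub HR).
  by exists (- y) => //; rewrite addrAC subrr sub0r; exact: scalerN.
have [fK le1 _] := surj_len hs fT.
by rewrite (hd_flen_sub s aP fK) lerD2l lez_nat.
Qed.

(** Without torsion e_0 survives in dimension at least two. The induction hypothesis for the duals
    [DC j.+1], of smaller dimension, bounds each dual of the quotient by two consecutive duals of X,
    and Pascal's rule adds these bounds up. *)
Theorem hd_mq X : acc X -> exists N, forall n, (N <= n)%N -> hd (mq X (u n)) <= hd X.
Proof.
have [k] := ubnP (module_dim X); elim: k X => // k IH X dk aX.
have [d0|d0] := posnP (module_dim X).
  have fX := (dim0P st aX).1 d0; exists 0%N => n _.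
  have [fP le1 _] := surj_len (surj_qpi (S := range (@mulm A X (u n) : {linear X -> X}))) fX.
  by rewrite !hd_flen // lez_nat.
set X' := modt m X; have aX' : acc X' by exact: acc_quot.
have X'0 : depth_pos X' by move=> x; exact: (modt_tors m_local aA).
have dE : module_dim X = module_dim X'.
  exact: (dim_flen_sub st (ses_subquot (tors_submodule m X)) aX (tors_flen m_local aA aX)).
have [N1 HN1] := superficial_generic (st_gs st) (st_r st) (st_u st) aX'.
have [N2 HN2] : exists N, forall n, (N <= n)%N -> forall j, (j < (module_dim X).-1)%N ->
    superficial Q (DC j X') (u n) /\ hd (mq (DC j.+1 X') (u n)) <= hd (DC j.+1 X').
  apply: eventually_forall => j jd.
  have [Na HNa] := superficial_generic (st_gs st) (st_r st) (st_u st) (accDC j aX').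
  have [||Nb HNb] := IH (DC j.+1 X'); [|exact: accDC|].
    by apply: leq_ltn_trans (dim_DC _ aX') _; rewrite ltn_predRL in jd; apply: leq_trans jd _.
  exists (maxn Na Nb) => n; rewrite geq_max => /andP [/HNa ? /HNb ?]; by split.
exists (maxn N1 N2) => n; rewrite geq_max => /andP [/HN1 s1 /HN2 s2].
apply: le_trans (mq_modt aX s1) _; rewrite (hd_modt aX) lerD2r -/X'.
have Qa := mem_u st n; have dq := dim_mq st aX' Qa s1; rewrite -dE in dq.
have aP : acc (mq X' (u n)) by exact: acc_quot.
case E1 : (module_dim X) d0 => [//|t] _; have {}dq : module_dim (mq X' (u n)) = t.
  by apply/eqP; rewrite -eqSS dq ?E1.
rewrite [X in _ <= X]hd_dimS // -?dE ?E1 //.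
case: t E1 dq => [|t] E1 dq.
  (* In dimension one the quotient has finite length, equal to e_0 because u_n is regular. *)
  have fP := (dim0P st aP).1 dq.
  rewrite hd_flen // (@hc_mq_last _ _ _ _ _ _ st X' (u n) 0) // -?dE ?E1 //.
  rewrite (hc_dim0 st) // expr0 mul1r big_ord_recl big_ord0 /= mul1r addr0 hd_DC0 // (t0_0 X'0) addr0.
  have [_ le1] := mk_t0 aX' s1; move: le1; rewrite (t0_0 X'0) leqn0 => /eqP ->.
  by rewrite subr0.
rewrite hd_dimS // dq // (@hc_mq _ _ _ _ _ _ st X' (u n) 0) // -?dE ?E1 // lerD2l /=.
rewrite -(pascal_sum t (fun j => hd (DC j X'))); apply: ler_sum => j _; rewrite ler_wpM2l //.
have [|sD le1] := s2 j; first by rewrite E1.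
apply: le_trans (hd_DC_mq aX' X'0 s1 sD le1) _; rewrite lerD2l.
by have [] := mk_hd (accDC j aX') sD.
Qed.

Theorem hd_DC_generic X J : acc X -> depth_pos X ->
  exists N, forall n, (N <= n)%N -> superficial Q X (u n) /\ forall j, (j < J)%N ->
    superficial Q (DC j X) (u n) /\
    hd (DC j (mq X (u n))) <= hd (DC j.+1 X) + hd (DC j X) /\
    (hd (DC j.+1 X) + hd (DC j X) <= hd (DC j (mq X (u n))) ->
      module_dim (DC j X) = 0%N /\ forall x : DC j X, u n *: x = 0).
Proof.
move=> aX X0; have [N1 HN1] := superficial_generic (st_gs st) (st_r st) (st_u st) aX.
have [N2 HN2] : exists N, forall n, (N <= n)%N -> forall j, (j < J)%N ->
    superficial Q (DC j X) (u n) /\ hd (mq (DC j.+1 X) (u n)) <= hd (DC j.+1 X).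
  apply: eventually_forall => j jd.
  have [Na HNa] := superficial_generic (st_gs st) (st_r st) (st_u st) (accDC j aX).
  have [Nb HNb] := hd_mq (accDC j.+1 aX).
  exists (maxn Na Nb) => n; rewrite geq_max => /andP [/HNa ? /HNb ?]; by split.
exists (maxn N1 N2) => n; rewrite geq_max => /andP [/HN1 s1 /HN2 s2]; split=> // j jJ.
have [sD le1] := s2 j jJ; have le2 := hd_DC_mq aX X0 s1 sD le1.
have [le3 H3] := mk_hd (accDC j aX) sD; split=> //; split.
  by apply: le_trans le2 _; rewrite lerD2l.
by move=> le4; apply: H3; have := le_trans le4 le2; rewrite lerD2l.
Qed.

End HomologicalDegree.

(** * d-sequences and unmixed modules *)

Section DSequences.
Variables (A : comNzRingType) (Q : set A).
Implicit Types X Y : lmodType A.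

(* l is a d-sequence on X / S, as a condition on X itself. *)
Fixpoint dsq X (S : set X) (l : seq A) : Prop :=
  if l is a :: l' then
    (forall c x, c \in l -> S ((a * c) *: x) -> S (c *: x)) /\
    dsq (addS S (range (@mulm A X a : {linear X -> X}))) l'
  else True.

Local Notation rg X a := (range (@mulm A X a : {linear X -> X})).

Lemma rg_submodule X a : is_submodule (rg X a).
Proof. exact: range_submodule. Qed.

(** The conditions of a d-sequence concern products c x with c in Q, that is elements of QX, on
    which S and [S'] agree. *)
Lemma dsq_transfer X (S S' : set X) l : is_submodule S' -> S `<=` S' ->
  (forall x, S' x -> pw Q 1 x -> S x) -> (forall c, c \in l -> Q c) -> dsq S' l -> dsq S l.
Proof.
elim: l S S' => [//|a l IH] S S' HS' SS H lQ /= [H1 H2]; split.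
  move=> c x cl /SS /(H1 c x cl) Sc; apply: H => //; apply: pwS_mem; first exact: lQ.
  exact: pw0.
have Qa : Q a by apply: lQ; rewrite mem_head.
apply: IH H2.
- by apply: addS_submodule => //; exact: rg_submodule.
- by apply: addSS.
- move=> _ [s [_ [Ss [y _ <-] ->]]] Qx; exists s, (mulm a y); split=> //.
  have Qy : pw Q 1 (mulm a y) by apply: pwS_mem => //; exact: pw0.
  by apply: H => //; rewrite -[s](addrK (mulm a y)); exact: (submodB (pw_submodule Q X 1)).
- by move=> c cl; apply: lQ; rewrite inE cl orbT.
Qed.

Lemma dsq_pre X Y (f : {linear X -> Y}) (T : set Y) l : onto f -> is_submodule T ->
  dsq T l -> dsq (f @^-1` T) l.
Proof.
move=> fs; elim: l T => [//|a l IH] T HT /= [H1 H2]; split.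
  by move=> c x cl; rewrite /= !linearZ /=; exact: H1.
have HT' : is_submodule (addS T (rg Y a)) by apply: addS_submodule => //; exact: rg_submodule.
have := IH _ HT' H2; congr dsq; apply/seteqP; split=> x /=.
  move=> [t [_ [Tt [y _ <-] E]]]; have [z zE] := fs y.
  exists (x - mulm a z), (mulm a z); split; [|by exists z|by rewrite subrK].
  by rewrite /= linearB E /mulm linearZ /= zE addrK.
move=> [s [_ [Ts [y _ <-] ->]]]; exists (f s), (mulm a (f y)); split=> //.
by rewrite linearD /mulm linearZ.
Qed.

(* Peel off the last component c y of x: c^2 y lies in the base, hence so does c y. *)
Lemma dsq_descend X (S : set X) l x : is_submodule S -> dsq S l ->
  (forall c, c \in l -> S (c *: x)) -> addS S (mulS l setT) x -> S x.
Proof.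
elim: l S x => [|a l IH] S x HS /=; first by move=> _ _ [s [_ [Ss -> ->]]]; rewrite addr0.
move=> [H1 H2] H [s [_ [Ss [_ [t [[y _ <-] lt ->]] xE]]]]; subst x.
have HS' : is_submodule (addS S (rg X a)) by apply: addS_submodule => //; exact: rg_submodule.
have : addS S (rg X a) (s + (a *: y + t)).
  apply: (IH _ _ HS' H2).
    by move=> c cl; apply: sub_addSl; [exact: rg_submodule|apply: H; rewrite inE cl orbT].
  exists (s + a *: y), t; split=> //; last by rewrite addrA.
  by exists s, (a *: y); split=> //; exists y.
move=> [s' [_ [Ss' [z _ <-] E]]]; rewrite E; apply: (submodD HS) => //.
apply: H1; first exact: mem_head.
have := H a (mem_head _ _); rewrite E scalerDr /mulm scalerA => Sa.
by rewrite -[_ *: z](addKr (a *: s')); apply: (submodD HS) => //; apply: (submodN HS); exact: submodZ.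
Qed.

(* Huneke's argument: descending induction on the prefix p of the d-sequence p, l. *)
Lemma dsq_filter X p l : dsq (mulS p (@setT X)) l -> (forall c, c \in p ++ l -> Q c) ->
  (forall n, pw Q n.+1 `<=` addS (mulS p (@pw A Q X n)) (mulS l (pw Q n))) ->
  forall n (x : X), mulS p setT x -> pw Q n.+1 x -> mulS p (pw Q n) x.
Proof.
elim: l p => [|a l IH] p /=.
  by move=> _ _ H n x _ /H [y [_ [py -> ->]]]; rewrite addr0.
move=> [H1 H2] lQ H; have Tp : is_submodule (mulS p (@setT X)).
  by apply: mulS_submodule; exact: submodule_setT.
have HP n : is_submodule (mulS p (@pw A Q X n)) by apply: mulS_submodule; exact: pw_submodule.
have Qa : Q a by apply: lQ; rewrite mem_cat mem_head orbT.
have pe : mulS (a :: p) (@setT X) = addS (mulS p setT) (rg X a).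
  apply/seteqP; split=> x /= [y [z [Hy Hz ->]]]; exists z, y; split=> //; exact: addrC.
have IHa : forall n (x : X), mulS (a :: p) setT x -> pw Q n.+1 x -> mulS (a :: p) (@pw A Q X n) x.
  apply: IH; first by rewrite pe.
    by move=> c; rewrite mem_cat inE -orbA => cl; apply: lQ; rewrite mem_cat inE orbCA.
  move=> n x /H [y [_ [py [s [t [as_ lt ->]] ->]]]]; exists (s + y), t; split=> //.
    by exists s, y.
  by rewrite addrA [y + s]addrC.
elim=> [|n IHn] x px Qx.
  by apply: (mulSS _ _ px) => [|z _]; [exact: pw_submodule|exact: pw0].
have : mulS (a :: p) (@pw A Q X n.+1) x.
  by apply: IHa => //; rewrite pe; apply: sub_addSl => //; exact: rg_submodule.
move=> [_ [y [[z Qz <-] py xE]]]; rewrite xE; apply: (submodD (HP _)) => //.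
have Sz : mulS p setT (a *: z).
  rewrite -[_ *: z](addrK y) -xE; apply: (submodB Tp) => //.
  by apply: (mulSS _ _ py) => //; exact: submodule_setT.
(* A multiple of z by any later element lies in the span of p, and z lies in QX; by [dsq_descend] z
   itself is in that span, so the induction on n applies to it. *)
have pz : mulS p setT z.
  apply: (@dsq_descend X _ (a :: l)) => //=.
  + move=> c cl; apply: H1 => //; rewrite mulrC -scalerA; exact: (submodZ Tp).
  + have /H [u1 [v1 [pu av ->]]] : pw Q 1 z by apply: pw_le Qz.
    exists u1, v1; split=> //.
      by apply: (mulSS _ _ pu) => //; exact: submodule_setT.
    by apply: (@mulSS A X (a :: l) _ _ _ _ _ av) => //; exact: submodule_setT.
apply: (mulS_min (S := [set w | mulS p (pw Q n.+1) (a *: w)]) _ _ (IHn z pz Qz)) => [|c w cp Qw].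
  exact: (scale_submodule a (HP n.+1)).
rewrite /= scalerA mulrC -scalerA; apply: mulS_mem => //; first exact: pw_submodule.
exact: pwS_mem.
Qed.

Lemma dsq_nth X (S : set X) l i j x : is_submodule S -> dsq S l -> (i <= j < size l)%N ->
  addS S (mulS (take i l) setT) ((nth 0 l i * nth 0 l j) *: x) ->
  addS S (mulS (take i l) setT) (nth 0 l j *: x).
Proof.
elim: i j S l => [|i IH] j S [|a l] HS //=; rewrite ?andbF //.
  move=> [H1 _] jl; have E (z : X) : addS S [set 0] z <-> S z.
    split=> [[s [_ [Ss -> ->]]]|Sz]; first by rewrite addr0.
    by exists z, 0; rewrite addr0.
  by move=> /E Sx; apply/E; apply: H1 Sx; exact: (mem_nth 0 (s := a :: l)).
case: j => [//|j] [_ H2]; rewrite !ltnS => ij /=.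
have E : addS S (addS (scS a setT) (mulS (take i l) setT)) = addS (addS S (rg X a)) (mulS (take i l) setT).
  apply/seteqP; split=> z.
    move=> [s [_ [Ss [b [c [Hb Hc ->]] ->]]]]; exists (s + b), c; split=> //; last by rewrite addrA.
    by exists s, b.
  move=> [_ [c [[s [b [Ss Hb ->]]] Hc ->]]]; exists s, (b + c); split=> //; last by rewrite addrA.
  by exists b, c.
by rewrite E; apply: IH => //; apply: addS_submodule => //; exact: rg_submodule.
Qed.

Lemma dsq_d_sequence X d (a : 'I_d -> A) (l : seq A) : size l = d ->
  (forall i : 'I_d, a i = nth 0 l i) -> dsq [set (0 : X)] l -> d_sequence X a.
Proof.
move=> sl aE dl i j ij N_i; have HN : is_submodule N_i by exact: ideal_smul_submodule.
have NE : N_i = addS [set 0] (mulS (take i l) setT).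
  apply/seteqP; split.
    apply: ideal_smul_min => [|b x].
      by apply: addS_submodule; [exact: submodule0|apply: mulS_submodule; exact: submodule_setT].
    have HM : is_submodule (mulS (take i l) (@setT X)) by apply: mulS_submodule; exact: submodule_setT.
    suff H : ideal_span [set a k | k in [set k : 'I_d | (k < i)%N]] `<=`
        [set b | mulS (take i l) (@setT X) (b *: x)].
      by move=> /H /=; apply: sub_addSr; exact: submodule0.
    apply: (@submod_span_min A A^o); first exact: colon_submodule.
    move=> _ [k ki <-] /=; apply: mulS_mem => //; first exact: submodule_setT.
    rewrite aE -(nth_take 0 ki); apply: mem_nth.
    by rewrite size_take sl ltn_ord.
  apply: addS_sub => //; first by move=> _ ->; exact: submod0.
  apply: mulS_min => // b x /(nthP 0) [k]; rewrite size_take sl ltn_ord => ki <- _.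
  apply: ideal_smul_mem; apply: sub_submod_span; rewrite nth_take //.
  have kd : (k < d)%N by apply: ltn_trans ki (ltn_ord i).
  by exists (Ordinal kd).
apply/seteqP; split=> x /=.
  rewrite NE !aE; apply: dsq_nth => //; first exact: submodule0.
  by rewrite ij sl ltn_ord.
by rewrite -scalerA => Nx; exact: (submodZ HN).
Qed.

End DSequences.

(** * Dual modules of an unmixed module *)

Section Unmixed.
Variables (A : comNzRingType) (m Q : set A) (gs : seq A) (r : nat) (u : nat -> A) (E : lmodType A).
Hypothesis st : setting m Q gs r u.
Hypothesis m_complete : adically_complete m.
Hypothesis E_env : injective_envelope (cyclic_module m) E.
Variables (res : forall N : lmodType A, injective_resolution N).
Implicit Types X : lmodType A.
Local Notation DC := (@DC A m E res).
Let m_local := st_local st.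
Let aA := st_acc st.

(** A maximal annihilator among those of nonzero multiples of z is prime. *)
Lemma associated_prime_above X (z : X) (K : set A) : z <> 0 -> (forall a, K a -> a *: z = 0) ->
  exists2 p, associated_prime X p & K `<=` p.
Proof.
move=> z0 Kz; pose ann (b : A) : set A^o := [set a | a *: (b *: z) = 0].
have annS b : is_submodule (ann b) by exact: (colon_submodule (b *: z) (@submodule0 A X)).
have [|p [_ [b [bz ->]] pmax]] := @acc_max A A^o (fun S => exists b : A, b *: z <> 0 /\ S = ann b) (ann 1) aA (annS 1).
  by exists 1; rewrite scale1r.
exists (ann b); last first.
  by move=> a /Kz az; rewrite /ann /= scalerA mulrC -scalerA az scaler0.
split; last by exists (b *: z).
apply: prime_intro => //; first by rewrite /ann /= scale1r.
move=> x y xy; have [|yb] := pselect (y *: (b *: z) = 0); [by right|left].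
apply: (pmax (ann (y * b))) => //.
- by exists (y * b); split=> //; rewrite -scalerA.
- by move=> a; rewrite /ann /= => az; rewrite -scalerA scalerA mulrC -scalerA az scaler0.
- by rewrite /ann /= -scalerA scalerA.
Qed.

Lemma dim_line X (z : X) : module_dim (submod (line z)) = krull_dim [set a : A | a *: z = 0].
Proof.
rewrite /module_dim; congr krull_dim; apply/seteqP; split=> a /=.
  have [w wE] : exists w : submod (line z), \val w = z.
    by apply: (submod_mem (line_submodule z)); exists 1; rewrite ?scale1r.
  by move=> /(_ w) /(congr1 (subval (line z))); rewrite linearZ linear0 /= wE.
move=> az w; apply: inj0_subval; rewrite linearZ /=.
have [b _ <-] := submod_valP (line_submodule z) w.
by rewrite scalerA mulrC -scalerA az scaler0.
Qed.

Lemma unmixed_le X (z : X) (K : set A) : unmixed X -> z <> 0 -> (forall a, K a -> a *: z = 0) ->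
  forall Y, K = annihilator Y -> (module_dim X <= module_dim Y)%N.
Proof.
move=> uX z0 Kz Y KE; have [p ap Kp] := associated_prime_above z0 Kz.
have [_ [x pE]] := ap; rewrite -(uX p ap) pE -dim_line.
apply: (dim_mono st) => a; rewrite -KE => /Kp; rewrite pE /= => ax w.
apply: inj0_subval; rewrite linearZ /=; have [b _ <-] := submod_valP (line_submodule x) w.
by rewrite scalerA mulrC -scalerA ax scaler0.
Qed.

Lemma unmixed_depth X : acc X -> unmixed X -> (0 < module_dim X)%N -> depth_pos m X.
Proof.
move=> aX uX d0 x tx; apply: contrapT => x0.
have fL : flen (submod (line x)).
  apply: (acc_tors_flen m_local aA (acc_sub aX)) => z.
  apply: (tors_inj (f := subval (line x))); first exact: inj0_subval.
  rewrite /=; have [b _ <-] := submod_valP (line_submodule x) z.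
  exact: (submodZ (tors_submodule m X)).
have := unmixed_le uX x0 (K := annihilator (submod (line x))) _ erefl.
rewrite ((dim0P st (flen_acc fL)).2 fL) leqn0 => H; move: d0; rewrite lt0n H // => a la.
have [w wE] : exists w : submod (line x), \val w = x.
  by apply: (submod_mem (line_submodule x)); exists 1; rewrite ?scale1r.
by have := congr1 (subval (line x)) (la w); rewrite linearZ linear0 /= wE.
Qed.

(** The annihilator of [DC j.+1 X] contains a regular element x of X; otherwise it would kill a
    nonzero z and lie in an associated prime of too small dimension. Since x kills it, the dual
    embeds in [DC j] of X / xX, of dimension at most j. *)
Lemma unmixed_dim X j : infinite_set [set: cyclic_module m] -> acc X -> unmixed X ->
  (j.+1 < module_dim X)%N -> (module_dim (DC j.+1 X) <= j)%N.
Proof.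
move=> inf aX uX jd; set Y := DC j.+1 X.
have dY : (module_dim Y <= j.+1)%N by exact: (dim_DC st m_complete E_env).
have [l _ lE] := @acc_fg A A^o _ aA (ann_submodule Y).
have : exists2 x, annihilator Y x & forall z : X, x *: z = 0 -> z = 0.
  (* The extra generator 0 only makes the list nonempty. *)
  have HL : @lspan A A^o (0 :: l) = annihilator Y.
    rewrite -lE; apply/seteqP; split.
      apply: (@lspan_min A A^o); first exact: lspan_submodule.
      move=> b; rewrite inE => /orP [/eqP ->|bl]; first exact: (submod0 (@lspan_submodule A A^o l)).
      exact: (@lspan_mem A A^o).
    apply: (@lspan_min A A^o); first exact: lspan_submodule.
    by move=> b bl; apply: (@lspan_mem A A^o); rewrite inE bl orbT.
  have [||x xY xr] := @exists_regular A m m_local X (0 :: l) inf aX; rewrite ?HL //.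
    move=> z Hz; apply: contrapT => z0.
    by have := unmixed_le uX z0 Hz erefl; rewrite leqNgt (leq_ltn_trans dY jd).
  by exists x => //; rewrite -HL.
move=> [x xY xr]; have [p [_ [pi _ _]]] := DC_ses E_env res j xr.
apply: leq_trans (_ : module_dim (mq Y x) <= _)%N; last first.
  by apply: leq_trans (dim_inj st pi) _; apply: (dim_DC st m_complete E_env); exact: acc_quot.
apply: (dim_mono st) => a Ha y.
have := Ha (qpi _ y); rewrite -linearZ => /(ker_qpi (range_submodule _)) [w _ <-].
exact: xY.
Qed.

End Unmixed.

(** * Reduction modulo a generic element *)

Lemma hval1E e n : hval 1 e n = e 0%N * n.+1%:Z - e 1%N.
Proof.
by rewrite /hval !big_ord_recl big_ord0 /= expr0 expr1 mul1r mulN1r addn0 bin0 mulr1 addr0 addn1 bin1.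
Qed.

Lemma hval2E e n : hval 2 e n = e 0%N * 'C(n + 2, 2)%:Z - e 1%N * n.+1%:Z + e 2%N.
Proof.
rewrite /hval !big_ord_recl big_ord0 /= expr0 expr1 mul1r mulN1r addn0 bin0 mulr1 addr0 addn1 bin1.
by rewrite mulNr addrA sqrrN expr1n mul1r.
Qed.

Section Reduction.
Variables (A : comNzRingType) (m Q : set A) (gs : seq A) (r : nat) (u : nat -> A).
Hypothesis st : setting m Q gs r u.
Implicit Types X Y : lmodType A.
Local Notation e i X := (hilbert_coef Q i X).
Local Notation t0 := (@t0 A m).
Local Notation rg X a := (range (@mulm A X a : {linear X -> X})).
Let m_local := st_local st.
Let aA := st_acc st.

Definition red X (a : A) : lmodType A := modt m (mq X a).

Definition tored X a : {linear X -> red X a} := qpi (@tors A m (mq X a)) \o qpi (rg X a).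

Lemma tored_onto X a : onto (@tored X a).
Proof.
move=> z; have [y <-] := surj_qpi (S := @tors A m (mq X a)) z.
by have [x <-] := surj_qpi y; exists x.
Qed.

(* The saturation [aX : m^oo] *)
Definition sat X a : set X := @tored X a @^-1` [set 0].

Lemma satE X a x : @sat X a x <-> tors m (qpi (rg X a) x).
Proof. exact: (ker_qpi (tors_submodule m (mq X a))). Qed.

Lemma sat_submodule X a : is_submodule (@sat X a).
Proof. exact: (preimage_submodule (tored X a) (@submodule0 A _)). Qed.

Lemma rg_sat X a : rg X a `<=` @sat X a.
Proof.
move=> x Rx; apply/satE; rewrite ((ker_qpi (rg_submodule X a) x).2 Rx).
exact: (submod0 (tors_submodule m _)).
Qed.

Definition good X n := superficial Q X (u n).

(** With a = u_n: the torsion of X / aX meets Q(X / aX) in zero, expressed in X. *)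
Definition inter X n := forall x : X, @sat X (u n) x -> pw Q 1 x -> rg X (u n) x.

Section OneStep.
Variables (X : lmodType A) (n : nat).
Hypotheses (aX : acc X) (X0 : depth_pos m X) (sX : good X n) (d0 : (0 < module_dim X)%N).
Local Notation a := (u n).
Local Notation P := (mq X a).
Local Notation X' := (red X a).

Lemma good_regular (x : X) : a *: x = 0 -> x = 0.
Proof. exact: (sup_regular m_local aA st aX X0 sX). Qed.

Lemma acc_mq : acc P.
Proof. exact: acc_quot. Qed.

Lemma acc_red : acc X'.
Proof. by apply: acc_quot; exact: acc_mq. Qed.

Lemma red_depth : depth_pos m X'.
Proof. by move=> x; apply: (modt_tors m_local aA); exact: acc_mq. Qed.

Lemma dim_red_mq : module_dim X' = module_dim P.
Proof.
apply/esym; apply: (dim_flen_sub st (ses_subquot (tors_submodule m P)) acc_mq).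
by apply: (tors_flen m_local aA); exact: acc_mq.
Qed.

Lemma dim_red : (module_dim X').+1 = module_dim X.
Proof. by rewrite dim_red_mq; apply: (dim_mq st) => //; exact: (mem_u st). Qed.

Lemma mk0 : module_length (submod (@mk A X a)) = 0%N.
Proof.
have [] // := @trivial_flen A (submod (@mk A X a)) => z.
apply: inj0_subval; apply: good_regular.
exact: (submod_valP (ker_submodule (@mulm A X a : {linear X -> X})) z).
Qed.

Lemma e_mq i : (i < module_dim X)%N -> e i X = e i P.
Proof.
rewrite leq_eqVlt => /orP [/eqP E1|lt].
  by rewrite (hc_mq_last st aX (mem_u st n) sX E1) mk0 mulr0 subr0.
exact: (hc_mq st aX (mem_u st n) sX lt).
Qed.

Lemma e_red i : (i.+1 < module_dim X)%N -> e i X = e i X'.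
Proof.
move=> lt; rewrite e_mq; last exact: ltnW.
have [H _] := hc_flen_sub st (ses_subquot (tors_submodule m P)) acc_mq (tors_flen m_local aA acc_mq).
by apply: H; rewrite -dim_red_mq -ltnS dim_red.
Qed.

Lemma e_red_last i : i.+1 = module_dim X -> e i X = e i X' + (-1) ^+ i * (t0 P)%:Z.
Proof.
move=> iE; rewrite e_mq ?iE //.
have [_] := hc_flen_sub st (ses_subquot (tors_submodule m P)) acc_mq (tors_flen m_local aA acc_mq).
by have -> : module_dim P = i by apply/eqP; rewrite -dim_red_mq -eqSS dim_red iE.
Qed.

Lemma hl1_mq : hl Q X 1 = hl Q P 1.
Proof.
rewrite (hl_mq st a 1 aX) -[RHS]add0n; congr (_ + _)%N.
have [] // := @trivial_flen A (quotmod (@mulm A X a @^-1` @pw A Q X 1)) => z.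
have [x <-] := surj_qpi z.
apply/(ker_qpi (preimage_submodule (@mulm A X a : {linear X -> X}) (pw_submodule Q X 1))).
by apply: pwS_mem; [exact: (mem_u st)|exact: pw0].
Qed.

Let Hpre k : is_submodule (@mulm A X a @^-1` @pw A Q X k).
Proof. exact: (preimage_submodule (@mulm A X a : {linear X -> X}) (pw_submodule Q X k)). Qed.

Let sub_pre k : @pw A Q X k `<=` @mulm A X a @^-1` @pw A Q X k.+1.
Proof. by move=> x Qx; apply: pwS_mem => //; exact: (mem_u st). Qed.

Lemma hl_step_le k : (hl Q X k.+1 <= hl Q X k + hl Q P k.+1)%N.
Proof.
rewrite (hl_mq st a k.+1 aX) leq_add2r.
by have [] := col_sub (pw_submodule Q X k) (Hpre k.+1) (@sub_pre k) (flen_quot_pw st k aX).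
Qed.

Lemma hl_step_eq k : (forall x : X, pw Q k.+1 (a *: x) -> pw Q k x) ->
  hl Q X k.+1 = (hl Q X k + hl Q P k.+1)%N.
Proof.
move=> H; rewrite (hl_mq st a k.+1 aX); congr (_ + _)%N; rewrite /hl -/(colen _).
by congr colen; apply/seteqP; split; [exact: H|exact: sub_pre].
Qed.

Let W := submod (@tors A m P).
Let sv : {linear W -> P} := subval (@tors A m P).
Let HW k : is_submodule (sv @^-1` @pw A Q P k).
Proof. exact: (preimage_submodule sv (pw_submodule Q P k)). Qed.

Let hlP k : hl Q P k = (colen (sv @^-1` @pw A Q P k) + hl Q X' k)%N.
Proof. exact: (col_flen_ses st k (ses_subquot (tors_submodule m P)) acc_mq). Qed.

Let fW : flen W.
Proof. by apply: (tors_flen m_local aA); exact: acc_mq. Qed.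

Lemma hl_red_le k : (hl Q P k <= hl Q X' k + t0 P)%N.
Proof.
rewrite hlP addnC leq_add2l.
by have [_ le1 _] := surj_len (surj_qpi (S := sv @^-1` @pw A Q P k)) fW.
Qed.

(** Equality in [hl_red_le] for k = 1 means that the torsion W of P embeds in P / QP. *)
Lemma hl_red_inter : (hl Q X' 1 + t0 P <= hl Q P 1)%N -> inter X n.
Proof.
rewrite hlP addnC leq_add2r => le1 x /satE tx Qx.
have [_ _ H] := surj_len (surj_qpi (S := sv @^-1` @pw A Q P 1)) fW.
have [w wE] := submod_mem (tors_submodule m P) tx.
apply/(ker_qpi (rg_submodule X a)); rewrite -wE.
suff -> : w = 0 by [].
apply: (H le1); apply/(ker_qpi (HW 1)); rewrite /= wE; exact: pw_lin.
Qed.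

Lemma inter_hl k : inter X n -> hl Q P k.+1 = (hl Q X' k.+1 + t0 P)%N.
Proof.
move=> Hi.
have g0 (w : W) : (sv @^-1` @pw A Q P k.+1) w -> w = 0.
  move=> Qw; apply: inj0_subval; rewrite -/sv.
  have /(pw_onto (surj_qpi (S := rg X a))) [x Qx xE] : pw Q 1 (sv w) by apply: pw_le Qw.
  rewrite -xE; apply/(ker_qpi (rg_submodule X a)); apply: Hi => //; apply/satE; rewrite xE.
  exact: (submod_valP (tors_submodule m P) w).
have WI : iso W (quotmod (sv @^-1` @pw A Q P k.+1)).
  exists (qpi (sv @^-1` @pw A Q P k.+1)); split; last exact: surj_qpi.
  by move=> w /(ker_qpi (HW k.+1)); exact: g0.
by have [_ E1] := iso_flen WI fW; rewrite hlP addnC; congr (_ + _)%N; exact: E1.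
Qed.

End OneStep.

(** I holds the indices already divided out; any r - |I| other terms then generate Q on X. *)
Definition killed (I : seq nat) X := forall i, i \in I -> forall x : X, u i *: x = 0.

Lemma killed_red I X n : killed I X -> killed (n :: I) (red X (u n)).
Proof.
move=> kI i iI z; have [x <-] := tored_onto z; rewrite -linearZ /=.
move: iI; rewrite inE => /orP [/eqP ->|/kI ->]; last by rewrite !linear0.
suff: @sat X (u n) (u n *: x) by [].
by apply: rg_sat; exists x.
Qed.

Lemma pw_gen I J X k : killed I X -> uniq (I ++ J) -> size (I ++ J) = r ->
  @pw A Q X k.+1 `<=` mulS (map u J) (pw Q k).
Proof.
move=> kI uI sI; have HS : is_submodule (mulS (map u J) (@pw A Q X k)).
  by apply: mulS_submodule; exact: pw_submodule.
apply: pwS_min => // q x Qq Qx; apply: (general_position_colon (st_u st) HS uI sI) Qq => i.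
rewrite mem_cat => /orP [iI|iJ]; first by rewrite (kI _ iI); exact: submod0.
by apply: mulS_mem; [exact: pw_submodule|exact: map_f|].
Qed.

(** With default value n, [head n J = n] says that J begins with n or is empty, the latter in
    dimension 0. Allowing every large n as first index is what [sat_inter] relies on. *)
Definition generic_dsq (I : seq nat) X := exists N, forall n, (N <= n)%N ->
  exists J, [/\ uniq (I ++ J), size J = module_dim X, head n J = n & dsq [set (0 : X)] (map u J)].

Definition concl (I : seq nat) X := [/\
  forall n, (hl Q X n.+1)%:Z = hval (module_dim X) (fun i => e i X) n,
  e (module_dim X) X = 0 & generic_dsq I X].

Lemma concl_dim0 I X : acc X -> depth_pos m X -> uniq I -> module_dim X = 0%N -> concl I X.
Proof.
move=> aX X0 uI d0; have fX := (dim0P st aX).1 d0.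
have Xz (x : X) : x = 0 by apply: X0; exact: (flen_tors m_local aA fX).
have e00 : e 0 X = 0 by rewrite (hc_dim0 st) // (trivial_flen Xz).2.
split; rewrite ?d0 //.
  move=> n; rewrite hval0 e00 /hl.
  have [] // := @trivial_flen A (quotmod (@pw A Q X n.+1)) => [z|_ -> //].
  by have [x <-] := surj_qpi z; rewrite (Xz x) linear0.
by exists 0%N => n _; exists [::]; rewrite cats0.
Qed.

(** [inter] lifts the d-sequences of the reduction, preceded by u_n. For such a sequence
    [dsq_filter] gives Q^(k+1) X : u_n = Q^k X for every k, so the Hilbert function of X is the sum
    of that of X / u_n X from the start, not only for large k. *)
Lemma concl_step I X N : acc X -> depth_pos m X -> (0 < module_dim X)%N -> uniq I ->
  (size I + module_dim X = r)%N -> killed I X ->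
  (forall n, (N <= n)%N -> [/\ good X n, n \notin I, inter X n & concl (n :: I) (red X (u n))]) ->
  concl I X.
Proof.
move=> aX X0 d0 uI sI kI H.
have D n : (N <= n)%N -> exists J, [/\ uniq (I ++ J), size J = module_dim X,
    head n J = n & dsq [set (0 : X)] (map u J)] /\ exists J', J = n :: J'.
  move=> Nn; have [sX nI Hi [_ _ [N' HN']]] := H n Nn.
  have [J [uJ sJ _ dJ]] := HN' N' (leqnn _); exists (n :: J); split; last by exists J.
  split=> //.
  - by rewrite -[n :: J]cat1s uniq_catCA.
  - by rewrite /= sJ dim_red.
  - split.
      move=> c x; rewrite -scalerA => cl /(good_regular aX X0 sX).
      by move=> ->.
    apply: (@dsq_transfer A Q X _ (@sat X (u n))).
    + exact: sat_submodule.
    + apply: addS_sub; first exact: sat_submodule.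
        by move=> _ ->; exact: (submod0 (@sat_submodule X (u n))).
      exact: rg_sat.
    + by move=> x sx Qx; apply: sub_addSr; [exact: submodule0|exact: Hi].
    + by move=> _ /mapP [i _ ->]; exact: (mem_u st).
    + by apply: dsq_pre => //; [exact: tored_onto|exact: submodule0].
have [sX nI Hi [H1 H2 _]] := H N (leqnn N).
have dE := dim_red aX sX d0; set s := module_dim (red X (u N)) in dE H1 H2.
have hP n : (hl Q (mq X (u N)) n.+1)%:Z = hval s (fun i => e i X) n.
  rewrite (inter_hl aX n Hi) PoszD H1 -/s -hval_addc; apply: hval_eq => i.
  rewrite leq_eqVlt => /orP [/eqP ->|lt]; first by rewrite eqxx (e_red_last aX X0 sX d0).
  by rewrite ltn_eqF // (e_red aX X0 sX d0) // -dE.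
have Hreg k (x : X) : pw Q k.+1 (u N *: x) -> pw Q k x.
  move=> Qx; have [J [[uJ sJ _ dJ] [J' JE]]] := D N (leqnn N); subst J.
  have rgE : mulS [:: u N] (@setT X) = addS [set 0] (rg X (u N)).
    apply/seteqP; split=> z /= [y [w [Hy Hw ->]]]; exists w, y; split=> //; exact: addrC.
  suff : mulS [:: u N] (@pw A Q X k) (u N *: x).
    move=> [_ [z [[w Qw <-] -> /eqP]]]; rewrite addr0 -subr_eq0 -scalerBr => /eqP.
    by move=> /(good_regular aX X0 sX) /eqP; rewrite subr_eq0 => /eqP ->.
  apply: (@dsq_filter A Q X [:: u N] (map u J') _ _ _ k (u N *: x) _ Qx).
  - by rewrite rgE; have [] := dJ.
  - by move=> c; rewrite /= inE => /orP [/eqP ->|/mapP [i _ ->]]; exact: (mem_u st).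
  - move=> j y /(pw_gen kI uJ); rewrite size_cat sJ sI => /(_ erefl) [v [w [Hv Hw ->]]].
    by exists v, w; split=> //; exists v, 0; rewrite addr0.
  - by apply: mulS_mem; [exact: submodule_setT|exact: mem_head|].
have hX n : (hl Q X n.+2)%:Z - (hl Q X n.+1)%:Z = hval s (fun i => e i X) n.+1.
  by rewrite (hl_step_eq aX (@Hreg n.+1)) PoszD hP addrC addKr.
(* The polynomial is right for large n and has the right differences everywhere, so it is right for
   all n by descending induction. *)
have aE n : (hl Q X n.+1)%:Z = hval (module_dim X) (fun i => e i X) n.
  have [n0 Hn0] := hcP st aX; rewrite -dE in Hn0 *.
  have {Hn0} : forall k, (n0 <= k + n)%N -> (hl Q X n.+1)%:Z = hval s.+1 (fun i => e i X) n.
    move=> k; elim: k n => [|k IH] n kn; first exact: Hn0.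
    have := IH n.+1; rewrite addnS -addSn => /(_ kn) E1.
    have := hX n; rewrite -(hval_diff s (fun i => e i X) n) E1 => /(addrI _) /oppr_inj; exact.
  by move=> /(_ n0); rewrite leq_addr => /(_ isT).
split=> //; last by exists N => n /D [J [HJ _]]; exists J.
(* At n = 0, X and X / u_N X have the same length modulo Q, while their polynomials differ by the
   last coefficient of X up to sign. *)
have := aE 0%N; rewrite (@hl1_mq X N aX) hP.
rewrite -dE hvalS.
have -> : \sum_(i < s.+1) (-1) ^+ i * e i X * 'C(0 + (s - i).+1, (s - i).+1)%:Z = hval s (fun i => e i X) 0.
  by apply: eq_bigr => i _; rewrite !add0n !binn.
by move/eqP; rewrite -subr_eq0 opprD addrA subrr sub0r oppr_eq0 mulf_eq0 signr_eq0 => /eqP.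
Qed.

Lemma good_generic X : acc X -> exists N, forall n, (N <= n)%N -> good X n.
Proof. exact: (superficial_generic (st_gs st) (st_r st) (st_u st)). Qed.

Lemma notin_generic (I : seq nat) : exists N, forall n, (N <= n)%N -> n \notin I.
Proof.
elim: I => [|i I [N HN]]; first by exists 0%N.
exists (maxn i.+1 N) => n; rewrite geq_max inE negb_or => /andP [ni /HN ->].
by rewrite neq_ltn ni orbT.
Qed.

(** All but one of r terms of u kill X, so QX = u_n X and [inter] is immediate. *)
Lemma concl_dim1 I X : acc X -> depth_pos m X -> module_dim X = 1%N -> uniq I ->
  (size I + 1 = r)%N -> killed I X -> concl I X.
Proof.
move=> aX X0 d1 uI sI kI; have d0 : (0 < module_dim X)%N by rewrite d1.
have [N1 H1] := good_generic aX; have [N2 H2] := notin_generic I.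
apply: (@concl_step I X (maxn N1 N2)); rewrite ?d1 // => n; rewrite geq_max => /andP [/H1 sX /H2 nI].
split=> //.
  move=> x _ Qx; have uJ : uniq (I ++ [:: n]) by rewrite cats1 rcons_uniq nI.
  have := pw_gen kI uJ; rewrite size_cat sI => /(_ 0%N erefl x Qx).
  by move=> [_ [_ [[y _ <-] -> ->]]]; exists y; rewrite ?addr0.
have dX' := dim_red aX sX d0; rewrite d1 in dX'; case: dX' => dX'.
apply: concl_dim0 => //; [exact: acc_red|exact: red_depth|by rewrite /= nI].
Qed.

Definition sgenus X : int := (hl Q X 1)%:Z - e 0 X + e 1 X.

Lemma concl_sgenus2 I X : module_dim X = 2%N -> concl I X -> sgenus X = 0 /\ e 2 X = 0.
Proof.
move=> d2 [H1 H2 _]; rewrite d2 in H1 H2; split=> //.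
by rewrite /sgenus H1 hval2E H2 add0n binn !mulr1 addr0 addrAC subrK subrr.
Qed.

(** The reduction has dimension one and vanishing last coefficient. The length of X / QX then falls
    short of e_0 plus the torsion length by some c >= 0, with c = 0 exactly when [inter] holds; both
    -[sgenus] and -e_2 turn out to be at least c. *)
Lemma dim2_inter I X n : acc X -> depth_pos m X -> module_dim X = 2%N -> good X n ->
  concl (n :: I) (red X (u n)) ->
  [/\ sgenus X <= 0, e 2 X <= 0, sgenus X = 0 -> inter X n & e 2 X = 0 -> inter X n].
Proof.
move=> aX X0 d2 sX; have d0 : (0 < module_dim X)%N by rewrite d2.
have dX' := dim_red aX sX d0; rewrite d2 in dX'; case: dX' => dX' [H1 H2 _].
rewrite dX' in H1 H2; set X' := red X (u n) in dX' H1 H2; set P := mq X (u n).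
have e0E : e 0 X = e 0 X' by apply: e_red => //; rewrite d2.
have e1E : e 1 X = e 1 X' - (t0 P)%:Z by rewrite (e_red_last aX X0 sX d0) ?d2 // expr1 mulN1r.
have F0 : (hl Q X 1)%:Z <= e 0 X + (t0 P)%:Z.
  rewrite (hl1_mq n aX) e0E; apply: le_trans (_ : (hl Q X' 1 + t0 P)%N%:Z <= _).
    by rewrite lez_nat; exact: hl_red_le.
  by rewrite PoszD H1 lerD2r hval1E H2 mulr1 subr0.
have I0 : e 0 X + (t0 P)%:Z <= (hl Q X 1)%:Z -> inter X n.
  move=> le1; apply: hl_red_inter => //; rewrite -lez_nat -/P -(hl1_mq n aX); apply: le_trans le1.
  by rewrite PoszD H1 lerD2r e0E hval1E H2 mulr1 subr0.
have gE : sgenus X = (hl Q X 1)%:Z - (e 0 X + (t0 P)%:Z).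
  by rewrite /sgenus e1E H2 sub0r opprD addrA.
(* This is minus the sectional genus. *)
pose c := e 0 X + (t0 P)%:Z - (hl Q X 1)%:Z.
(* The coefficients of X with e_2 replaced by 0: the inequality is propagated from k = 0 without
   knowledge of e_2, which is compared with -c for large k. *)
pose f i := if i is j.+2 then 0 else e i X.
have up k : (hl Q X k.+1)%:Z <= hval 2 f k - c.
  elim: k => [|k IH].
    rewrite hval2E /= e1E H2 add0n binn !mulr1 addr0 sub0r opprK.
    by rewrite /c opprB addrC subrK.
  apply: le_trans (_ : (hl Q X k.+1 + hl Q P k.+2)%N%:Z <= _); first by rewrite lez_nat; exact: hl_step_le.
  have -> : hval 2 f k.+1 - c = hval 2 f k - c + hval 1 f k.+1 by rewrite -(hval_diff 1) [RHS]addrC addrA subrK.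
  rewrite PoszD; apply: lerD => //.
  apply: le_trans (_ : (hl Q X' k.+2 + t0 P)%N%:Z <= _); first by rewrite lez_nat; exact: hl_red_le.
  rewrite PoszD H1 -hval_addc (@hval_eq 1 _ f) // => -[|[|i]] //= _.
  by rewrite e1E expr1 mulN1r.
have e2le : e 2 X <= - c.
  have [n0 /(_ n0 (leqnn _))] := hcP st aX; rewrite d2 => E1.
  by have := up n0; rewrite E1 !hval2E /= addr0 lerD2l.
split.
- by rewrite gE subr_le0.
- by apply: le_trans e2le _; rewrite oppr_le0 /c subr_ge0.
- by rewrite gE => /eqP; rewrite subr_eq0 => /eqP E1; apply: I0; rewrite E1.
- by move=> E1; apply: I0; rewrite E1 oppr_ge0 /c subr_le0 in e2le.
Qed.

End Reduction.

(** * Consequences of the vanishing of Q on a dual module *)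

Section KilledDuals.
Variables (A : comNzRingType) (m Q : set A) (gs : seq A) (r : nat) (u : nat -> A) (E : lmodType A).
Hypothesis st : setting m Q gs r u.
Hypothesis m_complete : adically_complete m.
Hypothesis E_env : injective_envelope (cyclic_module m) E.
Variables (res : forall N : lmodType A, injective_resolution N).
Implicit Types X Y : lmodType A.
Local Notation H j X := (local_cohomology m res j X).
Local Notation DC := (@DC A m E res).
Local Notation hd := (hdeg m E res Q).
Local Notation t0 := (@t0 A m).
Local Notation rg X a := (range (@mulm A X a : {linear X -> X})).
Local Notation killed I X := (killed u I X).
Local Notation good X n := (good Q u X n).
Local Notation inter X n := (@inter A m Q u X n).
Local Notation concl I X := (@concl A Q u I X).
Local Notation sat X a := (@sat A m X a).
Local Notation red X a := (@red A m X a).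
Let m_local := st_local st.
Let aA := st_acc st.

Lemma coh_killed j X q : (forall x : DC j X, q *: x = 0) -> forall h : H j X, q *: h = 0.
Proof.
move=> Hq h; apply: (separates m_local E_env) => f; have [p pE] := dual_lin f.
by rewrite -pE linearZ /= pE -dualZ (Hq f) dual0.
Qed.

(** Since H^0 of X vanishes, the torsion of X / yX embeds in H^1 of X, which q kills along with its
    dual. *)
Lemma sat_killed X y q x : depth_pos m X -> (forall x : X, y *: x = 0 -> x = 0) ->
  (forall z : DC 1 X, q *: z = 0) -> sat X y x -> rg X y (q *: x).
Proof.
move=> X0 yr Hq /satE tx; have [G [Dl [_ GD _]]] := mul_les m res yr.
have [f [fi fs]] := coh0 m res (mq X y).
have [w wE] := submod_mem (tors_submodule m (mq X y)) tx.
have H0 (h : H 0 X) : h = 0.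
  have [g [_ gs']] := coh0 m res X; have [z <-] := gs' h.
  rewrite (_ : z = 0) ?linear0 //; apply: inj0_subval; apply: X0.
  exact: (submod_valP (tors_submodule m X) z).
have Di (h : H 0 (mq X y)) : Dl 0%N h = 0 -> h = 0.
  by move=> /GD [h' <-]; rewrite (H0 h') linear0.
have qw : q *: w = 0.
  by apply: fi; apply: Di; rewrite !linearZ /=; exact: coh_killed.
apply/(ker_qpi (rg_submodule X y)); rewrite linearZ -wE.
by have := congr1 (subval (@tors A m (mq X y))) qw; rewrite linearZ linear0.
Qed.

Lemma tors_of_Q X (z : X) : acc X -> (forall q q', Q q -> Q q' -> q' *: (q *: z) = 0) -> tors m z.
Proof.
move=> aX Hz; have aL : acc (submod (line z)) by exact: acc_sub.
have fL : flen (submod (line z)).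
  apply/(flenP st aL); exists 2%N => w Qw; apply: inj0_subval.
  have Q1 : @pw A Q (submod (line z)) 1 `<=` [set w | forall q, Q q -> q *: subval (line z) w = 0].
    apply: pwS_min.
      apply/submoduleP; split=> [q _|b x y Hx Hy q Qq]; first by rewrite (linear0 (subval (line z))) scaler0.
      by rewrite (linearP (subval (line z))) scalerDr (Hy q Qq) addr0 scalerA mulrC -scalerA (Hx q Qq) scaler0.
    move=> q x Qq _ q' Qq'; have -> : subval (line z) (q *: x) = q *: subval (line z) x by exact: linearZ.
    rewrite /=.
    have [b _ <-] := submod_valP (line_submodule z) x.
    by rewrite !scalerA mulrC -scalerA -[(q' * q) *: z]scalerA Hz // scaler0.
  suff : @pw A Q (submod (line z)) 2 `<=` ker (subval (line z)) by exact.
  apply: pwS_min; first exact: ker_submodule.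
  move=> q x Qq /Q1 Hx; change (subval (line z) (q *: x) = 0).
  have -> : subval (line z) (q *: x) = q *: subval (line z) x by exact: linearZ.
  exact: Hx.
have [w wE] : exists w : submod (line z), \val w = z.
  by apply: (submod_mem (line_submodule z)); exists 1; rewrite ?scale1r.
by rewrite -wE; exact: (tors_lin (subval _) (flen_tors m_local aA fL w)).
Qed.

(* With b = u_k and a = u_n: modulo [bX : m^oo] the element a starts a d-sequence,
   which pushes x into [bX : m^oo] + aX; the component v in [bX : m^oo] lies in
   [abX : m^oo], so b v is a multiple of ab. *)
Lemma sat_inter I X N : acc X -> depth_pos m X -> (1 < module_dim X)%N -> uniq I ->
  (size I + module_dim X)%N = r -> killed I X ->
  (forall q, Q q -> forall z : DC 1 X, q *: z = 0) ->
  (forall k, (N <= k)%N -> [/\ good X k, k \notin I & concl (k :: I) (red X (u k))]) ->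
  exists N', forall n, (N' <= n)%N -> inter X n.
Proof.
move=> aX X0 d1 uI sI kI Hq HN; have d0 := ltnW d1.
have [sk kI' [_ _ [N1 HN1]]] := HN N (leqnn N); set k := N in sk kI' N1 HN1.
set Xk := red X (u k) in HN1; have aXk : acc Xk by exact: acc_red.
have Xk0 : depth_pos m Xk by exact: (red_depth st).
have dXk : (module_dim Xk).+1 = module_dim X by exact: (dim_red st).
have [N2 HN2] := good_generic st aXk; exists (maxn N (maxn N1 N2)) => n.
rewrite !geq_max => /and3P [/HN [sn nI _] /HN1 [J [uJ sJ hJ dJ]] /HN2 sXk] x sx Qx.
have br := good_regular st aX X0 sk; have ar := good_regular st aX X0 sn.
have arb := good_regular st aXk Xk0 sXk.
have QU y q z : (forall x : X, y *: x = 0 -> x = 0) -> Q q -> sat X y z -> rg X y (q *: z).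
  by move=> yr Qq; apply: sat_killed => //; exact: Hq.
case: J sJ hJ uJ dJ => [|n' J] sJ hJ uJ dJ; first by move: d1; rewrite -dXk -sJ.
have E1 : n' = n by []; subst n'.
have Tb := sat_submodule m X (u k); have Ta := sat_submodule m X (u n).
have [_ d2] : dsq (sat X (u k)) (u n :: map u J).
  by apply: dsq_pre dJ; [exact: tored_onto|exact: submodule0].
set S1 := addS _ _ in d2.
have HS1 : is_submodule S1 by apply: addS_submodule => //; exact: rg_submodule.
have [v [_ [bv [y _ <-] xE]]] : S1 x.
  apply: (dsq_descend HS1 d2).
    move=> _ /mapP [i _ ->]; apply: sub_addSr => //; apply: QU => //; exact: (mem_u st).
  have uJ' : uniq (I ++ (k :: n :: J)) by rewrite -[k :: _]cat1s uniq_catCA.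
  have sJ' : size (I ++ (k :: n :: J)) = r by rewrite size_cat /= -sI -dXk -sJ.
  have /= [_ [z [[b _ <-] [_ [z' [[a _ <-] lz E2]]] E3]]] := pw_gen st kI uJ' sJ' Qx.
  rewrite E3 E2; exists (u k *: b + u n *: a), z'; split; [| |by rewrite addrA].
    by exists (u k *: b), (u n *: a); split=> //; apply: rg_sat; exists b.
  by apply: (mulSS _ _ lz) => //; exact: submodule_setT.
rewrite xE; apply: (submodD (@rg_submodule A X (u n))); last by exists y.
have av : sat X (u n) v.
  rewrite -[v](addrK (mulm (u n) y)) -xE; apply: (submodB Ta) => //.
  by apply: rg_sat; exists y.
pose c := u n * u k; have cr (z : X) : c *: z = 0 -> z = 0.
  by rewrite -scalerA => /ar /br.
have cv : sat X c v.
  apply/satE; apply: tors_of_Q; first exact: acc_quot.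
  have L b z : qpi (rg X c) (b *: z) = b *: qpi (rg X c) z by exact: linearZ.
  move=> q q' Qq Qq'.
  have <- : qpi (rg X c) (q' *: (q *: v)) = q' *: (q *: qpi (rg X c) v) by rewrite !L.
  apply/(ker_qpi (rg_submodule X c)) => /=.
  have [w _ wE] := QU _ _ _ ar Qq av.
  (* Here u_n w = q v lies in the saturation for u_k, and u_n is regular modulo that saturation. *)
  have bw : sat X (u k) w.
    apply: arb; rewrite -linearZ; have := submodZ Tb q bv; rewrite -wE; exact.
  by have [w' _ w'E] := QU _ _ _ br Qq' bw; exists w' => //;
    rewrite -wE /mulm [RHS]scalerA [q' * _]mulrC -[RHS]scalerA -w'E /mulm scalerA.
have [w _ wE] := QU _ _ _ cr (mem_u st k) cv; exists w => //.
apply/eqP; rewrite -subr_eq0; apply/eqP/br; rewrite scalerBr -wE /mulm scalerA [u k * _]mulrC.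
exact: subrr.
Qed.

(** The torsion of X / aX is dual to [DC 0] of it, which is [DC 1 X] modulo a because [DC 0 X] is
    zero. *)
Lemma t0_mq X n : acc X -> depth_pos m X -> good X n ->
  flen (mq (DC 1 X) (u n)) /\ t0 (mq X (u n)) = module_length (mq (DC 1 X) (u n)).
Proof.
move=> aX X0 sX; have reg := good_regular st aX X0 sX.
have [p [q s]] := DC_ses E_env res 0 reg.
have aP : acc (mq X (u n)) by exact: acc_quot.
have [f0 <-] := DC0_len st E_env res aP.
have [fm _] := (ses_flen s).1 f0; split=> //; rewrite (ses_len s f0).
have [fD lD] := DC0_len st E_env res aX; rewrite (t0_0 X0) in lD.
have [_ le1 _] := inj_len (inj0_subval (S := @mk A (DC 0 X) (u n))) fD.
by move: le1; rewrite lD leqn0 => /eqP ->; rewrite addn0.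
Qed.

Lemma killed_all X N : (forall n, (N <= n)%N -> forall x : X, u n *: x = 0) ->
  forall q, Q q -> forall x : X, q *: x = 0.
Proof.
move=> H q Qq x.
apply: (general_position_colon (st_u st) (@submodule0 A X) (iota_uniq N r) (size_iota N r) _ Qq).
by move=> i; rewrite mem_iota => /andP [/H Hi _]; exact: Hi.
Qed.

Lemma red_torsion X n j : acc X -> hd (DC j.+1 (mq X (u n))) = hd (DC j.+1 (red X (u n))).
Proof.
move=> aX; have aP : acc (mq X (u n)) by exact: acc_quot.
apply: (hd_iso st m_complete E_env); first exact: (accDC st m_complete E_env).
exact: (DC_modt st m_complete E_env).
Qed.

End KilledDuals.

Section Pascal.

(** All binomials that occur are positive, so an equality between the sums is an equality in every
    term. *)
Lemma pascal_le t (p h : nat -> int) : (forall j, (j <= t)%N -> p j <= h j.+1 + h j) ->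
  \sum_(j < t.+1) 'C(t, j)%:Z * p j <= \sum_(j < t.+2) 'C(t.+1, j)%:Z * h j /\
  (\sum_(j < t.+2) 'C(t.+1, j)%:Z * h j <= \sum_(j < t.+1) 'C(t, j)%:Z * p j ->
    forall j, (j <= t)%N -> p j = h j.+1 + h j).
Proof.
move=> H; rewrite -pascal_sum.
have ge0 (j : 'I_t.+1) : true -> 'C(t, j)%:Z * p j <= 'C(t, j)%:Z * (h j.+1 + h j).
  by move=> _; rewrite ler_wpM2l // H // -ltnS.
have le1 : \sum_(j < t.+1) 'C(t, j)%:Z * p j <= \sum_(j < t.+1) 'C(t, j)%:Z * (h j.+1 + h j) by exact: ler_sum.
split=> // le2 j jt.
have : \sum_(i < t.+1) ('C(t, i)%:Z * (h i.+1 + h i) - 'C(t, i)%:Z * p i) == 0.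
  by rewrite sumrB subr_eq0 eq_le le1 le2.
rewrite psumr_eq0 => [/allP /(_ (Ordinal (jt : (j < t.+1)%N)))|i _]; last by rewrite subr_ge0 ge0.
rewrite mem_index_enum => /(_ isT) /implyP /(_ isT) /=.
rewrite -mulrBr mulf_eq0 subr_eq0 => /orP [|/eqP -> //].
by rewrite eqz_nat -leqn0 leqNgt bin_gt0 jt.
Qed.

End Pascal.

(** * The induction on the dimension *)

Section Main.
Variables (A : comNzRingType) (m Q : set A) (gs : seq A) (r : nat) (u : nat -> A) (E : lmodType A).
Hypothesis st : setting m Q gs r u.
Hypothesis m_complete : adically_complete m.
Hypothesis E_env : injective_envelope (cyclic_module m) E.
Variables (res : forall N : lmodType A, injective_resolution N).
Implicit Types X Y : lmodType A.
Local Notation DC := (@DC A m E res).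
Local Notation e i X := (hilbert_coef Q i X).
Local Notation hd := (hdeg m E res Q).
Local Notation t0 := (@t0 A m).
Local Notation killed I X := (killed u I X).
Local Notation good X n := (good Q u X n).
Local Notation inter X n := (@inter A m Q u X n).
Local Notation concl I X := (@concl A Q u I X).
Local Notation red X a := (@red A m X a).
Local Notation sg X := (@sgenus A Q X).

(** By Pascal's rule this is hdeg - e_0 - T^1: from the binomials (d - 1 over j) of hdeg, T^1
    removes (d - 2 over j - 1). *)
Definition genus_bound X : int :=
  \sum_(j < (module_dim X).-1) 'C((module_dim X).-2, j)%:Z * hd (DC j X).

(** The homological torsion with its summation index shifted to start at 0. *)
Definition hom_tors i X : int :=
  \sum_(j < module_dim X - i) 'C((module_dim X - i).-1, j)%:Z * hd (DC j.+1 X).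

(** The form in which unmixedness is carried through the induction. *)
Definition unmixed_dims X := forall j, (j.+1 < module_dim X)%N -> (module_dim (DC j.+1 X) <= j)%N.

Lemma hd_DC00 X : acc X -> depth_pos m X -> hd (DC 0 X) = 0.
Proof. by move=> aX X0; rewrite (hd_DC0 st m_complete E_env) // t0_0. Qed.

Section Step.
Variables (X : lmodType A) (t n : nat).
Hypotheses (aX : acc X) (X0 : depth_pos m X) (dX : module_dim X = t.+3) (sX : good X n).
Hypothesis HK : forall j, (j < t.+3)%N -> superficial Q (DC j X) (u n) /\
  hd (DC j (mq X (u n))) <= hd (DC j.+1 X) + hd (DC j X) /\
  (hd (DC j.+1 X) + hd (DC j X) <= hd (DC j (mq X (u n))) ->
      module_dim (DC j X) = 0%N /\ forall x : DC j X, u n *: x = 0).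
Local Notation a := (u n).
Local Notation P := (mq X a).
Local Notation X' := (red X a).
Local Notation p j := (hd (DC j P)).
Local Notation h j := (hd (DC j X)).

Let d0 : (0 < module_dim X)%N.
Proof. by rewrite dX. Qed.

Lemma step_dim : module_dim X' = t.+2.
Proof. by have := dim_red st aX sX d0; rewrite dX => -[]. Qed.

Let aP : acc P.
Proof. exact: acc_quot. Qed.

Let aX' : acc X'.
Proof. by apply: acc_red. Qed.

Let X'0 : depth_pos m X'.
Proof. exact: (red_depth st aX). Qed.

Lemma step_p0 : p 0 = (t0 P)%:Z.
Proof. exact: (hd_DC0 st m_complete E_env). Qed.

Lemma step_pS j : p j.+1 = hd (DC j.+1 X').
Proof. exact: (red_torsion st m_complete E_env). Qed.

Lemma step_p_le j : (j <= t)%N -> p j <= h j.+1 + h j.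
Proof. by move=> jt; have [_ [le1 _]] := HK (leqW (leqW (jt : (j < t.+1)%N))). Qed.

Lemma step_sgenus : sg X = sg X' + (hl Q P 1)%:Z - (hl Q X' 1)%:Z.
Proof.
rewrite /sgenus -(hl1_mq st n aX) (e_red st aX X0 sX d0) ?dX // (e_red st aX X0 sX d0) ?dX //.
have E1 (x y z w : int) : x - y + z = w - y + z + x - w.
  by rewrite -[w - y + z]addrA [w + _]addrC [RHS]addrAC addrK [RHS]addrC addrA.
exact: E1.
Qed.

Lemma step_sgenus_le : sg X <= sg X' + (t0 P)%:Z.
Proof.
rewrite step_sgenus -addrA lerD2l lerBlDr -PoszD lez_nat addnC; exact: (hl_red_le st n aX).
Qed.

Lemma step_sgenus_eq : inter X n -> sg X = sg X' + (t0 P)%:Z.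
Proof.
by move=> Hi; rewrite step_sgenus (inter_hl st aX 0 Hi) PoszD addrA addrAC addrK.
Qed.

Lemma step_bound : genus_bound X = \sum_(j < t.+2) 'C(t.+1, j)%:Z * h j.
Proof. by rewrite /genus_bound dX. Qed.

Lemma step_bound_red : (t0 P)%:Z + genus_bound X' = \sum_(j < t.+1) 'C(t, j)%:Z * p j.
Proof.
rewrite /genus_bound step_dim [LHS]addrC 2!big_ord_recl /= bin0 !mul1r hd_DC00 // add0r step_p0 addrC.
by congr (_ + _); apply: eq_bigr => j _; rewrite step_pS.
Qed.

Lemma step_tors i : (i <= t.+1)%N -> hom_tors i X = \sum_(j < (t.+1 - i).+2) 'C((t.+1 - i).+1, j)%:Z * h j.+1.
Proof. by move=> it; rewrite /hom_tors dX (subSn (leqW it)) (subSn it). Qed.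

Lemma step_tors_red i : (i <= t.+1)%N ->
  hom_tors i X' = \sum_(j < (t.+1 - i).+1) 'C(t.+1 - i, j)%:Z * p j.+1.
Proof.
by move=> it; rewrite /hom_tors step_dim (subSn it); apply: eq_bigr => j _; rewrite step_pS.
Qed.

Lemma step_tors_last : hom_tors t.+2 X = h 1.
Proof. by rewrite /hom_tors dX subSn // subnn big_ord_recl big_ord0 /= mul1r addr0. Qed.

Lemma step_tors_le i : (2 <= i <= t.+1)%N -> hom_tors i X' <= hom_tors i X /\
  (hom_tors i X <= hom_tors i X' -> forall j, (j <= t.+1 - i)%N -> p j.+1 = h j.+2 + h j.+1).
Proof.
move=> /andP [i2 it]; rewrite step_tors // step_tors_red //.
apply: (@pascal_le _ (fun j => p j.+1) (fun j => h j.+1)) => j jt; apply: step_p_le.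
by apply: leq_ltn_trans jt _; rewrite ltn_subLR //; exact: (leq_add i2 (leqnn t)).
Qed.

Lemma step_tors_eq i : (2 <= i <= t.+1)%N ->
  (forall j, (1 <= j <= t)%N -> p j = h j.+1 + h j) -> hom_tors i X' = hom_tors i X.
Proof.
move=> /andP [i2 it] H; rewrite step_tors // step_tors_red // -(pascal_sum _ (fun j => h j.+1)).
apply: eq_bigr => -[j jt] _ /=; rewrite H //=.
apply: leq_ltn_trans (jt : (j <= t.+1 - i)%N) _.
by rewrite ltn_subLR //; exact: (leq_add i2 (leqnn t)).
Qed.

(** [DC j.+1] of the reduction is an extension of a module of finite length by [DC j.+2 X] modulo a,
    where a superficial element lowers a positive dimension by one. *)
Lemma step_unmixed : unmixed_dims X -> unmixed_dims X'.
Proof.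
move=> U j; rewrite step_dim => jt.
rewrite -(dim_iso st (DC_modt st m_complete E_env res j aP)).
have [f [g s]] := DC_ses E_env res j.+1 (good_regular st aX X0 sX).
apply: leq_trans (dim_ses st s) _; rewrite geq_max; apply/andP; split; last first.
  have [sD _] := HK (leqW (jt : (j.+1 < t.+2)%N)).
  have aD : acc (DC j.+1 X) by apply: (accDC st m_complete E_env).
  have fK := sup_ker_flen st aD sD.
  by rewrite ((dim0P st (flen_acc fK)).2 fK).
have [sD _] := HK (jt : (j.+2 < t.+3)%N).
have aD : acc (DC j.+2 X) by apply: (accDC st m_complete E_env).
have := U j.+1; rewrite dX => /(_ jt) le1.
have [dD|dD] := posnP (module_dim (DC j.+2 X)); last first.
  by rewrite -ltnS (dim_mq st aD (mem_u st n) sD dD).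
apply: leq_trans (_ : module_dim (DC j.+2 X) <= _)%N; last by rewrite dD.
exact: (dim_onto st (surj_qpi (S := range (@mulm A (DC j.+2 X) a : {linear _ -> _})))).
Qed.

(** Only in dimension 3 is e_2 the last coefficient of X / aX, which removing the torsion alters. *)
Lemma step_e2 : e 2 X = e 2 X' + (if t is 0%N then (t0 P)%:Z else 0).
Proof.
case: t dX => [|t'] dX'; last by rewrite addr0 (e_red st aX X0 sX d0) // dX'.
by rewrite (e_red_last st aX X0 sX d0) ?dX' // expr2 mulrNN !mul1r.
Qed.

Lemma step_t0_le : (t0 P)%:Z <= h 1.
Proof. by rewrite -step_p0; apply: le_trans (step_p_le (leq0n t)) _; rewrite hd_DC00 // addr0. Qed.

Lemma step_e2_le : e 2 X' <= hom_tors 2 X' -> e 2 X <= hom_tors 2 X.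
Proof.
move=> le1; rewrite step_e2; case: t dX step_tors_last (@step_tors_le 2) => [|t'] dX' E1 H.
  rewrite E1; apply: le_trans (lerD le1 step_t0_le) _.
  have -> : hom_tors 2 X' = 0 by rewrite /hom_tors (_ : module_dim X' = 2%N) ?big_ord0 //; apply/eqP; rewrite -eqSS (dim_red st aX sX d0) dX'.
  by rewrite add0r.
by rewrite addr0; apply: le_trans le1 _; have [] := H isT.
Qed.

Lemma step_e2_tors : (forall j, (j <= t)%N -> p j = h j.+1 + h j) ->
  e 2 X' = hom_tors 2 X' -> e 2 X = hom_tors 2 X.
Proof.
move=> pE e2'; rewrite step_e2 e2'; have := pE 0%N (leq0n t); rewrite (hd_DC00 aX X0) addr0 step_p0.
case: (posnP t) => [t_0 ->|t_gt0 _].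
  rewrite [X in if X is 0%N then _ else _]t_0 /hom_tors step_dim t_0 subnn big_ord0 add0r.
  by rewrite -step_tors_last /hom_tors t_0.
have -> : (if t is 0%N then (t0 P)%:Z else 0) = 0 by case: t t_gt0.
by rewrite addr0; apply: step_tors_eq => // j /andP [_]; exact: pE.
Qed.

(** In dimension at least 4 equality propagates through T^2 term by term, and each equal term forces
    a to kill the dual concerned. In dimension 3 the torsion of X / aX accounts for all of hdeg of
    [DC 1 X]. *)
Lemma step_e2_eq : e 2 X' <= hom_tors 2 X' -> e 2 X = hom_tors 2 X -> unmixed_dims X ->
  [/\ e 2 X' = hom_tors 2 X', (t0 P)%:Z = h 1, forall x : DC 1 X, a *: x = 0 &
    forall j, (1 <= j <= t)%N -> p j = h j.+1 + h j /\ forall x : DC j X, a *: x = 0].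
Proof.
move=> le1 eX U; have aD1 : acc (DC 1 X) by apply: (accDC st m_complete E_env).
have [fq lq] := t0_mq st E_env res aX X0 sX.
have Hp j : (1 <= j <= t)%N -> p j = h j.+1 + h j -> module_dim (DC j X) = 0%N /\ forall x : DC j X, a *: x = 0.
  by move=> /andP [_ jt] E1; have [_ [_ H]] := HK (leqW (leqW (jt : (j < t.+1)%N))); apply: H; rewrite E1.
move: step_e2 (step_t0_le); rewrite eX; case: (posnP t) => [t_0|t_gt0].
  have T' : hom_tors 2 X' = 0 by rewrite /hom_tors step_dim t_0 subnn big_ord0.
  have T : hom_tors 2 X = h 1 by rewrite -step_tors_last t_0.
  rewrite [X in if X is 0%N then _ else _]t_0 T => E1 le2; rewrite T' in le1.
  have E2 : (t0 P)%:Z = h 1 by apply/eqP; rewrite eq_le le2 /= E1 gerDr.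
  split=> //; last by move=> j /andP [j1 jt]; move: (leq_trans j1 jt); rewrite t_0.
    by rewrite T'; move: E1; rewrite E2 => /eqP; rewrite -subr_eq0 opprD addrCA subrr addr0 oppr_eq0 => /eqP.
  (* Finite length is essential here: then [DC 1 X] and its quotient by a have the same length, and
     a acts as zero. *)
  have d1 : module_dim (DC 1 X) = 0%N by apply/eqP; rewrite -leqn0; apply: U; rewrite dX.
  have fD := (dim0P st aD1).1 d1; rewrite (hd_flen st m_complete E_env) // lq in E2.
  have [_ _ H] := surj_len (surj_qpi (S := range (@mulm A (DC 1 X) a : {linear _ -> _}))) fD.
  case: E2 => E2 x; have le3 : (module_length (DC 1 X) <= module_length (mq (DC 1 X) a))%N by rewrite E2.
  apply: (H le3); apply/(ker_qpi (range_submodule _)); by exists x.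
have -> : (if t is 0%N then (t0 P)%:Z else 0) = 0 by case: t t_gt0.
rewrite addr0 => E1 _; have [le2 H] := @step_tors_le 2 t_gt0.
have E2 : hom_tors 2 X' = hom_tors 2 X by apply/eqP; rewrite eq_le le2 E1.
have pE j : (1 <= j <= t)%N -> p j = h j.+1 + h j.
  case: j => [//|j] /= jt; apply: H; first by rewrite E2.
  by rewrite subn2 /= -ltnS (prednK t_gt0).
have [d1 k1] := Hp 1%N t_gt0 (pE 1%N t_gt0).
have fD := (dim0P st aD1).1 d1.
split=> //; first by rewrite -E1 E2.
  rewrite lq (hd_flen st m_complete E_env) //; congr Posz.
  have WI : iso (DC 1 X) (mq (DC 1 X) a).
    exists (qpi (range (@mulm A (DC 1 X) a : {linear DC 1 X -> DC 1 X}))); split; last exact: surj_qpi.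
    by move=> x /(ker_qpi (range_submodule _)) [y _ <-]; exact: k1.
  by have [_ ->] := iso_flen WI fD.
by move=> j Hj; have E3 := pE j Hj; split=> //; have [] := Hp j Hj E3.
Qed.

End Step.

(** With dimension s + 2 the bound j < s is the range up to dim - 3. The claims are proved together:
    the implication from the genus to e_2 uses itself for one reduction, the converse uses
    everything for all reductions with large index. *)
Theorem main_induction s X I : acc X -> depth_pos m X -> module_dim X = s.+2 -> uniq I ->
  (size I + s.+2)%N = r -> killed I X ->
  [/\ sg X <= genus_bound X, e 2 X <= hom_tors 2 X,
    sg X = genus_bound X -> e 2 X = hom_tors 2 X &
    e 2 X = hom_tors 2 X -> unmixed_dims X ->
    [/\ sg X = genus_bound X, concl I X,
      forall i, (2 <= i < s.+2)%N -> (-1) ^+ i * e i X = hom_tors i X &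
      forall j, (1 <= j < s)%N -> forall q, Q q -> forall x : DC j X, q *: x = 0]].
Proof.
elim: s X I => [|t IH] X I aX X0 dX uI sI kI; have d0 : (0 < module_dim X)%N by rewrite dX.
  have [N1 H1] := good_generic st aX; have [N2 H2] := notin_generic I.
  (* In dimension 2 the bound is hdeg of [DC 0 X], zero by positive depth, and T^2 is an empty
     sum. *)
  have B0 : genus_bound X = 0.
    by rewrite /genus_bound dX big_ord_recl big_ord0 /= mul1r addr0 hd_DC00.
  have T0 : hom_tors 2 X = 0 by rewrite /hom_tors dX subnn big_ord0.
  have Hn n : (maxn N1 N2 <= n)%N -> [/\ good X n, n \notin I, concl (n :: I) (red X (u n)) &
      [/\ sg X <= 0, e 2 X <= 0, sg X = 0 -> inter X n & e 2 X = 0 -> inter X n]].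
    rewrite geq_max => /andP [/H1 sX /H2 nI].
    have cX : concl (n :: I) (red X (u n)).
      apply: (concl_dim1 st).
      - exact: acc_red.
      - exact: (red_depth st aX).
      - by have := dim_red st aX sX d0; rewrite dX => -[].
      - by rewrite /= nI.
      - by rewrite /= addn1 -sI !addnS addn0.
      - exact: killed_red.
    by split=> //; exact: (dim2_inter st aX X0 dX sX cX).
  have step : (forall n, (maxn N1 N2 <= n)%N -> inter X n) -> concl I X.
    move=> Hi; apply: (@concl_step _ _ _ _ _ _ st I X (maxn N1 N2)); rewrite ?dX //.
    by move=> n Nn; have [] := Hn n Nn; split=> //; exact: Hi.
  rewrite B0 T0; have [_ _ _ [le1 le2 _ _]] := Hn _ (leqnn _); split=> //.
    move=> g0; have c : concl I X by apply: step => n /Hn [_ _ _ [_ _ H _]]; exact: H.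
    by have [] := concl_sgenus2 dX c.
  move=> e20 _; have c : concl I X by apply: step => n /Hn [_ _ _ [_ _ _ H]]; exact: H.
  split=> //; first by have [] := concl_sgenus2 dX c.
    by case=> [|[|i]].
  by move=> j; rewrite ltn0 andbF.
have [N1 H1] := hd_DC_generic st m_complete E_env res t.+3 aX X0; have [N2 H2] := notin_generic I.
set N := maxn N1 N2.
have [Hg Hk HnI] : [/\ forall n, (N <= n)%N -> good X n, forall n, (N <= n)%N -> forall j, (j < t.+3)%N ->
    superficial Q (DC j X) (u n) /\ hd (DC j (mq X (u n))) <= hd (DC j.+1 X) + hd (DC j X) /\
    (hd (DC j.+1 X) + hd (DC j X) <= hd (DC j (mq X (u n))) ->
      module_dim (DC j X) = 0%N /\ forall x : DC j X, u n *: x = 0) &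
    forall n, (N <= n)%N -> n \notin I].
  split=> n; rewrite geq_max => /andP [Hn1 Hn2]; [by have [] := H1 n Hn1| |exact: H2].
  by have [] := H1 n Hn1.
have HuI n : (N <= n)%N -> uniq (n :: I) by move=> Nn; rewrite /= HnI.
have HsI n : (size (n :: I) + t.+2)%N = r by rewrite /= -sI !addnS.
have IHn n (Nn : (N <= n)%N) := IH (red X (u n)) (n :: I) (@acc_red A m u X n aX)
  (@red_depth _ _ _ _ _ _ st X n aX) (step_dim aX dX (Hg n Nn)) (HuI n Nn) (HsI n) (killed_red (m := m) (n := n) kI).
have NN := leqnn N; have [G' E' Eq1 _] := IHn N NN.
have le1 := step_sgenus_le aX X0 dX (Hg N NN).
have BP := step_bound_red aX dX (Hg N NN).
have [le2 eq2] := pascal_le (step_p_le (Hk N NN)).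
rewrite -(step_bound dX) -BP in le2 eq2.
split.
- apply: le_trans le1 (le_trans _ le2); rewrite addrC lerD2l; exact: G'.
- exact: (step_e2_le aX X0 dX (Hg N NN) (Hk N NN)).
(* An extremal genus leaves no slack in either inequality: all Pascal terms are equalities, and the
   reduction has extremal genus too. *)
- move=> gE.
  have le3 : genus_bound X <= (t0 (mq X (u N)))%:Z + genus_bound (red X (u N)).
    by rewrite -gE; apply: le_trans le1 _; rewrite addrC lerD2l.
  have pE := eq2 le3.
  have gE' : sg (red X (u N)) = genus_bound (red X (u N)).
    apply/eqP; rewrite eq_le G' /= -(lerD2r (t0 (mq X (u N)))%:Z) [_ + (t0 _)%:Z]addrC.
    by apply: le_trans le2 _; rewrite -gE.
  exact: (step_e2_tors aX X0 dX (Hg N NN) pE (Eq1 gE')).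
move=> e2E U.
(* Every large n is used, since elements of Q are reached only through r of the u_n. *)
have F n Nn := step_e2_eq aX X0 dX (Hg n Nn) (Hk n Nn) (let: And4 _ E' _ _ := IHn n Nn in E') e2E U.
have Q1 q : Q q -> forall x : DC 1 X, q *: x = 0.
  by apply: (killed_all st (N := N)) => n Nn; have [] := F n Nn.
have cX' n : (N <= n)%N -> [/\ sg (red X (u n)) = genus_bound (red X (u n)), concl (n :: I) (red X (u n)) &
    forall i, (2 <= i < t.+2)%N -> (-1) ^+ i * e i (red X (u n)) = hom_tors i (red X (u n))].
  move=> Nn; have [_ _ _ H] := IHn n Nn; have [e2' _ _ _] := F n Nn.
  by have [] := H e2' (step_unmixed aX X0 dX (Hg n Nn) (Hk n Nn) U).
have [N' HN'] : exists N', forall n, (N' <= n)%N -> inter X n.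
  apply: (sat_inter st E_env aX X0 _ uI _ kI Q1 (N := N)); rewrite ?dX //.
  by move=> k Nk; have [_ ck _] := cX' k Nk; split=> //; [exact: Hg|exact: HnI].
set n := maxn N N'; have Nn : (N <= n)%N by exact: leq_maxl.
have Hi : inter X n by apply: HN'; exact: leq_maxr.
have [_ t0E _ pE] := F n Nn; have [gE' [_ eL _] gam'] := cX' n Nn.
rewrite (step_dim aX dX (Hg n Nn)) in eL.
split.
- rewrite (step_sgenus_eq aX X0 dX (Hg n Nn) Hi) gE' addrC (step_bound_red aX dX (Hg n Nn)).
  rewrite (step_bound dX) -(pascal_sum t (fun j => hd (DC j X))); apply: eq_bigr => -[[|j] jt] _ /=.
    by rewrite (step_p0 _ aX) t0E (hd_DC00 aX X0) addr0.
  by have [] := pE j.+1 jt; move=> ->.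
- apply: (@concl_step _ _ _ _ _ _ st I X n); rewrite ?dX //.
  move=> k nk; have Nk : (N <= k)%N by apply: leq_trans nk.
  by have [_ ck _] := cX' k Nk; split=> //; [exact: Hg|exact: HnI|apply: HN'; apply: leq_trans nk; exact: leq_maxr].
(* In the top index the reduction has vanishing coefficient, so only the torsion of X / u_n X
   remains, of length hdeg of [DC 1 X]. *)
- move=> i /andP [i2]; rewrite ltnS leq_eqVlt => /orP [/eqP ->|it].
    rewrite (step_tors_last dX) (e_red_last st aX X0 (Hg n Nn) d0) ?dX // eL add0r mulrA -expr2 sqrr_sign mul1r.
    exact: t0E.
  rewrite (e_red st aX X0 (Hg n Nn) d0) ?dX // gam' ?i2 //.
  by apply: (step_tors_eq aX dX (Hg n Nn)); rewrite ?i2 // => j /pE [].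
move=> j /andP [j1 jt] q Qq.
apply: (killed_all st (N := N)) Qq => k Nk; have [_ _ _ H] := F k Nk.
have Hj : (1 <= j <= t)%N by rewrite j1.
by have [] := H j Hj.
Qed.

End Main.

(** * From a parameter ideal to the standing hypotheses *)

Section ParameterSetting.
Variables (A : comNzRingType) (m Q : set A).

(** A positive value of [chain_length] is not its default value, hence comes from an actual bound on
    chains. *)
Lemma fin_chain_krull (T : Type) (P : set (set T)) : (0 < chain_length P)%N -> fin_chain P.
Proof.
rewrite /chain_length; case: xgetP => [n _ [_ nP] _|_]; last by rewrite ltnn.
by exists n.+1.
Qed.

Lemma parameter_setting k (a : 'I_k -> A) : is_local m -> acc (A^o : lmodType A) ->
  infinite_set [set: cyclic_module m] -> krull_dim [set (0 : A)] = k -> (0 < k)%N ->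
  radical Q = m -> Q = ideal_span (range a) ->
  exists u, setting m Q [seq a i | i <- enum 'I_k] k u.
Proof.
move=> m_local aA inf dA k0 radQ QE; set gs := map _ _.
have gsE : @lspan A A^o gs = Q.
  rewrite QE; apply/seteqP; split.
    apply: (@lspan_min A A^o); first exact: submod_span_submodule.
    by move=> _ /mapP [i _ ->]; apply: sub_submod_span; exists i.
  apply: (@submod_span_min A A^o); first exact: lspan_submodule.
  by move=> _ [i _ <-]; apply: (@lspan_mem A A^o); apply: map_f; rewrite mem_enum.
have sg : size gs = k by rewrite size_map size_enum_ord.
have [u ug] := exists_general_position m_local gs inf; rewrite gsE sg in ug.
exists u; split=> //.
- by rewrite -radQ => q Qq; exists 1%N; rewrite expr1.
- by rewrite -radQ.
- by apply: fin_chain_krull; rewrite -/(krull_dim [set (0 : A)]) dA.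
Qed.

Lemma ideal_pow1 : is_submodule (Q : set A^o) -> ideal_pow Q 1 = Q.
Proof.
move=> HQ; apply/seteqP; split.
  by apply: ideal_powS_min => // q b Qq _; rewrite mulrC; exact: (submodZ HQ).
by move=> q Qq; rewrite -[q]mulr1; exact: ideal_powS_mem.
Qed.

End ParameterSetting.

Theorem theorem1p4 (A : comNzRingType) (m : set A) (d : nat)
    (E : lmodType A)
    (res : forall N : lmodType A, injective_resolution N)
    (M : lmodType A) (Q : set A)
    (A_local : is_local m)
    (A_noetherian : noetherian A)
    (A_complete : adically_complete m)
    (residue_infinite : infinite_set [set: cyclic_module m])
    (E_envelope : injective_envelope (cyclic_module m) E)
    (dim_A : krull_dim [set (0 : A)] = d)
    (M_fg : finitely_generated M)
    (dim_M : module_dim M = d)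
    (d_ge3 : (3 <= d)%N)
    (M_unmixed : unmixed M)
    (Q_parameter : parameter_ideal m Q) :
  let e := fun i => hilbert_coef Q i M in
  let T := fun i => homological_torsion m E res Q i M in
  let cond1 := sectional_genus Q M = hdeg m E res Q M - e 0%N - T 1%N in
  let cond2 := e 2%N = T 2%N in
  (cond1 <-> cond2) /\
  (cond1 ->
    [/\ (forall i, (3 <= i <= d.-1)%N -> (-1) ^+ i * e i = T i) /\ e d = 0,
        forall n : nat, (module_length (mod_ideal M (ideal_pow Q n.+1)))%:Z =
          \sum_(i < d.+1) (-1) ^+ i * e i * 'C(n + d - i, d - i)%:Z,
        exists a : 'I_d -> A, Q = ideal_span (range a) /\ d_sequence M a
      & forall i, (1 <= i <= d - 3)%N ->
          forall (q : A) (h : local_cohomology m res i M),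
            Q q -> q *: h = 0]).
Proof.
have m_local := A_local; have aA := noetherian_acc A_noetherian.
have aM := fg_acc A_noetherian M_fg; have [radQ [a QE]] := Q_parameter.
rewrite dim_A in a QE; have d0 : (0 < d)%N by apply: leq_trans d_ge3.
have [u st] := parameter_setting m_local aA residue_infinite dim_A d0 radQ QE.
have M0 : depth_pos m M by apply: (unmixed_depth st) => //; rewrite dim_M.
have U : unmixed_dims m E res M.
  by move=> j jd; exact: (unmixed_dim st A_complete E_envelope).
have HQ : is_submodule (Q : set A^o) by exact: gens_ideal (st_gs st).
move=> e T cond1 cond2.
case: d => [//|[|s]] // in a QE d_ge3 dim_A dim_M d0 st *.
(* At the start nothing is divided out: I is empty and r = d = s + 2. *)
have [_ _ H12 H21] := main_induction st A_complete E_envelope res (I := [::]) aM M0 dim_M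
  isT (add0n _) (fun i (iI : i \in [::]) => False_ind _ (notF iI)).
have TE i : T i = hom_tors m Q E res i M.
  rewrite /T /homological_torsion /hom_tors big_add1 big_mkord subn1.
  by apply: eq_bigr => j _; rewrite subn1.
have c1E : cond1 <-> sgenus Q M = genus_bound m Q E res M.
  rewrite /cond1 TE /sectional_genus /mod_ideal -{1}(ideal_pow1 HQ) -/(hl Q M 1) -/(sgenus Q M).
  suff -> : hdeg m E res Q M - e 0%N - hom_tors m Q E res 1 M = genus_bound m Q E res M by [].
  rewrite (hd_dimS st A_complete E_envelope) ?dim_M // [hilbert_coef Q 0 M + _]addrC addrK.
  (* Pascal's rule splits the sum in hdeg M into T^1 and the genus bound. *)
  rewrite /hom_tors /genus_bound dim_M subSS subn0 /= -(pascal_sum s (fun j => hdeg m E res Q (DC m E res j M))).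
  under [X in X - _]eq_bigr => j _ do rewrite mulrDr.
  by rewrite big_split /= [X in X - _]addrC addrK.
have c2E : cond2 <-> e 2%N = hom_tors m Q E res 2 M by rewrite /cond2 TE.
split.
  by rewrite c1E c2E; split=> // H; have [] := H21 H U.
move=> /c1E /H12 H; have [_ [F eL [N HN]] gam kil] := H21 H U.
rewrite dim_M in F eL; split.
- split=> [i /andP [i3 it]|//]; rewrite TE; apply: gam.
  by rewrite (ltnW i3) ltnS.
- move=> n; rewrite -[LHS]/((hl Q M n.+1)%:Z) F /hval.
  by apply: eq_bigr => i _; rewrite addnBA // -ltnS.
- have [J [uJ sJ _ dJ]] := HN N (leqnn N); rewrite dim_M in sJ.
  exists (fun i : 'I_s.+2 => nth 0 (map u J) i); split; last first.
    by apply: (dsq_d_sequence (l := map u J)) => //; rewrite size_map.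
  (* The d-sequence consists of d distinct terms of u, which generate Q by general position. *)
  have [uQ ugen] := st_u st.
  apply/seteqP; split=> [q /(ugen J uJ sJ)|].
    apply: (@lspan_min A A^o); first exact: submod_span_submodule.
    move=> x /(nthP 0) [i]; rewrite size_map sJ => id <-.
    by apply: sub_submod_span; exists (Ordinal id).
  apply: (@submod_span_min A A^o _ _ HQ) => _ [i _ <-].
  by rewrite (nth_map 0%N) ?sJ //; exact: uQ.
- move=> i /andP [i1 it] q h Qq.
  (* Q kills the dual of H^i, and E separates the points of H^i itself. *)
  apply: (coh_killed st E_envelope) => x; apply: kil => //.
  by rewrite i1 /=; apply: leq_ltn_trans it _; rewrite ltn_subLR.
Qed.
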